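(* Let $\lambda$ be a dominant weight, let $\Gamma=(\beta_1,\dots,\beta_N)$ be a $\lambda$-chain, suppose that for some $t\ge 0$ and $q\ge2$ the roots $\beta_{t+1},\dots,\beta_{t+q}$ are, without repetition, the positive roots of a rank two root system $\overline\Phi\subseteq\Phi$, let $\Gamma'$ be the $\lambda$-chain obtained from $\Gamma$ by reversing this segment, and let $Y:\mathcal A(\Gamma)\to\mathcal A(\Gamma')$ be the corresponding Yang-Baxter move. Then the root operators commute with $Y$; that is, for every $p\in\{1,\dots,r\}$ and every $J\in\mathcal A(\Gamma)$, the root operator $F_p$ is defined on $J$ if and only if it is defined on $Y(J)$, and in this case $$Y(F_p(J))=F_p(Y(J)).$$
   Context: **Root system.** $\Phi\subset\mathfrak h^*_{\mathbb R}$ is an irreducible finite root system of rank $r$, with positive roots $\Phi^+$, simple roots $\alpha_1,\dots,\alpha_r$, $W$-invariant scalar product $\langle\cdot,\cdot\rangle$ and coroots $\alpha^\vee=2\alpha/\langle\alpha,\alpha\rangle$. For a root $\alpha$, $\mathrm{sgn}(\alpha)=\pm1$ according to whether $\alpha$ is positive or negative, and $|\alpha|=\mathrm{sgn}(\alpha)\alpha$. $W$ is the Weyl group, generated by the reflections $s_\alpha$, with length function $\ell$. Bruhat order on $W$: $w\lessdot u$ means $u=ws_\beta$ for some $\beta\in\Phi^+$ and $\ell(u)=\ell(w)+1$; $<$ is the transitive closure. A weight $\lambda$ ($\langle\lambda,\alpha^\vee\rangle\in\mathbb Z$ for all $\alpha\in\Phi$) is dominant if $\langle\lambda,\alpha^\vee\rangle\ge0$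 for all $\alpha\in\Phi^+$. For $\alpha\in\Phi$, $k\in\mathbb Z$: $H_{\alpha,k}=\{x\mid\langle x,\alpha^\vee\rangle=k\}$, and $s_{\alpha,k}(x)=x-(\langle x,\alpha^\vee\rangle-k)\alpha$. **$\lambda$-chains.** Alcoves are the connected components of the complement of all hyperplanes $H_{\alpha,k}$; $A_\circ=\{x\mid 0<\langle x,\alpha^\vee\rangle<1\ \forall\alpha\in\Phi^+\}$. $A\xrightarrow{\beta}B$ means that $A,B$ are distinct alcoves with a common wall, which lies in some $H_{\beta,k}$, and $\beta$ points from $A$ to $B$. A $\lambda$-chain is a sequence of positive roots $(\beta_1,\dots,\beta_N)$ such that there is an alcove path $A_\circ=A_0\xrightarrow{-\beta_1}\cdots\xrightarrow{-\beta_N}A_N=A_\circ-\lambda$ of minimal length among alcove paths from $A_\circ$ to $A_\circ-\lambda$. Put $l_i^\emptyset=\#\{j<i\mid\beta_j=\beta_i\}$, $r_i=s_{\beta_i}$, $\widehat r_i=s_{\beta_i,-l_i^\emptyset}$. **Admissible subsets.** $J=\{j_1<\dots<j_s\}\subseteq\{1,\dots,N\}$ is admissible if $1\lessdot r_{j_1}\lessdot r_{j_1}r_{j_2}\lessdot\cdots\lessdot r_{j_1}\cdots r_{j_s}$. $\mathcal A(\Gamma)$ is the set of admissible subsets; $w(J)=r_{j_1}\cdots r_{j_s}$, $\mu(J)=-\widehat r_{j_1}\cdots\widehat r_{j_s}(-\lambda)$; $w(\cdot)$ is also used for initial parts of $J$. **Root operators.** Let $J=\{j_1<\dots<j_s\}\in\mathcal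 A(\Gamma)$ and $p\in\{1,\dots,r\}$. For $i\in\{1,\dots,N\}$ let $j_1<\dots<j_d$ be the elements of $J$ smaller than $i$; put $\gamma_i=r_{j_1}\cdots r_{j_d}(\beta_i)$ and define $l_i\in\mathbb Z$ by $\widehat r_{j_1}\cdots\widehat r_{j_d}(H_{\beta_i,-l_i^\emptyset})=H_{-|\gamma_i|,l_i}$. Let $l_\infty^p=\langle\mu(J),\alpha_p^\vee\rangle$, $I(J,p)=\{i\mid\gamma_i=\pm\alpha_p\}$, and let $M(J,p)$ be the maximum of $l_\infty^p$ and all $l_i$, $i\in I(J,p)$. $F_p$ is defined on $J$ iff $M(J,p)>0$; then let $m=\min\{i\in I(J,p)\mid l_i=M(J,p)\}$ ($m=\infty$ if this set is empty), let $k$ be the predecessor of $m$ in $I(J,p)\cup\{\infty\}$ (it exists), and set $F_p(J)=(J\setminus\{m\})\cup\{k\}$. The same definitions apply to $\mathcal A(\Gamma')$. **Yang-Baxter move.** With $\Gamma$, $t$, $q$, $\overline\Phi$ as in the claim, $\alpha=\beta_{t+1}$, $\beta=\beta_{t+q}$ are the simple roots of $\overline\Phi$, and $\overline W=\langle s_\alpha,s_\beta\rangle$ is the corresponding dihedral group of order $2q$; $\Gamma'$ is again a $\lambda$-chain. For $J\in\mathcal A(\Gamma)$ put $u=w(J\cap\{1,\dots,t\})$, $w=w(J\cap\{1,\dots,t+q\})$, write $u=v\overline u$, $w=v\overline w$ with $v$ the minimal length representative of $u\overline W=w\overline W$ and $\overline u,\overline w\in\overline W$, and let $a,b$ be the lengths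 of $\overline u,\overline w$ in $\overline W$ with respect to the generators $s_\alpha,s_\beta$. Let $S=\{i\in\{1,\dots,q\}\mid t+i\in J\}$. Then $Y(J)=(J\setminus\{t+1,\dots,t+q\})\cup\{t+i\mid i\in Y_{q,a,b}(S)\}$, where the involution $Y_{q,a,b}$ is given by: - $\emptyset\leftrightarrow\emptyset$ if $a=b$; - $\{1\}\leftrightarrow\{q\}$ if $0\le a=b-1\le q-1$; - $\{q-a\}\leftrightarrow\{a+1\}$ if $0<a=b-1<q-1$; - $\{1,a+2,a+3,\dots,b\}\leftrightarrow\{a+1,a+2,\dots,b-1,q\}$ if $0\le a<a+2\le b<q$; - $\{1,a+2,a+3,\dots,b-1,q\}\leftrightarrow\{a+1,a+2,\dots,b\}$ if $0<a<a+2\le b\le q$ (for $b=a+2$ the sequence $a+2,\dots,b-1$ is empty); - $\{1,\dots,q\}\leftrightarrow\{1,\dots,q\}$ if $a=0$, $b=q$. (The set $S$ always appears in this list, and $Y$ is a bijection $\mathcal A(\Gamma)\to\mathcal A(\Gamma')$.) *)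

(* Defs.v *)
From HB Require Import structures.
From mathcomp Require Import all_boot all_order all_algebra.
From mathcomp Require Import all_classical all_reals all_analysis.
Import Order.TTheory GRing.Theory Num.Theory.
Import numFieldNormedType.Exports.

Set Implicit Arguments.
Unset Strict Implicit.
Unset Printing Implicit Defensive.

Local Open Scope classical_set_scope.
Local Open Scope ring_scope.

(** The ambient space [h*_R] is ['rV[R]_r], with [r] the rank of the root
    system.  The scalar product [ip] is an arbitrary one; it is automatically
    W-invariant, since reflections are defined from it.

    The index sets [{1, ..., N}] of the text are 0-based here:
    the i-th term of a chain has index [i - 1] in ['I_N]. *)

Section Reflections.
Variables (R : realType) (r : nat) (ip : 'rV[R]_r -> 'rV[R]_r -> R).
Local Notation V := 'rV[R]_r.

Definition scalar_product : Prop :=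
  [/\ forall (c : R) (x y z : V), ip (c *: x + y) z = c * ip x z + ip y z,
      forall x y : V, ip x y = ip y x &
      forall x : V, x != 0 -> 0 < ip x x].

Definition coroot (a : V) : V := (2 / ip a a) *: a.

Definition pairing (x a : V) : R := ip x (coroot a).

Definition refl (a x : V) : V := x - pairing x a *: a.

Definition arefl (a : V) (k : int) (x : V) : V :=
  x - (pairing x a - k%:~R) *: a.

Definition hyperplane (a : V) (k : int) : set V :=
  [set x | pairing x a = k%:~R].

(* Reduced crystallographic root system in its linear span; the finite set of
   roots is given by an enumeration. *)
Definition root_system_axioms (Phi : seq V) : Prop :=
  [/\ 0 \notin Phi,
      {in Phi &, forall a b, refl a b \in Phi},
      {in Phi &, forall a b, pairing b a \is a Num.int} &
      {in Phi, forall a (c : R), c *: a \in Phi -> c = 1 \/ c = -1}].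

Definition irreducible (Phi : seq V) : Prop :=
  Phi <> [::] /\
  forall P : pred V,
    {in Phi &, forall a b, P a -> ~~ P b -> ip a b = 0} ->
    {in Phi, forall a, P a} \/ {in Phi, forall a, ~~ P a}.

End Reflections.

(* The positive roots are determined by the choice of the simple roots, which
   form a base in the usual sense. *)
Record root_system (R : realType) (r : nat) := RootSystem {
  ip : 'rV[R]_r -> 'rV[R]_r -> R;
  roots : seq 'rV[R]_r;
  simple : 'I_r -> 'rV[R]_r;
  ip_axiom : scalar_product ip;
  roots_axiom : root_system_axioms ip roots;
  roots_span : (<<roots>> = fullv)%VS;
  roots_irreducible : irreducible ip roots;
  simple_root : forall p, simple p \in roots;
  simple_free : free [seq simple p | p : 'I_r];
  simple_base : {in roots, forall a, exists c : 'I_r -> nat,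
    a = \sum_(p < r) (c p)%:R *: simple p \/
    a = - \sum_(p < r) (c p)%:R *: simple p}
}.

Section Words.
Variable T : choiceType.

(* [word S s w] : [w] is the product of the list [s] of elements of [S];
   products of transformations are compositions. *)
Definition word (S : set (T -> T)) (s : seq (T -> T)) (w : T -> T) : Prop :=
  {in s, forall f, S f} /\ w = foldr (fun f g => f \o g) id s.

(* The group generated by [S] when [S] consists of involutions, as will be the
   case below. *)
Definition generated (S : set (T -> T)) : set (T -> T) :=
  [set w | exists s, word S s w].

Definition word_length (S : set (T -> T)) (w : T -> T) : nat :=
  xget 0%N [set n | (exists2 s, word S s w & size s = n) /\
                    forall s, word S s w -> (n <= size s)%N].

End Words.

Section RootSystem.
Variables (R : realType) (r : nat) (D : root_system R r).
Local Notation V := 'rV[R]_r.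
Local Notation pairing := (pairing (ip D)).

Definition positive : set V :=
  [set a | a \in roots D /\
           exists c : 'I_r -> nat, a = \sum_(p < r) (c p)%:R *: simple D p].

Definition absroot (a : V) : V := if `[< positive a >] then a else - a.

Definition simple_refls : set (V -> V) :=
  [set refl (ip D) (simple D p) | p in [set: 'I_r]].

Definition bruhat_cover (w u : V -> V) : Prop :=
  (exists2 b, positive b & u = w \o refl (ip D) b) /\
  word_length simple_refls u = (word_length simple_refls w).+1.

Definition dominant_weight (lam : V) : Prop :=
  {in roots D, forall a, pairing lam a \is a Num.int} /\
  (forall a, positive a -> 0 <= pairing lam a).

Definition regular_points : set V :=
  [set x | forall a (k : int), a \in roots D -> ~ hyperplane (ip D) a k x].

Definition alcove (A : set V) : Prop :=
  exists2 x, regular_points x & A = connected_component regular_points x.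

Definition fundamental_alcove : set V :=
  [set x | forall a, positive a -> 0 < pairing x a < 1].

(* [F] is the wall of [A] lying in the hyperplane [H_(a,k)]: a face of the
   closure of [A] having nonempty interior relative to that hyperplane. *)
Definition wall_in (A : set V) (a : V) (k : int) (F : set V) : Prop :=
  F = closure A `&` hyperplane (ip D) a k /\
  exists2 x, hyperplane (ip D) a k x &
             \forall y \near x, hyperplane (ip D) a k y -> F y.

Definition alcove_step (b : V) (A B : set V) : Prop :=
  [/\ alcove A, alcove B, A <> B, b \in roots D &
      exists k : int,
        [/\ exists F, wall_in A b k F /\ wall_in B b k F,
            forall x, A x -> pairing x b < k%:~R &
            forall x, B x -> k%:~R < pairing x b]].

Fixpoint alcove_path (A : set V) (bs : seq V) (B : set V) : Prop :=
  if bs is b :: bs' then exists C, alcove_step b A C /\ alcove_path C bs' B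
  else A = B.

Definition lambda_chain (lam : V) (N : nat) (G : N.-tuple V) : Prop :=
  let A := fundamental_alcove in
  let B := [set x - lam | x in A] in
  [/\ forall i, positive (tnth G i),
      alcove_path A [seq - b | b <- G] B &
      forall bs, alcove_path A bs B -> (N <= size bs)%N].

Section Chain.
Variables (lam : V) (N : nat) (G : N.-tuple V).
Implicit Types (J : {set 'I_N}) (i : 'I_N) (p : 'I_r).

Definition level0 i : nat :=
  #|[set j : 'I_N | (j < i)%N && (tnth G j == tnth G i)]%SET|.

Definition rhat i : V -> V :=
  arefl (ip D) (tnth G i) (- (level0 i)%:Z).

(* [w J] and its affine analogue; [enum J] is increasing. *)
Definition wprod J : V -> V :=
  foldr (fun j f => refl (ip D) (tnth G j) \o f) id (enum J).

Definition what J : V -> V := foldr (fun j f => rhat j \o f) id (enum J).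

(* the first [n] positions of [J], i.e. [J :&: {1, ..., n}] *)
Definition initial J (n : nat) : {set 'I_N} := [set j in J | (j < n)%N].

Definition admissible J : Prop :=
  forall j, j \in J ->
    bruhat_cover (wprod (initial J j)) (wprod (initial J j.+1)).

Definition mu J : V := - what J (- lam).

Definition gamma J i : V := wprod (initial J i) (tnth G i).

Definition level J i : int :=
  xget 0 [set l : int |
    what (initial J i) @` hyperplane (ip D) (tnth G i) (- (level0 i)%:Z)
    = hyperplane (ip D) (- absroot (gamma J i)) l].

Definition linf J p : R := pairing (mu J) (simple D p).

Definition Iset J p : {set 'I_N} :=
  [set i | (gamma J i == simple D p) || (gamma J i == - simple D p)].

Definition Mmax J p : R :=
  \big[Order.max/linf J p]_(i in Iset J p) (level J i)%:~R.

Definition root_op_defined p J : Prop := 0 < Mmax J p.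

(* The position [m] of the text; [None] stands for infinity. *)
Definition mpos J p : option 'I_N :=
  [pick i in Iset J p |
    ((level J i)%:~R == Mmax J p) &&
    [forall j in Iset J p, ((level J j)%:~R == Mmax J p) ==> (i <= j)%N]].

Definition before i (m : option 'I_N) : bool :=
  if m is Some m' then (i < m')%N else true.

Definition kpos J p : option 'I_N :=
  [pick i in Iset J p |
    before i (mpos J p) &&
    [forall j in Iset J p, before j (mpos J p) ==> (j <= i)%N]].

Definition oset (o : option 'I_N) : {set 'I_N} :=
  [set i | o == Some i]%SET.

(* meaningful when [root_op_defined p J] *)
Definition root_op p J : {set 'I_N} :=
  ((J :\: oset (mpos J p)) :|: oset (kpos J p))%SET.

End Chain.

Definition rank2_subsystem (Psi : seq V) : Prop :=
  [/\ root_system_axioms (ip D) Psi,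
      {subset Psi <= roots D} &
      (\dim <<Psi>>%VS = 2)%N].

Definition segment (N : nat) (G : N.-tuple V) (t q : nat) : seq V :=
  take q (drop t G).

Definition reverse_segment (N : nat) (G : N.-tuple V) (t q : nat) :
    N.-tuple V :=
  [tuple G`_(if (t <= i < t + q)%N then (t + (t + q).-1 - i)%N else i)
  | i < N].

(* The pairs exchanged by the involution [Y_(q,a,b)].  Subsets of
   [{1, ..., q}] are written (1-based) as increasing lists; [iv m n] is
   [{m, ..., n}]. *)
Definition iv (m n : nat) : seq nat := iota m (n.+1 - m).

Definition yb_pairs (q a b : nat) : seq (seq nat * seq nat) :=
  let on (c : bool) (x : seq nat * seq nat) := if c then [:: x] else [::] in
  on (a == b) ([::], [::]) ++
  on ((b == a.+1) && (a <= q.-1))%N ([:: 1%N], [:: q]) ++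
  on ((b == a.+1) && (0 < a < q.-1))%N ([:: (q - a)%N], [:: a.+1]) ++
  on (a.+2 <= b < q)%N (1%N :: iv a.+2 b, rcons (iv a.+1 b.-1) q) ++
  on ((0 < a) && (a.+2 <= b <= q))%N
     (1%N :: rcons (iv a.+2 b.-1) q, iv a.+1 b) ++
  on ((a == 0) && (b == q))%N (iv 1 q, iv 1 q).

(* Total function; lists not occurring in the table are left unchanged. *)
Definition yb_invol (q a b : nat) (S : seq nat) : seq nat :=
  foldr (fun x T => if S == x.1 then x.2 else if S == x.2 then x.1 else T)
        S (yb_pairs q a b).

Section YangBaxter.
Variables (N : nat) (G : N.-tuple V) (t q : nat).

Definition dihedral_refls : set (V -> V) :=
  [set refl (ip D) G`_t; refl (ip D) G`_(t + q).-1].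

Local Notation Wbar := (generated dihedral_refls).

Definition min_rep (u : V -> V) : V -> V :=
  xget (@id V) [set v | (exists2 x, Wbar x & v = u \o x) /\
    forall x, Wbar x ->
      (word_length simple_refls v <= word_length simple_refls (u \o x))%N].

(* length in [Wbar] of the element [y] such that [x = v \o y] *)
Definition bar_length (v x : V -> V) : nat :=
  word_length dihedral_refls (xget (@id V) [set y | Wbar y /\ x = v \o y]).

Definition yang_baxter (J : {set 'I_N}) : {set 'I_N} :=
  let u := wprod G (initial J t) in
  let w := wprod G (initial J (t + q)) in
  let v := min_rep u in
  let S := [seq (j - t).+1 | j : 'I_N <- enum J & (t <= j < t + q)%N] in
  let T := yb_invol q (bar_length v u) (bar_length v w) S in
  [set j : 'I_N | if (t <= j < t + q)%N then (j - t).+1 \in T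
                  else j \in J]%SET.

End YangBaxter.

End RootSystem.

(* Main.v *)
(* Fold the alcove path at [J] and let [f i] be the integer part of
   [- <., a_p^vee>] on its [i]-th alcove. It changes only at the unfolded indices
   of [I(J, p)], by one and in the direction given by the sign of
   [w_i^-1 a_p], where [w_i] is the product of the first folds; by the lifting
   property of the Bruhat order this sign passes from plus to minus only at a
   fold in [I(J, p)]. Hence [M(J, p)] is first attained at a fold [m], the
   predecessor [k] of [m] is an unfolded crossing upwards, and
   [w_i (F_p J) = s_p w_i(J)] for [k < i <= m], while the two products agree
   elsewhere.

   The hyperplanes of the window share an affine subspace of codimension two, so
   all window indices of [I(J, p)] have the same level, and the gallery of [Y J]
   coincides with that of [J] outside the window. If [m] lies in the window then
   the gallery enters it with sign plus and leaves it with sign minus; if [k]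
   does then both signs are plus; otherwise [F_p] multiplies the
   window factors on the left by [s_p], which preserves [a] and [b], or not at
   all. What remains is a statement on the dihedral groups of order [2 q], where
   [q] is 2, 3, 4 or 6, which is checked by computation. *)

Require Import Defs.
From HB Require Import structures.
From mathcomp Require Import all_boot all_order all_algebra.
From mathcomp Require Import all_classical all_reals all_analysis.
From mathcomp Require Import ring lra zify.
Import Order.TTheory GRing.Theory Num.Theory.
Import numFieldNormedType.Exports.
Set Implicit Arguments.
Unset Strict Implicit.
Unset Printing Implicit Defensive.
Local Open Scope classical_set_scope.
Local Open Scope ring_scope.

(** * Reflections *)

(** Alcoves are given topologically, so everything rests on one fact drawn from the path: the wall
    crossed at step [i] contains a point lying strictly inside the strips of all other positive
    roots, where the strips are recorded by the counts [nbefore]. Coroot sums evaluated at such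
    points also force the roots of the window to appear in angular order. This is what permits
    numbering them modulo [2 q]. The restriction on [q] comes from the Cartan integers of the two
    extreme roots, whose product is less than 4.

    The analysis of signs and levels uses that every fold is a Bruhat cover, and it is carried out
    for [J] only. For [Y J] the position of the maximum and its predecessor are found by comparison
    with [J]: outside the window the galleries agree, and inside it the finite check decides.

    That check is restricted to fold sets in which each fold raises the dihedral length by exactly
    one. A cover in [W] by a reflection of the window has this property, because any longer jump in
    the dihedral group factors through three length-increasing reflections. *)

Section ReflectionAlgebra.
Variables (R : realType) (r : nat) (ip : 'rV[R]_r -> 'rV[R]_r -> R).
Hypothesis ipP : scalar_product ip.
Local Notation V := 'rV[R]_r.
Local Notation refl := (refl ip).
Local Notation arefl := (arefl ip).
Local Notation pairing := (pairing ip).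
Implicit Types (a b x y : V) (c : R).

Lemma ipC x y : ip x y = ip y x. Proof. by case: ipP. Qed.
Lemma ip_gt0 x : x != 0 -> 0 < ip x x. Proof. by case: ipP => _ _; apply. Qed.
Lemma ipLl c x y z : ip (c *: x + y) z = c * ip x z + ip y z.
Proof. by case: ipP. Qed.
Lemma ip0l x : ip 0 x = 0.
Proof.
have := ipLl 1 0 0 x; rewrite scaler0 addr0 mul1r => /eqP.
by rewrite -subr_eq subrr => /eqP.
Qed.
Lemma ipDl x y z : ip (x + y) z = ip x z + ip y z.
Proof. by have := ipLl 1 x y z; rewrite scale1r mul1r. Qed.
Lemma ipZl c x z : ip (c *: x) z = c * ip x z.
Proof. by have := ipLl c x 0 z; rewrite addr0 ip0l addr0. Qed.
Lemma ipNl x z : ip (- x) z = - ip x z.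
Proof. by rewrite -scaleN1r ipZl mulN1r. Qed.
Lemma ipDr x y z : ip z (x + y) = ip z x + ip z y.
Proof. by rewrite ipC ipDl !(ipC z). Qed.
Lemma ipZr c x z : ip z (c *: x) = c * ip z x.
Proof. by rewrite ipC ipZl (ipC z). Qed.
Lemma ipNr x z : ip z (- x) = - ip z x.
Proof. by rewrite ipC ipNl (ipC z). Qed.

Lemma pairingE x a : pairing x a = 2 * ip x a / ip a a.
Proof. by rewrite /Defs.pairing /coroot ipZr mulrAC. Qed.
Lemma pairingD x y a : pairing (x + y) a = pairing x a + pairing y a.
Proof. by rewrite /Defs.pairing ipDl. Qed.
Lemma pairingZ c x a : pairing (c *: x) a = c * pairing x a.
Proof. by rewrite /Defs.pairing ipZl. Qed.
Lemma pairingNl x a : pairing (- x) a = - pairing x a.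
Proof. by rewrite /Defs.pairing ipNl. Qed.
Lemma pairingB x y a : pairing (x - y) a = pairing x a - pairing y a.
Proof. by rewrite pairingD pairingNl. Qed.
Lemma pairing0 a : pairing 0 a = 0.
Proof. by rewrite /Defs.pairing ip0l. Qed.
Lemma pairingNr x a : pairing x (- a) = - pairing x a.
Proof. by rewrite !pairingE !ipNr ipNl opprK mulrN mulNr. Qed.
Lemma pairing_self a : a != 0 -> pairing a a = 2.
Proof. by move=> /ip_gt0 h; rewrite pairingE mulfK // gt_eqF. Qed.
Lemma pairing_sum (I : finType) (F : I -> V) a :
  pairing (\sum_i F i) a = \sum_i pairing (F i) a.
Proof. by apply: (big_morph (pairing^~ a)) => [x y|]; rewrite ?pairingD ?pairing0. Qed.
Lemma ip_suml (I : finType) (F : I -> V) x :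
  ip (\sum_i F i) x = \sum_i ip (F i) x.
Proof. by apply: (big_morph (ip^~ x)) => [y z|]; rewrite ?ipDl ?ip0l. Qed.
Lemma pairing_gt0 x a : a != 0 -> (0 < pairing x a) = (0 < ip x a).
Proof.
move=> /ip_gt0 h; rewrite pairingE pmulr_lgt0 ?invr_gt0 //.
by rewrite pmulr_rgt0.
Qed.

Lemma reflN a x : refl (- a) x = refl a x.
Proof. by rewrite /Defs.refl pairingNr scalerN scaleNr opprK. Qed.
Lemma refl_self a : a != 0 -> refl a a = - a.
Proof.
move=> h; rewrite /Defs.refl pairing_self //.
by rewrite scaler_nat mulr2n opprD addNKr.
Qed.
Lemma reflNx a x : refl a (- x) = - refl a x.
Proof. by rewrite /Defs.refl pairingNl scaleNr opprB opprK addrC. Qed.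
Lemma reflK a : a != 0 -> involutive (refl a).
Proof.
move=> h x; rewrite /Defs.refl pairingB pairingZ pairing_self //.
have -> : pairing x a - pairing x a * 2 = - pairing x a by ring.
by rewrite scaleNr opprK subrK.
Qed.

(** Linear isometries as plain functions, the form in which products of reflections arise. *)
Definition isom (g : V -> V) : Prop :=
  (forall c x y, g (c *: x + y) = c *: g x + g y) /\
  (forall x y, ip (g x) (g y) = ip x y).

Lemma isom_id : isom id. Proof. by []. Qed.
Lemma isom_comp g h : isom g -> isom h -> isom (g \o h).
Proof.
by move=> [g1 g2] [h1 h2]; split=> [c x y|x y] /=; rewrite ?h1 ?g1 ?g2 ?h2.
Qed.
Lemma isom_refl a : a != 0 -> isom (refl a).
Proof.
move=> h; split=> [c x y|x y].
  rewrite /Defs.refl pairingD pairingZ scalerBr scalerA scalerDl opprD.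
  by rewrite addrACA.
have h2 := ip_gt0 h.
rewrite /Defs.refl !pairingE !(ipDl, ipDr, ipNl, ipNr, ipZl, ipZr).
rewrite (ipC a y); field; exact: lt0r_neq0.
Qed.

Section Isom.
Variable g : V -> V.
Hypothesis hg : isom g.
Lemma isomD x y : g (x + y) = g x + g y.
Proof. by have := hg.1 1 x y; rewrite !scale1r. Qed.
Lemma isom0 : g 0 = 0.
Proof. by have /eqP := isomD 0 0; rewrite addr0 -subr_eq subrr => /eqP. Qed.
Lemma isomZ c x : g (c *: x) = c *: g x.
Proof. by have := hg.1 c x 0; rewrite isom0 !addr0. Qed.
Lemma isomN x : g (- x) = - g x.
Proof. by rewrite -scaleN1r isomZ scaleN1r. Qed.
Lemma isomB x y : g (x - y) = g x - g y.
Proof. by rewrite isomD isomN. Qed.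
Lemma isom_inj : injective g.
Proof.
move=> x y e; apply/eqP; rewrite -subr_eq0; apply/negPn/negP => /ip_gt0.
rewrite -hg.2 isomB e subrr.
by rewrite ip0l ltxx.
Qed.
Lemma isom_pairing x a : pairing (g x) (g a) = pairing x a.
Proof. by rewrite !pairingE !hg.2. Qed.
Lemma isom_refl_conj a x : g (refl a x) = refl (g a) (g x).
Proof. by rewrite /Defs.refl isomB isomZ isom_pairing. Qed.
End Isom.

End ReflectionAlgebra.

(** Makes the number of roots of smaller height a strictly decreasing measure in [pos_conj_base]. *)
Lemma ltn_count (T : eqType) (P Q : pred T) (s : seq T) x :
  subpred P Q -> x \in s -> Q x -> ~~ P x -> (count P s < count Q s)%N.
Proof.
move=> PQ + Qx nPx; elim: s => //= y s IH; rewrite inE => /orP[/eqP<-|/IH h].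
  by rewrite Qx (negbTE nPx) ltnS; apply: sub_count.
by rewrite -addnS leq_add //; case: (P y) (PQ y) => // ->.
Qed.

(** * Words in involutions and their length *)

Section WordLength.
Variables (T : choiceType) (S : set (T -> T)).

Lemma word_nil : word S [::] id. Proof. by []. Qed.
Lemma word_cons f s w : S f -> word S s w -> word S (f :: s) (f \o w).
Proof.
move=> Sf [Ss ->]; split=> // g; rewrite inE => /orP[/eqP->//|]; exact: Ss.
Qed.
Lemma word_cat s1 s2 w1 w2 :
  word S s1 w1 -> word S s2 w2 -> word S (s1 ++ s2) (w1 \o w2).
Proof.
elim: s1 w1 => [|f s IH] w1 [S1 ->] W2 //=.
have /IH/(_ W2) W : word S s (foldr (fun f g => f \o g) id s).
  by split=> // g gs; apply: S1; rewrite inE gs orbT.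
by apply: (word_cons _ W); apply: S1; rewrite inE eqxx.
Qed.
Lemma word_consP f s w : word S (f :: s) w ->
  S f /\ exists2 w', word S s w' & w = f \o w'.
Proof.
move=> [Ss ->]; split; first by apply: Ss; rewrite inE eqxx.
by exists (foldr (fun f g => f \o g) id s) => //; split=> // g gs; apply: Ss; rewrite inE gs orbT.
Qed.
Lemma generated_comp w1 w2 : generated S w1 -> generated S w2 ->
  generated S (w1 \o w2).
Proof. by move=> [s1 W1] [s2 W2]; exists (s1 ++ s2); apply: word_cat. Qed.
Lemma generated_id : generated S id. Proof. by exists [::]. Qed.
Lemma generated_sub f : S f -> generated S f.
Proof. by move=> Sf; exists [:: f]; apply: (word_cons Sf word_nil). Qed.

(** [word_length] is a choice with default 0. For a generated [w] the set of lengths of its words is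
    nonempty, so a minimum exists and the choice is not the default. *)
Lemma word_lengthP w : generated S w ->
  (exists2 s, word S s w & size s = word_length S w) /\
  forall s, word S s w -> (word_length S w <= size s)%N.
Proof.
move=> [s0 W0]; rewrite /word_length.
set A := [set n | _].
suff : exists n, A n by move=> [n An]; case: xgetP => [m _ //|/(_ n)].
pose P n := `[< exists2 s, word S s w & size s = n >].
have exP : exists n, P n by exists (size s0); apply/asboolP; exists s0.
case: (ex_minnP exP) => n /asboolP Pn nmin; exists n; split=> // s Ws.
by apply: nmin; apply/asboolP; exists s.
Qed.

Lemma word_length_le s w : word S s w -> (word_length S w <= size s)%N.
Proof. by move=> W; apply: (word_lengthP _).2 => //; exists s. Qed.
End WordLength.

(** * Root systems with a base *)

(** Stated for a root system whose base spans a possibly proper subspace, because it serves twice: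
    for [D] with its simple roots, and for the rank two system of the window with its two extreme
    roots. *)
Record based_system (R : realType) (r : nat) (ip : 'rV[R]_r -> 'rV[R]_r -> R)
    (Phi : seq 'rV[R]_r) (pos : 'rV[R]_r -> Prop) (n : nat)
    (X : n.-tuple 'rV[R]_r) : Prop := BasedSystem {
  based_ip : scalar_product ip;
  based_roots : root_system_axioms ip Phi;
  based_free : free X;
  based_base : {subset X <= Phi};
  based_span : {subset Phi <= <<X>>%VS};
  based_pos : {in Phi, forall a, pos a <-> forall p, 0 <= coord X p a};
  based_sign : {in Phi, forall a, pos a \/ pos (- a)}
}.

Section BasedSystem.
Variables (R : realType) (r : nat) (ip : 'rV[R]_r -> 'rV[R]_r -> R).
Local Notation V := 'rV[R]_r.
Local Notation refl := (refl ip).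
Local Notation pairing := (pairing ip).
Variables (Phi : seq V) (pos : V -> Prop) (n : nat) (X : n.-tuple V).
Hypothesis B : based_system ip Phi pos X.
Let ipP := based_ip B.
Let PhiP := based_roots B.
Let freeX := based_free B.
Let XPhi := based_base B.
Let PhiX := based_span B.
Let posE := based_pos B.
Let signP := based_sign B.

Lemma root_nz : {in Phi, forall a, a != 0}.
Proof. by case: PhiP => nz _ _ _ a aP; apply: contraNneq nz => <-. Qed.
Lemma root_refl : {in Phi &, forall a b, refl a b \in Phi}.
Proof. by case: PhiP. Qed.
Lemma root_opp : {in Phi, forall a, - a \in Phi}.
Proof. by move=> a aP; rewrite -(refl_self ipP) ?root_nz ?root_refl. Qed.

Lemma pos_excl : {in Phi, forall a, pos a -> ~ pos (- a)}.
Proof.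
move=> a aP /(posE aP) h1 /(posE (root_opp aP)) h2.
have c0 p : coord X p a = 0.
  by apply/eqP; rewrite eq_le h1 andbT -oppr_ge0 -linearN; apply: h2.
have := coord_span (PhiX aP).
rewrite big1 => [/eqP|p _]; last by rewrite c0 scale0r.
exact/negP/root_nz.
Qed.
Lemma not_posP : {in Phi, forall a, ~ pos a <-> pos (- a)}.
Proof.
move=> a aP; split; first by case: (signP aP).
by move=> + /(pos_excl aP).
Qed.

Lemma coord_base (p q : 'I_n) : coord X p X`_q = (p == q)%:R.
Proof. by rewrite coord_free // eq_sym. Qed.
Lemma base_root (p : 'I_n) : X`_p \in Phi.
Proof. by apply: XPhi; rewrite -tnth_nth mem_tnth. Qed.
Lemma base_pos (p : 'I_n) : pos X`_p.
Proof. by apply/posE => [|q]; rewrite ?base_root // coord_base ler0n. Qed.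

Lemma reduced_eq : {in Phi, forall a c, c *: a \in Phi -> 0 < c -> c = 1}.
Proof.
by case: PhiP => _ _ _ red a aP c /(red a aP)[] // ->; rewrite ltr0N1.
Qed.

Lemma base_refl_coord (p q : 'I_n) a :
  q != p -> coord X q (refl X`_p a) = coord X q a.
Proof.
move=> qp; rewrite /Defs.refl linearB linearZ /= coord_base.
by rewrite (negbTE qp) mulr0 subr0.
Qed.

(** A positive root other than the base root has a positive coordinate at some other base root,
    since the system is reduced. The reflection leaves this coordinate unchanged. *)
Lemma base_permutes (p : 'I_n) : {in Phi, forall a, pos a -> a <> X`_p ->
  pos (refl X`_p a)}.
Proof.
move=> a aP pa na; have bP := base_root p.
have rP := root_refl bP aP.
have ca := (posE aP).1 pa.
have [q qp cq] : exists2 q, q != p & 0 < coord X q a.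
  apply: contrapT => nex; apply: na.
  have c0 q : q != p -> coord X q a = 0.
    move=> qp; apply/eqP/negPn/negP => c0; apply: nex; exists q => //.
    by rewrite lt_neqAle eq_sym c0 ca.
  have ea : a = coord X p a *: X`_p.
    rewrite {1}(coord_span (PhiX aP)) (bigD1 p) //= big1 ?addr0 // => q qp.
    by rewrite c0 // scale0r.
  have cp : 0 < coord X p a.
    rewrite lt_neqAle eq_sym ca andbT; apply: contraTneq (root_nz aP) => cp.
    by rewrite ea cp scale0r eqxx.
  by rewrite ea (reduced_eq bP _ cp) ?scale1r // -ea.
case: (signP rP) => // /(posE (root_opp rP)) /(_ q).
by rewrite linearN /= base_refl_coord // oppr_ge0 leNgt cq.
Qed.

Definition base_refls : set (V -> V) := [set refl X`_p | p in [set: 'I_n]].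

Lemma generated_isom w : generated base_refls w ->
  isom ip w /\ {in Phi, forall a, w a \in Phi}.
Proof.
case=> s; elim: s w => [|f s IH] w.
  by case=> _ ->; split => //; apply: isom_id.
move=> /word_consP[[p _ <-] [w' /IH [i1 i2] ->]]; split.
  by apply: isom_comp => //; apply: (isom_refl ipP); apply: root_nz; apply: base_root.
by move=> a aP /=; apply: root_refl; rewrite ?base_root ?i2.
Qed.

Lemma height_gt0 : {in Phi, forall a, pos a -> 0 < \sum_p coord X p a}.
Proof.
move=> a aP /(posE aP) ca; rewrite lt_neqAle sumr_ge0 // andbT eq_sym.
rewrite psumr_eq0 //; apply/allP => h.
have /eqP : a = 0.
  rewrite (coord_span (PhiX aP)) big1 // => p _.
  by have /implyP/(_ isT)/eqP-> := h p (mem_index_enum p); rewrite scale0r.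
exact/negP/root_nz.
Qed.

(** Induction on the number of roots of smaller height: unless [a] is in the base, the reflection in
    a suitable base root keeps it positive and lowers its height. *)
Lemma pos_conj_base : {in Phi, forall a, pos a ->
  exists2 w, generated base_refls w & exists p : 'I_n, a = w X`_p}.
Proof.
pose h (a : V) := \sum_p coord X p a.
pose m a := count (fun b => h b < h a) Phi.
move=> a; have [k] := ubnP (m a); elim: k a => // k IH a mk aP pa.
have [[p ->]|na] := pselect (exists p : 'I_n, a = X`_p).
  by exists id; [apply: generated_id|exists p].
have [p ip0] : exists p : 'I_n, 0 < ip a X`_p.
  apply: contrapT => nex; have := ip_gt0 ipP (root_nz aP).
  rewrite {1}(coord_span (PhiX aP)) ip_suml // ltNge sumr_le0 // => p _.
  rewrite ipZl //; apply: mulr_ge0_le0; first exact: (posE aP).1.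
  by rewrite leNgt ipC //; apply/negP => h0; apply: nex; exists p.
have bP := base_root p.
have rP := root_refl bP aP.
have pr : pos (refl X`_p a) by apply: base_permutes => // e; apply: na; exists p.
have hlt : h (refl X`_p a) < h a.
  rewrite /h (bigD1 p) //= [ltRHS](bigD1 p) //=.
  under eq_bigr => q qp do rewrite base_refl_coord //.
  rewrite ltrD2r /Defs.refl linearB linearZ /= coord_base eqxx mulr1.
  by rewrite gtrBl pairing_gt0 ?root_nz.
have [|w gw [q e]] := IH (refl X`_p a) _ rP pr.
  rewrite -ltnS; apply: leq_trans mk; rewrite ltnS /m.
  apply: (ltn_count _ rP) => //=; last by rewrite ltxx.
  by move=> b /= /lt_trans; apply.
exists (refl X`_p \o w); first by apply: generated_comp => //; apply: generated_sub; exists p.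
by exists q => /=; rewrite -e reflK ?root_nz.
Qed.

Lemma generated_refl_conj w a : generated base_refls w -> a \in Phi ->
  w \o refl a = refl (w a) \o w.
Proof.
by move=> /generated_isom [iw _] _; apply/funext => x /=; rewrite isom_refl_conj.
Qed.

Lemma generated_inv w : generated base_refls w ->
  exists w', [/\ generated base_refls w', w \o w' = id & w' \o w = id].
Proof.
case=> s; elim: s w => [|f s IH] w.
  by case=> _ ->; exists id; split=> //; apply: generated_id.
move=> /word_consP[[p _ <-] [w0 /IH [w' [g e1 e2]] ->]].
exists (w' \o refl X`_p); split.
- by apply: generated_comp => //; apply: generated_sub; exists p.
- apply/funext => x /=; have /= -> := congr1 (fun h => h (refl X`_p x)) e1.
  by rewrite reflK ?root_nz ?base_root.
- apply/funext => x /=; rewrite reflK ?root_nz ?base_root //.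
  by have /= -> := congr1 (fun h => h x) e2.
Qed.

Lemma generated_refl : {in Phi, forall a, generated base_refls (refl a)}.
Proof.
move=> a aP; wlog pa : a aP / pos a => [hw|].
  case: (signP aP) => [/hw|pa]; first exact.
  have -> : refl a = refl (- a) by apply/funext => x; rewrite reflN.
  by apply: hw; rewrite ?root_opp.
have [w gw [p ->]] := pos_conj_base aP pa.
have [w' [g' e1 e2]] := generated_inv gw.
have -> : refl (w X`_p) = w \o refl X`_p \o w'.
  rewrite generated_refl_conj ?base_root //; apply/funext => x /=.
  by have /= -> := congr1 (fun h => h x) e1.
apply: generated_comp => //; apply: generated_comp => //.
by apply: generated_sub; exists p.
Qed.

(** Follow [b] through the word from the right. At the letter that turns it negative, [b] has become
    the root of that letter, so multiplying by [refl b] deletes the letter. *)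
Lemma exchange s w b : word base_refls s w -> b \in Phi -> pos b ->
  ~ pos (w b) -> exists2 s', word base_refls s' (w \o refl b) & (size s' < size s)%N.
Proof.
move=> + bP pb; elim: s w => [|f s IH] w.
  by case=> _ -> /=.
move=> /word_consP[[p _ <-] [w' W ->]] /= npos.
have gw' : generated base_refls w' by exists s.
have w'b := (generated_isom gw').2 _ bP.
have [h|/(IH _ W) [s' W' ss]] := pselect (pos (w' b)); last first.
  exists (refl X`_p :: s') => //=.
  by rewrite -[_ \o _]/(refl X`_p \o (w' \o refl b)); apply: word_cons => //; exists p.
have [e|ne] := pselect (w' b = X`_p); last by case: npos; apply: base_permutes.
exists s => //.
suff -> : refl X`_p \o w' \o refl b = w' by [].
rewrite -e -generated_refl_conj //.
by apply/funext => x /=; rewrite reflK ?root_nz.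
Qed.

Lemma exchange_lt w b : generated base_refls w -> b \in Phi -> pos b ->
  ~ pos (w b) -> (word_length base_refls (w \o refl b) < word_length base_refls w)%N.
Proof.
move=> gw bP pb np; have [[s W <-] _] := word_lengthP gw.
have [s' W' ss] := exchange W bP pb np.
exact: leq_ltn_trans (word_length_le W') ss.
Qed.

(** This is [exchange_lt] applied to the product of [w] and [refl b], which sends [b] to a negative
    root. *)
Lemma exchange_gt w b : generated base_refls w -> b \in Phi -> pos b ->
  pos (w b) -> (word_length base_refls w < word_length base_refls (w \o refl b))%N.
Proof.
move=> gw bP pb p.
have g2 : generated base_refls (w \o refl b) by apply: generated_comp => //; apply: generated_refl.
have E : w \o refl b \o refl b = w by apply/funext => x /=; rewrite reflK ?root_nz.
rewrite -{1}E; apply: exchange_lt => //=.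
rewrite refl_self ?root_nz // (isomN (generated_isom gw).1).
by apply: pos_excl => //; apply: (generated_isom gw).2.
Qed.

Variable bs : seq V.
Hypothesis bs_uniq : uniq bs.
Hypothesis bsP : forall b, b \in bs <-> b \in Phi /\ pos b.

(** The inversion number is counted over a separate list [bs] of the positive roots without
    repetition, since the enumeration [Phi] may repeat roots. *)
Definition ninv (w : V -> V) : nat := count (fun b => ~~ `[< pos (w b) >]) bs.

(** The base reflection permutes the positive roots other than its own, so only the base root itself
    changes its contribution, from 0 to 1. *)
Lemma ninv_comp_base w (p : 'I_n) : generated base_refls w -> pos (w X`_p) ->
  ninv (w \o refl X`_p) = (ninv w).+1.
Proof.
move=> gw pw; have bP := base_root p; have pb := base_pos p.
have wP := (generated_isom gw).2.
have Xbs : X`_p \in bs by apply/bsP.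
rewrite /ninv !(permP (perm_to_rem Xbs)) /=.
rewrite refl_self ?root_nz // (isomN (generated_isom gw).1).
rewrite asboolF /=; last by apply: pos_excl => //; apply: wP.
rewrite asboolT //= add0n add1n; congr _.+1.
set b' := rem _ _.
have b'P b : b \in b' <-> [/\ b \in Phi, pos b & b != X`_p].
  rewrite /b' mem_rem_uniq // !inE; split=> [/andP[ne /bsP[]]|[hb1 hb2 ->]] //.
  exact/bsP.
have pm : perm_eq b' (map (refl X`_p) b').
  have sub : {subset map (refl X`_p) b' <= b'}.
    move=> _ /mapP[b /b'P [hb1 hb2 /eqP ne] ->]; apply/b'P; split.
    - exact: root_refl.
    - exact: base_permutes.
    - apply/eqP => e; apply: (pos_excl bP pb).
      by rewrite -(refl_self ipP) ?root_nz // -{2}e reflK ?root_nz.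
  have uq : uniq (map (refl X`_p) b').
    rewrite map_inj_uniq ?rem_uniq //; apply: can_inj.
    exact: (reflK ipP (root_nz bP)).
  rewrite perm_sym; apply: uniq_perm => //; first exact: rem_uniq.
  by have [] := uniq_min_size uq sub; rewrite ?size_map.
by rewrite (permP pm) count_map; apply: eq_count => b /=; rewrite reflK ?root_nz.
Qed.

(** Induction on a shortest word from its last letter, which adds exactly one inversion. *)
Lemma ninv_word_length w : generated base_refls w ->
  word_length base_refls w = ninv w.
Proof.
move=> gw; have [[s W sz] mn] := word_lengthP gw; rewrite -sz.
have {}mn : forall s', word base_refls s' w -> (size s <= size s')%N by move=> s' /mn; rewrite sz.
move: W mn {sz gw}; elim/last_ind: s w => [|s f IH] w W mn.
  case: W => _ -> /=; rewrite /ninv; apply/esym/eqP; rewrite -leqn0 leqNgt -has_count.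
  by apply/hasPn => b /bsP[_ pb]; rewrite negbK; apply/asboolP.
have Ss : {in s, forall g, base_refls g}.
  by move=> g gs; apply: W.1; rewrite mem_rcons inE gs orbT.
have [p _ fE] : base_refls f by apply: W.1; rewrite mem_rcons inE eqxx.
pose w' := foldr (fun f g => f \o g) id s.
have W' : word base_refls s w' by [].
have wE : w = w' \o f.
  by rewrite W.2 -cats1 foldr_cat /w' /=; elim: (s) => //= g s' ->.
have Wf : word base_refls [:: f] f by apply: (word_cons _ (word_nil _)); exists p.
have gw' : generated base_refls w' by exists s.
have mn' s' : word base_refls s' w' -> (size s <= size s')%N.
  move=> W2; have := mn (s' ++ [:: f]); rewrite size_rcons size_cat addn1 ltnS; apply.
  by rewrite wE; apply: word_cat.
have [pw|npw] := pselect (pos (w' X`_p)).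
  by rewrite size_rcons wE -fE ninv_comp_base // (IH w').
(* If the last letter removed an inversion instead, the exchange property would give a word for [w]
   shorter than the minimal one. *)
have [s' W2 lt] := exchange W' (base_root p) (base_pos p) npw.
have := mn s'; rewrite wE -fE => /(_ W2); rewrite size_rcons => h.
by have := leq_trans (ltnW h) (ltnW lt); rewrite -ltnS ltnNge; move: lt h; lia.
Qed.

Lemma ninv0_id w : generated base_refls w -> (forall b, b \in bs -> pos (w b)) -> w = id.
Proof.
move=> gw hp; have [[s W sz] _] := word_lengthP gw.
have n0 : ninv w = 0%N.
  apply/eqP; rewrite -leqn0 leqNgt -has_count; apply/hasPn => b bb; rewrite negbK.
  exact/asboolP/hp.
by move: sz W; rewrite ninv_word_length // n0 => /size0nil -> [].
Qed.

End BasedSystem.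

(** * The Weyl group *)

Section WeylGroup.
Variables (R : realType) (r : nat) (D : root_system R r).
Local Notation V := 'rV[R]_r.
Local Notation refl := (refl (ip D)).
Local Notation pairing := (pairing (ip D)).
Local Notation pos := (positive D).
Local Notation Phi := (Defs.roots D).
Local Notation W := (generated (simple_refls D)).
Local Notation len := (word_length (simple_refls D)).

Definition simples : r.-tuple V := [tuple simple D p | p < r].

Lemma simplesE (p : 'I_r) : simples`_p = simple D p.
Proof. by rewrite -tnth_nth tnth_mktuple. Qed.

Lemma simples_free : free simples.
Proof. exact: Defs.simple_free. Qed.

Lemma simples_span : {subset Phi <= <<simples>>%VS}.
Proof.
have S (c : 'I_r -> nat) : \sum_(p < r) (c p)%:R *: simple D p \in <<simples>>%VS.
  apply: memv_suml => p _; apply: memvZ; apply: memv_span.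
  by rewrite -simplesE -tnth_nth mem_tnth.
by move=> a /(simple_base)[c [|] ->]; rewrite ?memvN.
Qed.

Lemma coord_simples (c : 'I_r -> nat) p :
  coord simples p (\sum_(q < r) (c q)%:R *: simple D q) = (c p)%:R.
Proof.
under eq_bigr => q _ do rewrite -simplesE.
exact: (coord_sum_free _ _ simples_free).
Qed.

Lemma weyl_based : based_system (ip D) Phi pos simples.
Proof.
split.
- exact: ip_axiom.
- exact: roots_axiom.
- exact: simples_free.
- by move=> a /tnthP[p ->]; rewrite tnth_mktuple simple_root.
- exact: simples_span.
- move=> a aP; split=> [[_ [c ->]] p|h]; first by rewrite coord_simples ler0n.
  split=> //; have [c [|e]] := simple_base aP; first by exists c.
  (* Here [a] is minus a nonnegative combination with nonnegative coordinates, so all coefficients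
     vanish and the zero combination serves. *)
  exists (fun=> 0%N); rewrite {1}e.
  rewrite [X in - X]big1 ?big1 ?oppr0 // => p _; first by rewrite scale0r.
  have := h p; rewrite e linearN /= coord_simples oppr_ge0 => c0.
  by have /eqP-> : (c p)%:R == 0 :> R; rewrite ?scale0r // eq_le c0 ler0n.
- move=> a aP; have [c [e|e]] := simple_base aP.
    by left; split=> //; exists c.
  right; split; last by exists c; rewrite e opprK.
  have [nz rf _ _] := roots_axiom D.
  have a0 : a != 0 by apply: contraNneq nz => <-.
  by rewrite -(refl_self (ip_axiom D)) ?rf.
Qed.

Lemma simple_reflsE : simple_refls D = base_refls (ip D) simples.
Proof.
by apply/seteqP; split=> _ [p _ <-]; exists p; rewrite ?simplesE.
Qed.

Lemma simple_pos p : pos (simple D p).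
Proof. by have := base_pos weyl_based p; rewrite simplesE. Qed.

Lemma weyl_refl : {in Phi, forall a, W (refl a)}.
Proof. by rewrite simple_reflsE; apply: (generated_refl weyl_based). Qed.

Lemma weyl_isom w : W w -> isom (ip D) w.
Proof. by rewrite simple_reflsE => /(generated_isom weyl_based)[]. Qed.

Lemma weyl_root w : W w -> {in Phi, forall a, w a \in Phi}.
Proof. by rewrite simple_reflsE => /(generated_isom weyl_based)[]. Qed.

Lemma weyl_inv w : W w -> exists w', [/\ W w', w \o w' = id & w' \o w = id].
Proof. by rewrite simple_reflsE; apply: (generated_inv weyl_based). Qed.

Lemma weyl_conj w a : W w -> w \o refl a = refl (w a) \o w.
Proof.
by move=> /weyl_isom iw; apply/funext => x /=; rewrite (isom_refl_conj (ip_axiom D) iw).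
Qed.

Lemma len_lt w b : W w -> pos b -> ~ pos (w b) -> (len (w \o refl b) < len w)%N.
Proof.
by rewrite simple_reflsE => gw pb; apply: (exchange_lt weyl_based) => //; case: pb.
Qed.

Lemma len_gt w b : W w -> pos b -> pos (w b) -> (len w < len (w \o refl b))%N.
Proof.
by rewrite simple_reflsE => gw pb; apply: (exchange_gt weyl_based) => //; case: pb.
Qed.

Lemma cover_pos w b : W w -> pos b -> len (w \o refl b) = (len w).+1 -> pos (w b).
Proof.
move=> gw pb e; apply: contrapT => /(len_lt gw pb); rewrite e.
by rewrite ltnNge leqnSn.
Qed.

Lemma simple_permutes p a : pos a -> a <> simple D p -> pos (refl (simple D p) a).
Proof.
move=> pa; rewrite -simplesE => ne; apply: (base_permutes weyl_based) => //.
by case: pa.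
Qed.

Lemma root_nz0 : {in Phi, forall a, a != 0}.
Proof. exact: (root_nz weyl_based). Qed.
Lemma pos_root a : pos a -> a \in Phi. Proof. by case. Qed.
Lemma pos_nz a : pos a -> a != 0. Proof. by move=> /pos_root/root_nz0. Qed.
Lemma neg_posP a : a \in Phi -> ~ pos a <-> pos (- a).
Proof. exact: (not_posP weyl_based). Qed.

Lemma posN a : pos a -> ~ pos (- a).
Proof. by move=> pa; apply: (pos_excl weyl_based) => //; apply: pos_root. Qed.

Lemma rootN a : a \in Phi -> - a \in Phi.
Proof. exact: (root_opp weyl_based). Qed.

(* If the conclusion failed, then
   [len w < len (s_p w) < len (s_p w s_b) < len (w s_b) = len w + 1]. *)
Lemma cover_simple w b d p : W w -> pos b -> len (w \o refl b) = (len w).+1 ->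
  d \in Phi -> w d = simple D p -> pos d -> ~ pos (refl b d) -> w b = simple D p.
Proof.
move=> gw pb e dP wd pd nd.
have bP := pos_root pb.
have iw := weyl_isom gw.
apply: contrapT => ne.
have pwb := cover_pos gw pb e.
set s := refl (simple D p).
have sw : s \o w = w \o refl d by rewrite weyl_conj // wd.
have gsw : W (s \o w) by rewrite sw; apply: generated_comp => //; apply: weyl_refl.
have l1 : (len w < len (s \o w))%N.
  by rewrite sw; apply: len_gt => //; rewrite wd; apply: simple_pos.
have l2 : (len (s \o w) < len (s \o w \o refl b))%N.
  by apply: len_gt => //=; apply: simple_permutes.
have gwb : W (w \o refl b) by apply: generated_comp => //; apply: weyl_refl.
have rP : refl b d \in Phi by apply: weyl_root => //; apply: weyl_refl.
have swb : s \o w \o refl b = (w \o refl b) \o refl (- refl b d).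
  rewrite [RHS]weyl_conj ?rootN // (isomN (weyl_isom gwb)) /= (reflK (ip_axiom D)) ?pos_nz //.
  by rewrite wd; apply/funext => x /=; rewrite (reflN (ip_axiom D)).
have l3 : (len (s \o w \o refl b) < len (w \o refl b))%N.
  rewrite swb; apply: len_lt => //; first exact/neg_posP.
  rewrite (isomN (weyl_isom gwb)) /= (reflK (ip_axiom D)) ?pos_nz // wd.
  exact/posN/simple_pos.
move: l1 l2 l3; rewrite e; lia.
Qed.

End WeylGroup.

(** * Folded galleries *)

Section Gallery.
Variables (R : realType) (r : nat) (D : root_system R r).
Local Notation V := 'rV[R]_r.
Local Notation refl := (refl (ip D)).
Local Notation pairing := (pairing (ip D)).
Local Notation pos := (positive D).
Local Notation Phi := (Defs.roots D).
Local Notation W := (generated (simple_refls D)).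
Local Notation len := (word_length (simple_refls D)).
Let ipP := ip_axiom D.

Section Chain.
Variable beta : nat -> V.

(** For [d] the root of step [i] this is the number written l_i with superscript the empty set. For
    a general positive [d] it locates the unfolded alcove after [i] steps: there the pairing with
    [d] lies strictly between [- nbefore i d] and [1 - nbefore i d]. *)
Definition nbefore i (d : V) : nat := count (fun j => beta j == d) (iota 0 i).

Lemma nbeforeS i d : nbefore i.+1 d = (nbefore i d + (beta i == d))%N.
Proof. by rewrite /nbefore -[X in iota 0 X]addn1 iotaD count_cat /= addn0. Qed.

Definition wall_refl i : V -> V :=
  arefl (ip D) (beta i) (- (nbefore i (beta i))%:Z).

Variable J : pred nat.

(** Recursion on natural numbers replaces the fold over [enum J]: consecutive partial products
    differ by at most one factor on the right. The affine product [aprod] follows the same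
    pattern. *)
Fixpoint gprod i : V -> V :=
  if i is i'.+1 then
    if J i' then gprod i' \o refl (beta i') else gprod i'
  else id.

Fixpoint aprod i : V -> V :=
  if i is i'.+1 then
    if J i' then aprod i' \o wall_refl i' else aprod i'
  else id.

Definition hits (a : V) i : bool :=
  (gprod i (beta i) == a) || (gprod i (beta i) == - a).

Variable N : nat.
Hypothesis beta_pos : forall i, (i < N)%N -> pos (beta i).

Lemma gprod_weyl i : (i <= N)%N -> W (gprod i).
Proof.
elim: i => [|i IH] iN /=; first exact: generated_id.
case: ifP => _; last exact/IH/ltnW.
by apply: generated_comp; [apply/IH/ltnW|apply/weyl_refl/pos_root/beta_pos].
Qed.

(** An affine reflection is the linear one followed by a translation, so [aprod i] is affine with
    linear part [gprod i]. *)
Lemma aprodE i x : (i <= N)%N -> aprod i x = gprod i x + aprod i 0.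
Proof.
elim: i x => [|i IH] x iN /=; first by rewrite addr0.
case: ifP => _; last exact/IH/ltnW.
have iw := weyl_isom (gprod_weyl (ltnW iN)).
rewrite /= !(IH (wall_refl i _)) ?(ltnW iN) // addrA; congr (_ + _).
rewrite -(isomD iw); congr gprod.
rewrite /wall_refl /arefl /Defs.refl (pairing0 ipP) sub0r add0r.
by rewrite scalerBl opprB addrA scaleNr opprK addrAC.
Qed.

(** A point in the relative interior of the wall crossed at step [i]; this is all that is retained
    of the alcoves. *)
Hypothesis beta_wall : forall i, (i < N)%N -> exists z : V,
  pairing z (beta i) = - (nbefore i (beta i))%:R /\
  forall d, pos d -> d != beta i ->
    - (nbefore i d)%:R < pairing z d < 1 - (nbefore i d)%:R.
Hypothesis J_cover : forall i, (i < N)%N -> J i ->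
  len (gprod i \o refl (beta i)) = (len (gprod i)).+1.
Variable p : 'I_r.
Local Notation a := (simple D p).
Local Notation hit := (hits a).

(** The root $w_i^{-1}\alpha_p$. Its sign is [up i], and [absdir i] is its absolute value. The
    default 0 never occurs for [i <= N]. *)
Definition dir i : V := xget 0 [set d | gprod i d = a].

Lemma dirP i : (i <= N)%N -> gprod i (dir i) = a /\ dir i \in Phi.
Proof.
move=> /gprod_weyl gi; have [w' [gw' e1 _]] := weyl_inv gi.
rewrite /dir; case: xgetP => [d _ /= e|/(_ (w' a))/=].
  split=> //; have -> : d = w' a.
    apply: (isom_inj ipP (weyl_isom gi)); rewrite e.
    by have /= -> := congr1 (fun h => h a) e1.
  by apply: weyl_root => //; apply: simple_root.
by case; have /= -> := congr1 (fun h => h a) e1.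
Qed.

Lemma dir_uniq i d : (i <= N)%N -> gprod i d = a -> dir i = d.
Proof.
move=> iN e; have gi := gprod_weyl iN.
by apply: (isom_inj ipP (weyl_isom gi)); rewrite e; case: (dirP iN).
Qed.

Definition up i : bool := `[< pos (dir i) >].
Definition absdir i : V := if up i then dir i else - dir i.

Lemma absdir_pos i : (i <= N)%N -> pos (absdir i).
Proof.
move=> iN; have [_ dP] := dirP iN; rewrite /absdir /up.
by case: asboolP => // /(neg_posP dP).
Qed.

Definition shift i : R := pairing (aprod i 0) a.

(* The integer part of [- <., a^vee>] on the [i]-th alcove of the gallery
   folded at [J]. *)
Definition floor_at i : R :=
  if up i then (nbefore i (absdir i))%:R - 1 - shift i
  else - (nbefore i (absdir i))%:R - shift i.

(** At a hit the image of the wall bounds the unit interval of the current alcove: from above if the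
    crossing goes up, from below if it goes down. *)
Definition lev i : R := floor_at i + (gprod i (beta i) == a)%:R.

Lemma pairing_aprod i x : (i <= N)%N ->
  pairing (aprod i x) a = pairing x (dir i) + shift i.
Proof.
move=> iN; have [e _] := dirP iN.
rewrite aprodE // (pairingD ipP) -{1}e.
by rewrite (isom_pairing ipP (weyl_isom (gprod_weyl iN))).
Qed.

Lemma floor_between i x : (i <= N)%N ->
  - (nbefore i (absdir i))%:R < pairing x (absdir i) < 1 - (nbefore i (absdir i))%:R ->
  floor_at i < - pairing (aprod i x) a < floor_at i + 1.
Proof.
move=> iN; rewrite pairing_aprod // /floor_at /absdir.
case: up; rewrite ?(pairingNr ipP) => /andP[]; lra.
Qed.

Lemma hit_dir i : (i < N)%N -> hit i -> absdir i = beta i.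
Proof.
move=> iN; rewrite /absdir /up => /orP[/eqP e|/eqP e].
  by rewrite (dir_uniq (ltnW iN) e) asboolT //; apply: beta_pos.
have e' : gprod i (- beta i) = a.
  by rewrite (isomN (weyl_isom (gprod_weyl (ltnW iN)))) e opprK.
by rewrite (dir_uniq (ltnW iN) e') asboolF ?opprK //; apply/posN/beta_pos.
Qed.

Lemma nohit_dir i : (i < N)%N -> ~~ hit i -> absdir i != beta i.
Proof.
move=> iN; apply: contra => /eqP; rewrite /absdir /hits.
have [e _] := dirP (ltnW iN).
case: ifP => _ <-; first by rewrite e eqxx.
by rewrite (isomN (weyl_isom (gprod_weyl (ltnW iN)))) e eqxx orbT.
Qed.

Lemma simpleN_neq : - a != a.
Proof.
apply/eqP => e; apply: (posN (simple_pos D p)); rewrite e; exact: simple_pos.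
Qed.

Lemma hit_up i : (i < N)%N -> hit i -> up i = (gprod i (beta i) == a).
Proof.
move=> iN h; have := hit_dir iN h; have [e _] := dirP (ltnW iN).
rewrite /absdir; case: ifP => _ <-; first by rewrite e eqxx.
by rewrite (isomN (weyl_isom (gprod_weyl (ltnW iN)))) e (negbTE simpleN_neq).
Qed.

Lemma lev_value i y : (i < N)%N -> hit i ->
  pairing y (beta i) = - (nbefore i (beta i))%:R ->
  - pairing (aprod i y) a = lev i.
Proof.
move=> iN h e; have iN' := ltnW iN; have ad := hit_dir iN h.
rewrite pairing_aprod // /lev -hit_up // /floor_at ad.
move: ad; rewrite /absdir; case: ifP => _.
  by move=> ->; rewrite e /=; lra.
by move=> /(canRL opprK) ->; rewrite (pairingNr ipP) e /=; lra.
Qed.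

Lemma shift_int i : (i <= N)%N -> shift i \is a Num.int.
Proof.
elim: i => [|i IH] iN; first by rewrite /shift /= (pairing0 ipP) rpred0.
rewrite /shift /=; case: ifP => _; last exact/IH/ltnW.
rewrite /= aprodE ?(ltnW iN) // (pairingD ipP) rpredD //; last exact/IH/ltnW.
have iw := weyl_isom (gprod_weyl (ltnW iN)).
rewrite /wall_refl /arefl (pairing0 ipP) !sub0r scaleNr opprK (isomZ iw).
rewrite (pairingZ ipP) rpredM ?intr_int //.
have [_ _ h _] := roots_axiom D.
apply: h; first exact: simple_root.
apply: weyl_root; first exact: gprod_weyl (ltnW iN).
exact/pos_root/beta_pos.
Qed.

Lemma floor_int i : (i <= N)%N -> floor_at i \is a Num.int.
Proof.
move=> /shift_int h; rewrite /floor_at; case: up.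
  by rewrite rpredB ?rpredB ?rpred_nat ?rpred1.
by rewrite rpredB ?rpredN ?rpred_nat.
Qed.

Lemma lev_int i : (i < N)%N -> lev i \is a Num.int.
Proof. by move=> iN; rewrite rpredD ?floor_int ?rpred_nat // ltnW. Qed.

Lemma int_close (x y z : R) : x \is a Num.int -> y \is a Num.int ->
  x < z < x + 1 -> y < z < y + 1 -> x = y.
Proof.
move=> /intrP[m ->] /intrP[n ->] /andP[h1 h2] /andP[h3 h4]; congr intr.
have : (m%:~R : R) < (n + 1)%:~R by rewrite intrD; apply: lt_trans h4.
have : (n%:~R : R) < (m + 1)%:~R by rewrite intrD; apply: lt_trans h2.
rewrite !ltr_int; lia.
Qed.

(** A fold fixes its wall pointwise, so points of the wall have the same image before and after step
    [i]. *)
Lemma aprod_wall i z : (i < N)%N ->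
  pairing z (beta i) = - (nbefore i (beta i))%:R -> aprod i.+1 z = aprod i z.
Proof.
move=> iN e /=; case: ifP => //= _.
by rewrite /wall_refl /arefl e mulrNz subrr scale0r subr0.
Qed.

Lemma dirS i : (i < N)%N ->
  dir i.+1 = if J i then refl (beta i) (dir i) else dir i.
Proof.
move=> iN; have [e dP] := dirP (ltnW iN).
apply: dir_uniq => //=; case: ifP => //= _.
by rewrite (reflK ipP) ?(pos_nz (beta_pos iN)).
Qed.

Lemma nohit_dirS i : (i < N)%N -> ~~ hit i -> absdir i.+1 != beta i.
Proof.
move=> iN nh; have := nohit_dir iN nh; have b0 := pos_nz (beta_pos iN).
have [_ dP] := dirP (ltnW iN).
have n1 : dir i != beta i.
  apply: contra nh => /eqP de; rewrite /hits -de; case: (dirP (ltnW iN)) => -> _.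
  by rewrite eqxx.
have n2 : dir i != - beta i.
  apply: contra nh => /eqP de; rewrite /hits -[beta i]opprK -de.
  rewrite (isomN (weyl_isom (gprod_weyl (ltnW iN)))).
  by case: (dirP (ltnW iN)) => -> _; rewrite eqxx orbT.
move=> _; rewrite /absdir dirS //.
have inj := inv_inj (reflK ipP b0).
case: (J i); case: ifP => _ //.
- by rewrite -(inj_eq inj) (reflK ipP b0) (refl_self ipP b0).
- by rewrite eqr_oppLR -(inj_eq inj) (reflK ipP b0) (reflNx ipP) (refl_self ipP b0) opprK.
- by rewrite eqr_oppLR.
Qed.

(** The point of [beta_wall] lies strictly inside the strips of [absdir i] and of [absdir i.+1],
    both different from [beta i], and its image is unchanged by the step. Both floors are therefore
    the integer part of one number. *)
Lemma floor_nohit i : (i < N)%N -> ~~ hit i -> floor_at i.+1 = floor_at i.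
Proof.
move=> iN nh; have [z [e hz]] := beta_wall iN.
apply: (@int_close _ _ (- pairing (aprod i z) a)); rewrite ?floor_int // ?(ltnW iN) //.
- rewrite -(aprod_wall iN e); apply: floor_between => //.
  rewrite nbeforeS eq_sym (negbTE (nohit_dirS iN nh)) addn0.
  by apply: hz; [exact: absdir_pos|exact: nohit_dirS].
- apply: floor_between; first exact: ltnW.
  by apply: hz; [exact: absdir_pos (ltnW iN)|exact: nohit_dir].
Qed.

(** A fold is a Bruhat cover, so [gprod i] sends [beta i] to a positive root; the value [- a] is
    excluded. *)
Lemma fold_dir i : (i < N)%N -> hit i -> J i -> gprod i (beta i) = a.
Proof.
move=> iN /orP[/eqP//|/eqP e] Ji.
have := cover_pos (gprod_weyl (ltnW iN)) (beta_pos iN) (J_cover iN Ji).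
by rewrite e => /(posN (simple_pos D p)).
Qed.

Lemma fold_up i : (i < N)%N -> hit i -> J i -> up i /\ ~~ up i.+1.
Proof.
move=> iN h Ji; have e := fold_dir iN h Ji.
rewrite hit_up // e eqxx; split=> //.
have de := dir_uniq (ltnW iN) e.
rewrite /up dirS // Ji de (refl_self ipP) ?(pos_nz (beta_pos iN)) //.
by apply/asboolPn/posN/beta_pos.
Qed.

Lemma floor_fold i : (i < N)%N -> hit i -> J i -> floor_at i.+1 = floor_at i.
Proof.
move=> iN h Ji; have [u1 u2] := fold_up iN h Ji.
have e := fold_dir iN h Ji; have de := dir_uniq (ltnW iN) e.
have ad : absdir i.+1 = beta i.
  rewrite /absdir (negbTE u2) dirS // Ji de (refl_self ipP) ?opprK //.
  exact: pos_nz (beta_pos iN).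
rewrite /floor_at u1 (negbTE u2) ad hit_dir // nbeforeS eqxx addn1 -natr1.
(* The count of [beta i] has grown by one and enters with the opposite sign; the translation part of
   the affine fold compensates exactly. *)
suff -> : shift i.+1 = shift i - 2 * (nbefore i (beta i))%:R by lra.
rewrite /shift /= Ji /= aprodE ?(ltnW iN) // (pairingD ipP) addrC; congr (_ + _).
have iw := weyl_isom (gprod_weyl (ltnW iN)).
rewrite /wall_refl /arefl (pairing0 ipP) !sub0r scaleNr opprK (isomZ iw) e.
rewrite (pairingZ ipP) (pairing_self ipP) ?(pos_nz (simple_pos D p)) //.
by rewrite mulrNz mulNr mulrC.
Qed.

Lemma floor_cross i : (i < N)%N -> hit i -> ~~ J i ->
  [/\ up i.+1 = up i & floor_at i.+1 = floor_at i + if up i then 1 else -1].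
Proof.
move=> iN h Ji; have de : dir i.+1 = dir i by rewrite dirS // (negbTE Ji).
have ue : up i.+1 = up i by rewrite /up de.
split=> //; have ad : absdir i.+1 = beta i by rewrite -(hit_dir iN h) /absdir ue de.
have se : shift i.+1 = shift i by rewrite /shift /= (negbTE Ji).
rewrite /floor_at ue ad (hit_dir iN h) se nbeforeS eqxx addn1 -natr1.
case: up; lra.
Qed.

(** The lifting property in the form of [cover_simple]: a fold that turns the sign from plus to
    minus has [gprod i (beta i) = a], hence is a hit. *)
Lemma up_nohit i : (i < N)%N -> ~~ hit i -> up i -> up i.+1.
Proof.
move=> iN nh u; apply: contraNT nh => nu.
have [e dP] := dirP (ltnW iN).
move: nu; rewrite /up dirS //; case: ifP => Ji; last by rewrite -/(up i) u.
move=> /asboolPn nu; rewrite /hits.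
rewrite (cover_simple (gprod_weyl (ltnW iN)) (beta_pos iN) (J_cover iN Ji) dP e) ?eqxx //.
exact/asboolP.
Qed.

Variable lam : V.
Hypothesis lam_count : forall d, pos d -> pairing lam d = (nbefore N d)%:R.

(** The final weight acts as one more wall: its level is the upper end of the last unit interval if
    the sign is plus, the lower end otherwise. *)
Lemma floor_last : pairing (- aprod N (- lam)) a = floor_at N + (up N)%:R.
Proof.
rewrite (pairingNl ipP) pairing_aprod // (pairingNl ipP) /floor_at.
have := lam_count (absdir_pos (leqnn N)); rewrite /absdir.
case: up; rewrite ?(pairingNr ipP) /= => h; lra.
Qed.

Lemma floor0 : floor_at 0 = -1 /\ up 0.
Proof.
have de : dir 0 = a by apply: dir_uniq.
have u : up 0 by rewrite /up de; apply/asboolP/simple_pos.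
(* The start is -1 because the pairing with [a] lies between 0 and 1 on the fundamental alcove and
   the floor is taken of its negative. *)
by rewrite /floor_at u /shift /= (pairing0 ipP); split=> //; rewrite /nbefore /=; lra.
Qed.

Variable M : R.
Hypothesis M_last : floor_at N + (up N)%:R <= M.
Hypothesis M_lev : forall i, (i < N)%N -> hit i -> lev i <= M.

(** While the sign is plus and no hit occurs, sign and floor persist. The next hit, or the end of
    the gallery, then has level [floor_at i + 1]. *)
Lemma up_below i : (i <= N)%N -> up i -> floor_at i + 1 <= M.
Proof.
move=> iN; have [k] := ubnP (N - i)%N; elim: k i iN => // k IH i iN ki u.
move: iN; rewrite leq_eqVlt => /orP[/eqP e|iN].
  by move: M_last; rewrite -e u.
have [h|nh] := boolP (hit i).
  by have := M_lev iN h; rewrite /lev -hit_up // u.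
rewrite -floor_nohit //; apply: IH => //; first by move: ki iN; lia.
exact: up_nohit.
Qed.

(** The sign starts as plus and turns to minus only at a fold in I(J, p). The latest such fold has
    the level wanted, since after it the floor can only decrease. *)
Lemma down_above i : (i <= N)%N -> ~~ up i ->
  exists j, [/\ (j < i)%N, hit j & floor_at i + 1 <= lev j].
Proof.
elim: i => [|i IH] iN u; first by rewrite floor0.2 in u.
have IH' : floor_at i.+1 <= floor_at i -> ~~ up i ->
    exists j, [/\ (j < i.+1)%N, hit j & floor_at i.+1 + 1 <= lev j].
  move=> le /(IH (ltnW iN))[j [h1 h2 h3]]; exists j; split=> //.
    by rewrite ltnS ltnW.
  by apply: le_trans h3; rewrite lerD2r.
have [h|nh] := boolP (hit i); last first.
  apply: IH'; first by rewrite floor_nohit.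
  by apply: contra u; apply: up_nohit.
have [Ji|nJi] := boolP (J i).
  exists i; split=> //; rewrite floor_fold // /lev -hit_up //.
  by have [-> _] := fold_up iN h Ji.
have [ue fe] := floor_cross iN h nJi; rewrite ue in u.
by apply: IH' => //; rewrite fe (negbTE u) gerDl lerN10.
Qed.

Hypothesis M_pos : 0 < M.

(** The floor rises only at an unfolded upward crossing, and the new floor is the level of that
    crossing, which is at most [M] and different from [M]. *)
Lemma below_before n : (n <= N)%N ->
  (forall i, (i < n)%N -> hit i -> lev i != M) -> floor_at n < M.
Proof.
elim: n => [|n IH] nN hn; first by rewrite floor0.1; move: M_pos; lra.
have {}IH : floor_at n < M.
  by apply: IH => [|i i_n]; [exact: ltnW|apply: hn; rewrite ltnS ltnW].
have [h|nh] := boolP (hit n); last by rewrite floor_nohit.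
have [Jn|nJn] := boolP (J n); first by rewrite floor_fold.
have [ue ->] := floor_cross nN h nJn; have := M_lev nN h; have := hn _ (ltnSn n) h.
rewrite /lev -hit_up //; case: up => /=; last by move=> _ _; lra.
by move=> ne le; rewrite lt_neqAle ne.
Qed.

(** With sign minus the level would equal the floor, which is still below [M]. An unfolded upward
    crossing would reach floor [M] with sign plus, against [up_below]. *)
Lemma first_max m : (m < N)%N -> hit m -> lev m = M ->
  (forall i, (i < m)%N -> hit i -> lev i != M) ->
  [/\ up m, J m & floor_at m + 1 = M].
Proof.
move=> mN h e hm; have lt := below_before (ltnW mN) hm.
have um : up m.
  by apply: contraLR lt => nu; rewrite -e /lev -hit_up // (negbTE nu) addr0 ltxx.
have fe : floor_at m + 1 = M by rewrite -e /lev -hit_up // um.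
split=> //; apply: contraT => nJ.
have [ue fe'] := floor_cross mN h nJ.
have := @up_below m.+1 mN; rewrite ue fe' um fe => /(_ isT); lra.
Qed.

(** Going back from [n], the last hit cannot be a fold, which would leave the sign minus. The sign
    cannot have been minus at a stage without a hit, since [down_above] would give an earlier hit of
    level at least [M]. The case [n = N] covers an infinite [m]. *)
Lemma pred_max n : (n <= N)%N -> up n -> floor_at n + 1 = M ->
  (forall i, (i < n)%N -> hit i -> lev i != M) ->
  exists k, [/\ (k < n)%N, hit k, forall j, (k < j < n)%N -> ~~ hit j,
    ~~ J k & forall j, (k <= j <= n)%N -> up j].
Proof.
elim: n => [|n IH] nN un fn hn.
  by move: fn M_pos; rewrite floor0.1; lra.
have hn' i : (i < n)%N -> hit i -> lev i != M by move=> i_n; apply: hn; rewrite ltnS ltnW.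
have [h|nh] := boolP (hit n).
  have [Jn|nJn] := boolP (J n).
    by have [_] := fold_up nN h Jn; rewrite un.
  have [ue fe] := floor_cross nN h nJn; exists n; split=> //.
  - by move=> j; lia.
  - move=> j; rewrite -ltnS => /andP[h1 h2]; have [->|-> //] : j = n \/ j = n.+1 by lia.
    by rewrite -ue.
have fe := floor_nohit nN nh.
have un' : up n.
  apply: contraT => nu.
  have [j [h1 h2 h3]] := down_above (ltnW nN) nu.
  have := hn' _ h1 h2; rewrite -fe fn in h3.
  by have := M_lev (ltn_trans h1 nN) h2 => h4; rewrite eq_le h3 h4.
have [k [h1 h2 h3 h4 h5]] := IH (ltnW nN) un' (etrans (congr1 (+%R^~ 1) (esym fe)) fn) hn'.
exists k; split=> //.
- by rewrite ltnS ltnW.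
- move=> j /andP[j1]; rewrite ltnS leq_eqVlt => /orP[/eqP->//|j2].
  by apply: h3; rewrite j1.
- move=> j /andP[j1]; rewrite leq_eqVlt => /orP[/eqP->//|]; rewrite ltnS => j2.
  by apply: h5; rewrite j1.
Qed.

End Chain.
End Gallery.

(** * Alcove paths *)

Section AlcoveGeometry.
Variables (R : realType) (r : nat) (D : root_system R r).
Local Notation V := 'rV[R]_r.
Local Notation pairing := (pairing (ip D)).
Local Notation pos := (positive D).
Local Notation Phi := (Defs.roots D).
Let ipP := ip_axiom D.

Lemma pairing_continuous d : continuous (pairing^~ d).
Proof.
have E x : pairing x d =
    \sum_(i <- index_enum 'I_r) x 0 i * pairing (delta_mx 0 i) d.
  rewrite {1}(row_sum_delta x) (pairing_sum ipP); apply: eq_bigr => i _.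
  by rewrite (pairingZ ipP).
have -> : pairing^~ d =
    (fun x : V => \sum_(i <- index_enum 'I_r) x 0 i * pairing (delta_mx 0 i) d).
  by apply/funext.
elim: (index_enum _) => [|i s IH].
  rewrite (_ : (fun _ => _) = cst 0); first exact: cst_continuous.
  by apply/funext => x; rewrite big_nil.
rewrite (_ : (fun _ => _) = (fun x : V => x 0 i * pairing (delta_mx 0 i) d +
    \sum_(j <- s) x 0 j * pairing (delta_mx 0 j) d)); last first.
  by apply/funext => x; rewrite big_cons.
move=> x; have h1 := @coord_continuous R 1 r 0 i x.
exact: cvgD (cvgM h1 (cvg_cst _)) (IH x).
Qed.

Lemma closure_pairing_ge (A : set V) d l x :
  (forall y, A y -> l <= pairing y d) -> closure A x -> l <= pairing x d.
Proof.
move=> h cx; rewrite leNgt; apply/negP => lt.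
have nb : nbhs x [set y | pairing y d < l].
  apply: open_nbhs_nbhs; split=> //.
  apply: (open_comp (D := [set z | z < l])); last exact: open_lt.
  by move=> y _; apply: pairing_continuous.
by have [y [Ay /=]] := cx _ nb; rewrite ltNge h.
Qed.

Lemma closure_pairing_le (A : set V) d l x :
  (forall y, A y -> pairing y d <= l) -> closure A x -> pairing x d <= l.
Proof.
move=> h cx; rewrite -lerN2 -(pairingNr ipP); apply: closure_pairing_ge cx.
by move=> y /h; rewrite (pairingNr ipP) lerN2.
Qed.

Lemma closure_pairing_near (A : set V) d l u x : closure A x ->
  l < pairing x d < u -> exists2 y, A y & l < pairing y d < u.
Proof.
move=> cx /andP[h1 h2].
have n1 : nbhs x [set y | l < pairing y d].
  apply: open_nbhs_nbhs; split=> //.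
  apply: (open_comp (D := [set z | l < z])); last exact: open_gt.
  by move=> y _; apply: pairing_continuous.
have n2 : nbhs x [set y | pairing y d < u].
  apply: open_nbhs_nbhs; split=> //.
  apply: (open_comp (D := [set z | z < u])); last exact: open_lt.
  by move=> y _; apply: pairing_continuous.
have [y [Ay [/= a1 a2]]] := cx _ (filterI n1 n2).
by exists y => //; rewrite a1.
Qed.

(** The image of a connected component under the pairing is an interval that avoids all integers. *)
Lemma alcove_floor (A : set V) d (k : int) y z : alcove D A -> d \in Phi ->
  A y -> k%:~R < pairing y d < k%:~R + 1 -> A z ->
  k%:~R < pairing z d < k%:~R + 1.
Proof.
move=> [x xr ->] dP Ay /andP[h1 h2] Az.
have rgy w : connected_component (regular_points D) x w -> forall l : int, pairing w d <> l%:~R.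
  by move=> /connected_component_sub h l; apply: h.
have itv : is_interval (pairing^~ d @` connected_component (regular_points D) x).
  apply/connected_intervalP; apply: connected_continuous_connected.
    exact: component_connected.
  by apply: continuous_subspaceT => w; apply: pairing_continuous.
have Iy : (pairing^~ d @` connected_component (regular_points D) x) (pairing y d) by exists y.
have Iz : (pairing^~ d @` connected_component (regular_points D) x) (pairing z d) by exists z.
apply/andP; split; rewrite ltNge; apply/negP => le.
  have [|w Aw /= e] := itv _ _ Iz Iy k%:~R; first by rewrite le ltW.
  exact: rgy Aw _ e.
have [|w Aw /= e] := itv _ _ Iy Iz (k + 1)%:~R; first by rewrite intrD le andbT ltW.
exact: rgy Aw _ e.
Qed.

Definition between (n : V -> nat) (x : V) (d : V) : Prop :=
  - (n d)%:R < pairing x d < 1 - (n d)%:R.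

(** The witness is the component of [d] orthogonal to [b]; it is nonzero because distinct positive
    roots of a reduced system are not proportional. *)
Lemma perp_part (b d : V) : pos b -> pos d -> d != b ->
  exists2 v, pairing v b = 0 & 0 < pairing v d.
Proof.
move=> pb pd ne; have b0 := pos_nz pb; have d0 := pos_nz pd.
exists (d - (ip D d b / ip D b b) *: b).
  rewrite (pairingB ipP) (pairingZ ipP) (pairing_self ipP) // (pairingE ipP).
  by field; exact: lt0r_neq0 (ip_gt0 ipP b0).
rewrite (pairing_gt0 ipP) //.
set v := d - _.
have vb : ip D v b = 0.
  rewrite (ipDl ipP) (ipNl ipP) (ipZl ipP) divfK ?subrr //.
  exact: lt0r_neq0 (ip_gt0 ipP b0).
have v0 : v != 0.
  rewrite /v subr_eq0; apply: contra ne => /eqP e.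
  have [_ _ _ red] := roots_axiom D.
  have := red _ (pos_root pb) (ip D d b / ip D b b); rewrite -e => /(_ (pos_root pd)).
  case=> c; first by rewrite e c scale1r.
  by move: pd; rewrite e c scaleN1r => /(posN pb).
have -> : ip D v d = ip D v v.
  by rewrite {3}/v (ipDr ipP) (ipNr ipP) (ipZr ipP) vb mulr0 subr0.
exact: ip_gt0.
Qed.

(** The strips of [A] pin the common wall to the hyperplane at [- n b]. An interior point of that
    wall lies strictly inside all other strips, so points of [C] close to it do too, and
    [alcove_floor] extends this to all of [C]. *)
Lemma alcove_cross (A C : set V) (b : V) (n : V -> nat) : pos b ->
  alcove_step D (- b) A C ->
  (forall x, A x -> forall d, pos d -> between n x d) ->
  (exists z, pairing z b = - (n b)%:R /\
     forall d, pos d -> d != b -> between n z d) /\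
  (forall x, C x -> forall d, pos d -> between (fun d => (n d + (b == d))%N) x d).
Proof.
move=> pb [alA alC _ _ [k [[F [wA wC]] Ak Ck]]] hA.
have [FA [z Hz Fz]] := wA.
have Fzz : F z by move: (nbhs_singleton Fz); apply.
have FC : F = closure C `&` hyperplane (ip D) (- b) k by case: wC.
have zb : pairing z b = - k%:~R.
  by move: Hz; rewrite /hyperplane /= (pairingNr ipP) => <-; rewrite opprK.
have cA y : F y -> closure A y by rewrite FA => -[].
have zcC : closure C z by move: Fzz; rewrite FC => -[].
have [x Ax] : exists x, A x.
  by case: alA => x xr ->; exists x; apply: connected_component_refl.
have kn : pairing z b = - (n b)%:R.
  have Az b' : A b' -> - k%:~R < pairing b' b.
    by move=> /Ak; rewrite (pairingNr ipP) ltrNl.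
  have := Az _ Ax; have /andP[] := hA _ Ax _ pb.
  have l1 : - (n b)%:R <= pairing z b.
    by apply: (closure_pairing_ge _ (cA _ Fzz)) => y Ay; have /andP[/ltW] := hA _ Ay _ pb.
  move=> h1 h2 h3; move: l1; rewrite zb lerN2 => l1.
  have : (k%:~R : R) <= (n b)%:Z%:~R by [].
  have : ((n b)%:Z%:~R : R) < (k + 1)%:~R.
    by rewrite intrD; move: h1 h2 h3; rewrite -[(n b)%:Z%:~R]/((n b)%:R : R); lra.
  rewrite ltr_int ler_int => q1 q2; have -> : k = (n b)%:Z by lia.
  by [].
have zd d : pos d -> d != b -> between n z d.
  move=> pd ne; have [v vb vd] := perp_part pb pd ne.
  (* [z] moves inside the wall along [v] both ways while remaining in the
     closure of [A], so the weak inequalities at [z] are strict. *)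
  have line := @cvgZr_tmp R V R (nbhs (0 : R)) (nbhs_filter _) id 0 v cvg_id.
  have {}line := cvgD (@cvg_cst V z _ (nbhs (0 : R)) (nbhs_filter _)) line.
  rewrite scale0r addr0 in line.
  have {}line : (fun s : R => z + s *: v) @ nbhs (0 : R) --> z := line (nbhs_filter _).
  have Fl : \forall s \near (0 : R), F (z + s *: v).
    have near_z : \forall s \near (0 : R),
      hyperplane (ip D) (- b) k (z + s *: v) -> F (z + s *: v) := line _ Fz.
    move: near_z; apply: filterS => s; apply.
    by rewrite /hyperplane /= (pairingNr ipP) (pairingD ipP) (pairingZ ipP) vb mulr0 addr0 zb opprK.
  have [/= e e0 he] := (nbhs_ballP _ _).1 Fl.
  have bnd s : `|s| < e -> - (n d)%:R <= pairing z d + s * pairing v d <= 1 - (n d)%:R.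
    move=> se; have /cA cl : F (z + s *: v).
      by apply: he; rewrite /ball /= sub0r normrN.
    have -> : pairing z d + s * pairing v d = pairing (z + s *: v) d.
      by rewrite (pairingD ipP) (pairingZ ipP).
    apply/andP; split.
      by apply: (closure_pairing_ge _ cl) => y Ay; have /andP[/ltW] := hA _ Ay _ pd.
    by apply: (closure_pairing_le _ cl) => y Ay; have /andP[_ /ltW] := hA _ Ay _ pd.
  have e2 : 0 < e / 2 by rewrite divr_gt0.
  have q1 : `|e / 2| < e by rewrite gtr0_norm //; lra.
  have /andP[_ b1] := bnd _ q1.
  have /andP[b2 _] := bnd (- (e / 2)) (etrans (congr1 (<%R^~ e) (normrN _)) q1).
  have ev : 0 < e / 2 * pairing v d by rewrite mulr_gt0.
  rewrite mulNr in b2; rewrite /between; lra.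
split; first by exists z.
move=> y Cy d pd.
have toInt m c : - m%:R < pairing y c < 1 - m%:R <->
    (- (m%:Z))%:~R < pairing y c < (- (m%:Z))%:~R + 1.
  by rewrite mulrNz addrC.
have [<-|ne] := eqVneq b d.
  rewrite /between eqxx; apply/(toInt (n b + 1)%N).
  (* Near the wall, [C] contains points whose pairing with [b] is just below [- n b]; this selects
     the next strip. *)
  have zbb : (- ((n b + 1)%N%:Z))%:~R < pairing z b < 1 - (n b)%:R.
    by rewrite kn mulrNz -[(n b + 1)%N%:Z%:~R]/((n b + 1)%:R : R) natrD; lra.
  have [w Cw /andP[w1 w2]] := closure_pairing_near zcC zbb.
  apply: (alcove_floor alC (pos_root pb) Cw _ Cy); rewrite w1 /=.
  have := Ck _ Cw; rewrite (pairingNr ipP) -ltrNr -zb kn => w3.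
  by apply: (lt_le_trans w3); rewrite mulrNz -[(n b + 1)%N%:Z%:~R]/((n b + 1)%:R : R) natrD; lra.
have zbd : - (n d)%:R < pairing z d < 1 - (n d)%:R by apply: zd; rewrite // eq_sym.
have [w Cw hw] := closure_pairing_near zcC zbd.
rewrite /between (negbTE ne) addn0.
apply/toInt; apply: (alcove_floor alC (pos_root pd) Cw _ Cy).
by move: hw; rewrite mulrNz addrC.
Qed.

Lemma alcove_path_walls (bs : seq V) (A B : set V) (n : V -> nat) :
  {in bs, forall b, pos b} -> alcove_path D A [seq - b | b <- bs] B ->
  (forall x, A x -> forall d, pos d -> between n x d) ->
  (forall i, (i < size bs)%N ->
     let m d := (n d + count_mem d (take i bs))%N in
     exists z, pairing z bs`_i = - (m bs`_i)%:R /\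
       forall d, pos d -> d != bs`_i -> between m z d) /\
  (forall x, B x -> forall d, pos d ->
     between (fun d => n d + count_mem d bs)%N x d).
Proof.
elim: bs A n => [|b bs IH] A n pbs /=.
  move=> <- hA; split=> // x Ax d pd; have := hA _ Ax _ pd.
  by rewrite /between addn0.
move=> [C [st pth]] hA.
have pb : pos b by apply: pbs; rewrite inE eqxx.
have [h1 h2] := alcove_cross pb st hA.
have [|I1 I2] := IH C _ _ pth h2; first by move=> c cb; apply: pbs; rewrite inE cb orbT.
split=> [[|i]|] /=.
- move=> _; case: h1 => z [e hz]; exists z; rewrite addn0; split=> // d pd ne.
  by have := hz _ pd ne; rewrite /between addn0.
- rewrite ltnS => /I1 [z [e hz]]; exists z; rewrite addnA; split=> // d pd ne.
  by have := hz _ pd ne; rewrite /between addnA.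
- by move=> x Bx d pd; have := I2 _ Bx _ pd; rewrite /between addnA.
Qed.

Lemma nbefore_take (s : seq V) i d : (i <= size s)%N ->
  nbefore (nth 0 s) i d = count_mem d (take i s).
Proof.
by move=> le; rewrite -(map_nth_iota0 0 le) count_map.
Qed.

Variables (lam : V) (N : nat) (G : N.-tuple V).
Hypothesis GP : lambda_chain D lam G.

Lemma chain_pos i : (i < N)%N -> pos G`_i.
Proof. by case: GP => h _ _ iN; have := h (Ordinal iN); rewrite (tnth_nth 0). Qed.

Lemma fundamental_between x d : fundamental_alcove D x -> pos d ->
  between (fun=> 0%N) x d.
Proof. by move=> h /h; rewrite /between mulr0n oppr0 addr0. Qed.

Lemma chain_path :
  (forall i, (i < size G)%N ->
     let m d := (0 + count_mem d (take i G))%N in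
     exists z, pairing z G`_i = - (m G`_i)%:R /\
       forall d, pos d -> d != G`_i -> between m z d) /\
  (forall x, [set x - lam | x in fundamental_alcove D] x -> forall d, pos d ->
     between (fun d => 0 + count_mem d G)%N x d).
Proof.
case: GP => h pth _; apply: (alcove_path_walls (A := fundamental_alcove D)) => //.
- by move=> b /tnthP[i ->].
- by move=> x Ax d; apply: fundamental_between.
Qed.

Lemma chain_wall i : (i < N)%N -> exists z : V,
  pairing z G`_i = - (nbefore (nth 0 G) i G`_i)%:R /\
  forall d, pos d -> d != G`_i ->
    - (nbefore (nth 0 G) i d)%:R < pairing z d < 1 - (nbefore (nth 0 G) i d)%:R.
Proof.
move=> iN; have := chain_path.1 i; rewrite size_tuple => /(_ iN)[z [e hz]].
have E d : nbefore (nth 0 G) i d = count_mem d (take i G).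
  by rewrite nbefore_take // size_tuple ltnW.
by exists z; rewrite E; split=> // d pd ne; rewrite E; apply: hz.
Qed.

(** Compare the strips of a point of the fundamental alcove with those of its translate by [- lam]:
    an integer in the interval so obtained is the count. *)
Lemma chain_weight : (0 < N)%N ->
  {in Phi, forall a, pairing lam a \is a Num.int} ->
  forall d, pos d -> pairing lam d = (nbefore (nth 0 G) N d)%:R.
Proof.
move=> N0 lint d pd.
(* The first step of the path makes its starting set an alcove, hence nonempty; this is where
   [0 < N] enters. *)
have [x xA] : exists x, fundamental_alcove D x.
  case: GP N0 => _ + _; case: (tval G) (size_tuple G) => [<-//|b s _].
  by case=> C [[[x xr ->] _ _ _ _] _] _; exists x; apply: connected_component_refl.
have := chain_path.2 (x - lam) (ex_intro2 _ _ x xA erefl) _ pd.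
have := fundamental_between xA pd.
rewrite /between (pairingB ipP) nbefore_take ?size_tuple // -{3}(size_tuple G) take_size.
have /intrP[l ->] := lint _ (pos_root pd).
rewrite add0n mulr0n oppr0 addr0; set m := count _ _ => /andP[h1 h2] /andP[h3 h4].
rewrite -[m%:R]/(m%:Z%:~R : R); congr intr.
have : ((l : int)%:~R : R) < (m%:Z + 1)%:~R by rewrite intrD -[m%:Z%:~R]/(m%:R : R); lra.
have : ((m%:Z)%:~R : R) < (l + 1)%:~R by rewrite intrD -[m%:Z%:~R]/(m%:R : R); lra.
rewrite !ltr_int; lia.
Qed.

End AlcoveGeometry.

(** * Root systems of rank two *)

(* Enumerate the roots of a rank two root system by angle, starting from a
   simple root, so that root [q + k] is the opposite of root [k]: the reflection
   in root [i] maps root [k] to root [2 i + q - k] modulo [2 q]. *)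
Definition dih_refl (q i k : nat) : nat := ((2 * i + 3 * q - k) %% (2 * q))%N.

(* Positive roots and coroots of the crystallographic rank two root systems
   with simple roots [A], [B], where [m = - <B, A^vee>] and
   [n = - <A, B^vee>]: coordinates in [A, B] and [A^vee, B^vee], listed from
   [A] to [B] by angle. *)
Definition rank2_roots (m n : nat) : seq (int * int) :=
  match m, n with
  | 0, 0 => [:: (1, 0); (0, 1)]
  | 1, 1 => [:: (1, 0); (1, 1); (0, 1)]
  | 2, 1 => [:: (1, 0); (2, 1); (1, 1); (0, 1)]
  | 1, 2 => [:: (1, 0); (1, 1); (1, 2); (0, 1)]
  | 3, 1 => [:: (1, 0); (3, 1); (2, 1); (3, 2); (1, 1); (0, 1)]
  | 1, 3 => [:: (1, 0); (1, 1); (2, 3); (1, 2); (1, 3); (0, 1)]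
  | _, _ => [::]
  end.

Definition rank2_types : seq (nat * nat) :=
  [:: (0, 0); (1, 1); (2, 1); (1, 2); (3, 1); (1, 3)]%N.

(** Passing to the dual system exchanges the two Cartan integers and preserves the order by
    angle. *)
Definition rank2_coroots (m n : nat) : seq (int * int) := rank2_roots n m.

Definition signed_coord (L : seq (int * int)) k : int * int :=
  if (k < size L)%N then nth (0, 0) L k
  else let c := nth (0, 0) L (k - size L) in (- c.1, - c.2).

(** The quadratic form is [<x, x>] multiplied by [n / <A, A>], and the equations say that [a] gives
    the coroot of [x], with denominators cleared. The two initial cases treat the base roots, also
    when [m = n = 0] makes the form vanish. *)
Definition coroot_ok (m n : int) (x a : int * int) : bool :=
  [|| (x == (1, 0)) && (a == (1, 0)), (x == (0, 1)) && (a == (0, 1)) |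
   [&& (0 < n) && (0 < m), x != (0, 0),
     n * x.1 == a.1 * (n * x.1 * x.1 + m * x.2 * x.2 - m * n * x.1 * x.2) &
     m * x.2 == a.2 * (n * x.1 * x.1 + m * x.2 * x.2 - m * n * x.1 * x.2)]].

(** The number [c] is the pairing of [u] with the coroot [a], computed from the Cartan matrix with
    entries 2, [- m] and [- n]. *)
Definition refl_ok (m n : int) (L C : seq (int * int)) i k : bool :=
  let u := signed_coord L k in let x := nth (0, 0) L i in
  let a := nth (0, 0) C i in
  let c := a.1 * (2 * u.1 - m * u.2) + a.2 * (2 * u.2 - n * u.1) in
  (u.1 - c * x.1, u.2 - c * x.2) == signed_coord L (dih_refl (size L) i k).

Lemma rank2_table_ok : all (fun mn : nat * nat =>
  let: (m, n) := mn in
  let L := rank2_roots m n in let C := rank2_coroots m n in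
  let q := size L in
  [&& q \in [:: 2; 3; 4; 6]%N, size C == q, uniq L,
    nth (0, 0) L 0 == (1, 0), nth (0, 0) L q.-1 == (0, 1),
    all (fun i => coroot_ok m n (nth (0, 0) L i) (nth (0, 0) C i)) (iota 0 q),
    all (fun i => all (refl_ok m n L C i) (iota 0 (2 * q))) (iota 0 q),
    all (fun x => (0 <= x.1) && (0 <= x.2)) L &
    all (fun k => [|| k == 0%N, k == q.-1 |
       (0 < (nth (0, 0) L k).1) && (0 < (nth (0, 0) L k).2)]) (iota 0 q)])
  rank2_types.
Proof. by vm_compute. Qed.

Section RankTwo.
Variables (R : realType) (r : nat) (D : root_system R r).
Local Notation V := 'rV[R]_r.
Local Notation refl := (refl (ip D)).
Local Notation pairing := (pairing (ip D)).
Local Notation pos := (positive D).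
Local Notation Phi := (Defs.roots D).
Let ipP := ip_axiom D.
Variable Psi : seq V.
Hypothesis PsiP : rank2_subsystem D Psi.

Let PsiR : root_system_axioms (ip D) Psi. Proof. by case: PsiP. Qed.
Let PsiPhi : {subset Psi <= Phi}. Proof. by case: PsiP. Qed.

Lemma Psi_refl : {in Psi &, forall a b, refl a b \in Psi}.
Proof. by case: PsiR. Qed.

Lemma Psi_opp a : a \in Psi -> - a \in Psi.
Proof.
move=> aP; have a0 : a != 0 by apply: (@root_nz0 _ _ D); apply: PsiPhi.
by rewrite -(refl_self ipP a0) Psi_refl.
Qed.

Lemma pos_colinear a b c : pos a -> pos b -> b = c *: a -> b = a.
Proof.
move=> pa pb e; have [_ _ _ red] := roots_axiom D.
have := red _ (pos_root pa) c; rewrite -e => /(_ (pos_root pb)) [] c1.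
  by rewrite e c1 scale1r.
by move: pb; rewrite e c1 scaleN1r => /(posN pa).
Qed.

Lemma free_pair a b : pos a -> pos b -> a <> b -> free [:: a; b].
Proof.
move=> pa pb ne; rewrite free_cons seq1_free (pos_nz pb) andbT span_seq1.
apply/negP => /vlineP[k e]; apply: ne.
exact: pos_colinear pb pa e.
Qed.

Lemma span_pair a b : a \in Psi -> b \in Psi -> pos a -> pos b -> a <> b ->
  {subset Psi <= <<[:: a; b]>>%VS}.
Proof.
move=> aP bP pa pb ne; have f := free_pair pa pb ne.
have e : (<<[:: a; b]>> == <<Psi>>)%VS.
  rewrite eqEdim; apply/andP; split.
    apply/span_subvP => x; rewrite !inE => /orP[]/eqP->; exact: memv_span.
  by case: PsiP => _ _ ->; move: f; rewrite /free => /eqP ->.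
by move=> x xP; rewrite (eqP e) memv_span.
Qed.

Lemma comb_pair a b : a \in Psi -> b \in Psi -> pos a -> pos b -> a <> b ->
  forall x, x \in Psi -> exists c : R * R, x = c.1 *: a + c.2 *: b.
Proof.
move=> aP bP pa pb ne x xP.
have /coord_span -> : x \in <<[tuple a; b]>>%VS by exact: (span_pair aP bP).
by rewrite big_ord_recl big_ord1; exists (coord [tuple a; b] ord0 x, coord [tuple a; b] (lift ord0 ord0) x).
Qed.

Section Base.
Variables A B : V.
Hypotheses (AP : A \in Psi) (BP : B \in Psi) (pA : pos A) (pB : pos B).
Hypothesis AB : A <> B.
Hypothesis cone : forall x, x \in Psi -> pos x ->
  exists c : R * R, [/\ 0 <= c.1, 0 <= c.2 & x = c.1 *: A + c.2 *: B].

Let X : 2.-tuple V := [tuple A; B].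

Lemma coordA x y : coord X ord0 (x *: A + y *: B) = x.
Proof.
have f : free X := free_pair pA pB AB.
have eA : coord X ord0 A = 1 by have := coord_free ord0 ord0 f.
have eB : coord X ord0 B = 0 by have := coord_free (lift ord0 ord0) ord0 f.
by rewrite linearD !linearZ /= eA eB mulr1 mulr0 addr0.
Qed.

Lemma coordB x y : coord X (lift ord0 ord0) (x *: A + y *: B) = y.
Proof.
have f : free X := free_pair pA pB AB.
have eA : coord X (lift ord0 ord0) A = 0 by have := coord_free ord0 (lift ord0 ord0) f.
have eB : coord X (lift ord0 ord0) B = 1.
  by have := coord_free (lift ord0 ord0) (lift ord0 ord0) f.
by rewrite linearD !linearZ /= eA eB mulr1 mulr0 add0r.
Qed.

Lemma comb_inj x y x' y' : x *: A + y *: B = x' *: A + y' *: B -> x = x' /\ y = y'.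
Proof.
move=> e; split; first by rewrite -(coordA x y) e coordA.
by rewrite -(coordB x y) e coordB.
Qed.

Lemma pair_based : based_system (ip D) Psi pos X.
Proof.
split=> //.
- exact: (free_pair pA pB AB).
- by move=> x; rewrite !inE => /orP[]/eqP->.
- exact: (span_pair AP BP).
- move=> x xP; split=> [px p|h].
    have [[c1 c2] [/= h1 h2 ->]] := cone xP px.
    by case: (unliftP ord0 p) => [j|] ->; rewrite ?(ord1 j) ?coordA ?coordB.
  apply: contrapT => /(neg_posP (PsiPhi xP)) npx.
  have [[c1 c2] [/= h1 h2 e]] := cone (Psi_opp xP) npx.
  have ex : x = (- c1) *: A + (- c2) *: B by rewrite !scaleNr -opprD -e opprK.
  move: (h ord0) (h (lift ord0 ord0)); rewrite ex coordA coordB !oppr_ge0 => h3 h4.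
  have c10 : c1 = 0 by apply/eqP; rewrite eq_le h3.
  have c20 : c2 = 0 by apply/eqP; rewrite eq_le h4.
  have := @root_nz0 _ _ D _ (PsiPhi xP).
  by rewrite ex c10 c20 !oppr0 !scale0r addr0 eqxx.
- move=> x xP; case: (pselect (pos x)) => [|/(neg_posP (PsiPhi xP))]; by [left|right].
Qed.

(** If the pairing were positive, the reflection of one root in the other would have coordinates of
    both signs, which [cone] excludes for a root and for its opposite. *)
Lemma base_pairing_le0 a b : (a, b) = (A, B) \/ (a, b) = (B, A) -> pairing b a <= 0.
Proof.
move=> hab; rewrite leNgt; apply/negP => k0.
have [aP bP] : a \in Psi /\ b \in Psi by case: hab => -[-> ->].
have rP := Psi_refl aP bP.
have [c [h1 h2]] : exists c : R * R, (0 <= c.1 /\ 0 <= c.2) /\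
    (refl a b = c.1 *: A + c.2 *: B \/ refl a b = (- c.1) *: A + (- c.2) *: B).
  have [p|/(neg_posP (PsiPhi rP)) p] := pselect (pos (refl a b)).
    by have [c [h1 h2 h3]] := cone rP p; exists c; split=> //; left.
  have [c [h1 h2 h3]] := cone (Psi_opp rP) p; exists c; split=> //; right.
  by rewrite !scaleNr -opprD -h3 opprK.
case: hab => -[ea eb]; rewrite ea eb in h2 k0.
- have E : refl A B = (- pairing B A) *: A + 1 *: B.
    by rewrite /Defs.refl scale1r scaleNr addrC.
  rewrite E in h2; case: h2 => /comb_inj[e1 e2]; case: h1 => h1 h3.
    by move: h1; rewrite -e1 oppr_ge0 leNgt k0.
  by move: h3; rewrite -oppr_le0 -e2 ler10.
- have E : refl B A = 1 *: A + (- pairing A B) *: B.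
    by rewrite /Defs.refl scale1r scaleNr.
  rewrite E in h2; case: h2 => /comb_inj[e1 e2]; case: h1 => h1 h3.
    by move: h3; rewrite -e2 oppr_ge0 leNgt k0.
  by move: h1; rewrite -oppr_le0 -e1 ler10.
Qed.

(** Strict Cauchy-Schwarz gives [m * n < 4], and [2 <A, B> = - m <A, A> = - n <B, B>] shows that [m]
    and [n] vanish together. *)
Lemma cartan_types : exists m n : nat,
  [/\ pairing B A = - m%:R, pairing A B = - n%:R & (m, n) \in rank2_types].
Proof.
have [_ _ int _] := PsiR.
have nat_of a b : a \in Psi -> b \in Psi -> pairing b a <= 0 ->
    exists m : nat, pairing b a = - m%:R.
  move=> aP bP; have /intrP[k ->] := int a b aP bP.
  rewrite (ler_int R k 0) => k0;have [m ->] : exists m : nat, k = - m%:Z by exists `|k|%N; lia.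
  by exists m; rewrite mulrNz.
have [m em] := nat_of _ _ AP BP (base_pairing_le0 (or_introl erefl)).
have [n en] := nat_of _ _ BP AP (base_pairing_le0 (or_intror erefl)).
exists m, n; split=> //.
have a0 := ip_gt0 ipP (pos_nz pA); have b0 := ip_gt0 ipP (pos_nz pB).
(* The component of [B] orthogonal to [A] is nonzero; its squared norm gives the strict
   inequality. *)
have c0 : 0 < ip D (B - (ip D A B / ip D A A) *: A) (B - (ip D A B / ip D A A) *: A).
  apply: (ip_gt0 ipP); rewrite subr_eq0; apply/eqP => e.
  by apply: AB; rewrite (pos_colinear pA pB e).
move: em en; rewrite !(pairingE ipP) (ipC ipP B A) => em en.
have em' : 2 * ip D A B = - m%:R * ip D A A by rewrite -em divfK // lt0r_neq0.
have en' : 2 * ip D A B = - n%:R * ip D B B by rewrite -en divfK // lt0r_neq0.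
have cs : (ip D A B) ^+ 2 < ip D A A * ip D B B.
  suff E : ip D (B - (ip D A B / ip D A A) *: A) (B - (ip D A B / ip D A A) *: A) =
      (ip D A A * ip D B B - ip D A B ^+ 2) / ip D A A.
    by move: c0; rewrite E pmulr_lgt0 ?invr_gt0 // subr_gt0.
  rewrite !(ipDl ipP, ipDr ipP, ipNl ipP, ipNr ipP, ipZl ipP, ipZr ipP).
  by rewrite (ipC ipP B A); field; rewrite lt0r_neq0.
have mn4 : (m * n < 4)%N.
  rewrite -(ltr_nat R) natrM.
  have e4 : m%:R * n%:R * (ip D A A * ip D B B) = 4 * (ip D A B) ^+ 2.
    transitivity ((- m%:R * ip D A A) * (- n%:R * ip D B B)); first by ring.
    by rewrite -em' -en'; ring.
  have p0 : 0 < ip D A A * ip D B B by rewrite mulr_gt0.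
  by rewrite -(ltr_pM2r p0) e4 ltr_pM2l.
have mn0 : (m == 0)%N = (n == 0)%N.
  apply/eqP/eqP => e0; move: em' en'; rewrite e0 oppr0 mul0r.
    move=> -> /esym/eqP; rewrite mulf_eq0 (gt_eqF b0) orbF oppr_eq0 pnatr_eq0.
    by move/eqP.
  move=> + e1; rewrite e1 => /esym/eqP; rewrite mulf_eq0 (gt_eqF a0) orbF oppr_eq0 pnatr_eq0.
  by move/eqP.
move: m n mn4 mn0 {em en em' en'} => [|[|[|[|m]]]] [|[|[|[|n]]]] //=; rewrite ?muln0 ?mul0n //; lia.
Qed.

Section Table.
Variables m n : nat.
Hypotheses (em : pairing B A = - m%:R) (en : pairing A B = - n%:R).
Hypothesis mnP : (m, n) \in rank2_types.

Local Notation L := (rank2_roots m n).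
Local Notation C := (rank2_coroots m n).
Local Notation q := (size L).

Definition int_comb (u : int * int) : V := u.1%:~R *: A + u.2%:~R *: B.

Let tableP := allP rank2_table_ok _ mnP.

Lemma table_size : q \in [:: 2; 3; 4; 6]%N.
Proof. by have /and5P[] := tableP. Qed.

Lemma table_gt1 : (1 < q)%N.
Proof. by move: table_size; rewrite !inE => /or4P[]/eqP->. Qed.

Lemma table_coroot i u : (i < q)%N ->
  pairing u (int_comb (nth (0, 0) L i)) =
  (nth (0, 0) C i).1%:~R * pairing u A + (nth (0, 0) C i).2%:~R * pairing u B.
Proof.
move=> iq; have /and5P[_ _ _ _ /and5P[_ /allP/(_ i) + _ _ _]] := tableP.
rewrite mem_iota add0n => /(_ iq).
move: (nth _ L i) (nth _ C i) => [x y] [a b]; rewrite /coroot_ok /int_comb /=.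
move=> /or3P[|| /and4P[/andP[n0 m0] x0]].
- case/andP => /eqP[-> ->] /eqP[-> ->].
  by rewrite scale1r scale0r addr0 mul1r mul0r addr0.
- case/andP => /eqP[-> ->] /eqP[-> ->].
  by rewrite scale1r scale0r add0r mul1r mul0r add0r.
move=> /eqP/(congr1 (fun k : int => k%:~R : R)).
rewrite /= !(intrM, intrD, mulrNz) => e1 /eqP/(congr1 (fun k : int => k%:~R : R)).
rewrite /= !(intrM, intrD, mulrNz) => e2.
have nR : (0 : R) < n%:~R by rewrite (ltr_int R 0 n).
have mR : (0 : R) < m%:~R by rewrite (ltr_int R 0 m).
move: e1 e2 nR mR; set n' : R := n%:~R; set m' : R := m%:~R.
set x' : R := x%:~R; set y' : R := y%:~R; set a' : R := a%:~R; set b' : R := b%:~R.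
move=> e1 e2 nR mR.
have A0 := ip_gt0 ipP (pos_nz pA); have B0 := ip_gt0 ipP (pos_nz pB).
move: em en; rewrite !(pairingE ipP) (ipC ipP B A) -/m' -/n' => em0 en0.
have em' : ip D A B = - m' / 2 * ip D A A.
  have : 2 * ip D A B = - m' * ip D A A by rewrite -em0 divfK // lt0r_neq0.
  by lra.
have en' : ip D B B = m' / n' * ip D A A.
  have : 2 * ip D A B = - n' * ip D B B by rewrite -en0 divfK // lt0r_neq0.
  rewrite em' => e; apply: (mulfI (lt0r_neq0 nR)).
  have -> : n' * (m' / n' * ip D A A) = m' * ip D A A.
    by rewrite mulrA mulrCA divff ?mulr1 // lt0r_neq0.
  by move: e; lra.
set v := x' *: A + y' *: B.
pose K : R := n' * x' * x' + m' * y' * y' - m' * n' * x' * y'.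
have NE : ip D v v = ip D A A / n' * K.
  rewrite /v !(ipDl ipP, ipDr ipP, ipZl ipP, ipZr ipP) (ipC ipP B A) em' en' /K.
  by field; rewrite lt0r_neq0.
have v0 : v != 0.
  apply: contra x0 => /eqP v0.
  have [x0 y0] : x' = 0 /\ y' = 0 by apply: comb_inj; rewrite !scale0r addr0.
  move/eqP: x0; move/eqP: y0; rewrite !intr_eq0 => /eqP-> /eqP->; exact: eqxx.
have N0 := ip_gt0 ipP v0.
have K1 : a' * K = n' * x' by rewrite e1 /K; ring.
have K2 : b' * K = m' * y' by rewrite e2 /K; ring.
have hx : x' / ip D v v = a' / ip D A A.
  apply/eqP; rewrite eqr_div ?lt0r_neq0 // NE; apply/eqP.
  rewrite [RHS]mulrCA K1; field; exact: lt0r_neq0.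
have hy : y' / ip D v v = b' / ip D B B.
  apply/eqP; rewrite eqr_div ?lt0r_neq0 // NE en'; apply/eqP.
  rewrite [RHS]mulrCA K2; field; exact: lt0r_neq0.
have -> : 2 * ip D u v / ip D v v = 2 * (x' / ip D v v * ip D u A + y' / ip D v v * ip D u B).
  have -> : ip D u v = x' * ip D u A + y' * ip D u B.
    by rewrite (ipDr ipP) !(ipZr ipP).
  by field; exact: lt0r_neq0.
rewrite hx hy; field; by rewrite !lt0r_neq0.
Qed.

Lemma int_combB u k x : int_comb (u.1 - k * x.1, u.2 - k * x.2) =
  int_comb u - k%:~R *: int_comb x.
Proof.
rewrite /int_comb /= !intrD !mulrNz !intrM !scalerDl !scaleNr scalerDr !scalerA.
by rewrite opprD addrACA.
Qed.

Lemma table_refl i k : (i < q)%N -> (k < 2 * q)%N ->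
  refl (int_comb (nth (0, 0) L i)) (int_comb (signed_coord L k)) =
  int_comb (signed_coord L (dih_refl q i k)).
Proof.
move=> iq kq.
have /and5P[_ _ _ _ /and5P[_ _ /allP/(_ i) + _ _]] := tableP.
rewrite mem_iota add0n => /(_ iq)/allP/(_ k); rewrite mem_iota add0n => /(_ kq).
rewrite /refl_ok => /eqP <-; rewrite int_combB /Defs.refl table_coroot //.
congr (_ - _ *: _).
rewrite /int_comb !(pairingD ipP) !(pairingZ ipP) em en.
rewrite (pairing_self ipP (pos_nz pA)) (pairing_self ipP (pos_nz pB)).
rewrite !(intrD, intrM, mulrNz); ring.
Qed.

Definition in_table (x : V) := exists2 k, (k < 2 * q)%N & x = int_comb (signed_coord L k).

Lemma dih_refl_lt i k : (dih_refl q i k < 2 * q)%N.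
Proof. by rewrite ltn_mod muln_gt0 (ltnW table_gt1). Qed.

Lemma int_comb_first : int_comb (nth (0, 0) L 0) = A.
Proof.
have /and5P[_ _ _ /eqP -> _] := tableP.
by rewrite /int_comb /= scale1r scale0r addr0.
Qed.

Lemma int_comb_last : int_comb (nth (0, 0) L q.-1) = B.
Proof.
have /and5P[_ _ _ _ /and5P[/eqP -> _ _ _ _]] := tableP.
by rewrite /int_comb /= scale1r scale0r add0r.
Qed.

Lemma signed_coord_pos k : (k < q)%N -> signed_coord L k = nth (0, 0) L k.
Proof. by rewrite /signed_coord => ->. Qed.

Lemma int_combN u : int_comb (- u.1, - u.2) = - int_comb u.
Proof. by rewrite /int_comb !mulrNz !scaleNr opprD. Qed.

Lemma signed_coord_neg k : (q <= k)%N ->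
  int_comb (signed_coord L k) = - int_comb (nth (0, 0) L (k - q)).
Proof. by rewrite /signed_coord ltnNge => -> /=; rewrite int_combN. Qed.

(** Every listed root is reached from the two end roots by reflections in roots already obtained;
    each call of [rc i j] yields the root numbered [dih_refl q i j]. *)
Lemma table_in_Psi k : (k < q)%N -> int_comb (nth (0, 0) L k) \in Psi.
Proof.
have rc i j : (i < q)%N -> (j < q)%N -> int_comb (nth (0, 0) L i) \in Psi ->
    int_comb (nth (0, 0) L j) \in Psi -> (dih_refl q i j < q)%N ->
    int_comb (nth (0, 0) L (dih_refl q i j)) \in Psi.
  move=> iq jq iP jP lt; rewrite -signed_coord_pos // -table_refl //; last first.
    by rewrite mul2n -addnn ltn_addr.
  by rewrite signed_coord_pos //; apply: Psi_refl.
have H0 : int_comb (nth (0, 0) L 0) \in Psi by rewrite int_comb_first.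
have Hq : int_comb (nth (0, 0) L q.-1) \in Psi by rewrite int_comb_last.
move: table_size H0 Hq rc; rewrite !inE => /or4P[]/eqP->; case: k => [|[|[|[|[|[|//]]]]]] //= H0 Hq rc _.
- exact: (rc 0 2)%N.
- exact: (rc 0 3)%N.
- exact: (rc 3 0)%N.
- exact: (rc 0 5)%N.
- by apply: (rc 0 4)%N => //; apply: (rc 5 0)%N.
- by apply: (rc 5 1)%N => //; apply: (rc 0 5)%N.
- exact: (rc 5 0)%N.
Qed.

Lemma table_pos k : (k < q)%N -> pos (int_comb (nth (0, 0) L k)).
Proof.
move=> kq; apply/(based_pos pair_based); first exact: table_in_Psi.
have /and5P[_ _ _ _ /and5P[_ _ _ /allP/(_ _ (mem_nth (0, 0) kq)) /andP[h1 h2] _]] := tableP.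
move=> p; case: (unliftP ord0 p) => [j|] ->; rewrite ?(ord1 j) ?coordA ?coordB.
  by rewrite (ler_int R 0).
by rewrite (ler_int R 0).
Qed.

(** The table with its opposites is closed under the two base reflections, and every positive root
    of [Psi] is the image of a base root under a product of them. *)
Lemma table_complete x : x \in Psi -> pos x ->
  exists2 k, (k < q)%N & x = int_comb (nth (0, 0) L k).
Proof.
move=> xP px; have q1 := table_gt1.
have step i y : (i < q)%N -> in_table y -> in_table (refl (int_comb (nth (0, 0) L i)) y).
  by move=> iq [k kq ->]; exists (dih_refl q i k); [exact: dih_refl_lt|rewrite table_refl].
have stepA y : in_table y -> in_table (refl A y).
  by move=> h; have := step 0%N y (ltnW q1) h; rewrite int_comb_first.
have qB : (q.-1 < q)%N by rewrite prednK // ltnW.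
have stepB y : in_table y -> in_table (refl B y).
  by move=> h; have := step q.-1 y qB h; rewrite int_comb_last.
have q2 k : (k < q)%N -> (k < 2 * q)%N by move=> h; rewrite mul2n -addnn ltn_addr.
have inA : in_table A.
  by exists 0%N; [exact/q2/ltnW|rewrite signed_coord_pos ?int_comb_first // ltnW].
have inB : in_table B.
  by exists q.-1; [exact/q2|rewrite signed_coord_pos ?int_comb_last].
have inX (p : 'I_2) : X`_p = A \/ X`_p = B.
  by case: p => -[|[|//]] ?; [left|right].
have [w [s ws] [p xw]] := pos_conj_base pair_based xP px.
have : in_table x.
  rewrite xw; have : in_table X`_p by case: (inX p) => ->.
  move: (X`_p) => y hy {xw}; elim: s w ws => [|f s IH] w.
    by case=> _ ->.
  move=> /word_consP[[i _ <-] [w' /IH h ->]] /=.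
  by case: (inX i) => ->; [exact: stepA|exact: stepB].
case=> k k2 ex; have [kq|kq] := ltnP k q.
  by exists k => //; rewrite ex signed_coord_pos.
have kq' : (k - q < q)%N by rewrite ltn_subLR // addnn -mul2n.
by move: px; rewrite ex signed_coord_neg // => /posN; rewrite opprK => /(_ (table_pos kq')).
Qed.

Lemma int_comb_inj : injective int_comb.
Proof.
move=> [x y] [x' y'] /comb_inj[/= /eqP + /eqP]; rewrite !eqr_int.
by move=> /eqP e1 /eqP e2; rewrite e1 e2.
Qed.

End Table.

End Base.
End RankTwo.

(** Here [p k] is meant as the place in the window of the [k]-th root by angle and [nt k] as its
    count before the window. Each coroot other than the two ends is a sum of two others, hence lies
    between them in the chain and has the sum of their counts. Such relations leave only the angular
    order. *)
Lemma order_of_sums (m n : nat) (p nt : nat -> nat) :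
  (m, n) \in rank2_types ->
  let C := rank2_coroots m n in let q := size (rank2_roots m n) in
  (p 0 < p q.-1)%N -> (forall k, (k < q)%N -> (p k < q)%N) ->
  (forall i j k, (i < q)%N -> (j < q)%N -> (k < q)%N ->
     [&& i != j, i != k & j != k] ->
     (nth (0, 0) C i).1 + (nth (0, 0) C j).1 = (nth (0, 0) C k).1 ->
     (nth (0, 0) C i).2 + (nth (0, 0) C j).2 = (nth (0, 0) C k).2 ->
     nt k = (nt i + nt j)%N /\ (p i < p k < p j \/ p j < p k < p i)%N) ->
  (forall k, (k < q)%N -> p k = k) /\
  (forall k, (k < q)%N ->
     (nt k)%:Z = (nth (0, 0) C k).1 * (nt 0%N)%:Z + (nth (0, 0) C k).2 * (nt q.-1)%:Z).
Proof.
rewrite /rank2_types !inE.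
case/or4P => [/eqP[-> ->]|/eqP[-> ->]|/eqP[-> ->]|/or3P[/eqP[-> ->]|/eqP[-> ->]|/eqP[-> ->]]] /= p0 pq S.
- have := pq 0%N isT; have := pq 1%N isT.
  by split=> [[|[|//]]|[|[|//]]] /= _; lia.
- have := pq 0%N isT; have := pq 1%N isT; have := pq 2%N isT.
  have [] := S 0%N 2%N 1%N isT isT isT isT erefl erefl.
  by split=> [[|[|[|//]]]|[|[|[|//]]]] /= _; lia.
- have := pq 0%N isT; have := pq 1%N isT; have := pq 2%N isT; have := pq 3%N isT.
  have [] := S 0%N 3%N 1%N isT isT isT isT erefl erefl.
  have [] := S 1%N 3%N 2%N isT isT isT isT erefl erefl.
  by split=> [[|[|[|[|//]]]]|[|[|[|[|//]]]]] /= _; lia.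
- have := pq 0%N isT; have := pq 1%N isT; have := pq 2%N isT; have := pq 3%N isT.
  have [] := S 0%N 3%N 2%N isT isT isT isT erefl erefl.
  have [] := S 0%N 2%N 1%N isT isT isT isT erefl erefl.
  by split=> [[|[|[|[|//]]]]|[|[|[|[|//]]]]] /= _; lia.
- have := pq 0%N isT; have := pq 1%N isT; have := pq 2%N isT; have := pq 3%N isT.
  have := pq 4%N isT; have := pq 5%N isT.
  have [] := S 0%N 5%N 1%N isT isT isT isT erefl erefl.
  have [] := S 1%N 5%N 3%N isT isT isT isT erefl erefl.
  have [] := S 3%N 5%N 4%N isT isT isT isT erefl erefl.
  have [] := S 1%N 3%N 2%N isT isT isT isT erefl erefl.
  by split=> [[|[|[|[|[|[|//]]]]]]|[|[|[|[|[|[|//]]]]]]] /= _; lia.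
- have := pq 0%N isT; have := pq 1%N isT; have := pq 2%N isT; have := pq 3%N isT.
  have := pq 4%N isT; have := pq 5%N isT.
  have [] := S 0%N 5%N 4%N isT isT isT isT erefl erefl.
  have [] := S 0%N 4%N 2%N isT isT isT isT erefl erefl.
  have [] := S 0%N 2%N 1%N isT isT isT isT erefl erefl.
  have [] := S 2%N 4%N 3%N isT isT isT isT erefl erefl.
  by split=> [[|[|[|[|[|[|//]]]]]]|[|[|[|[|[|[|//]]]]]]] /= _; lia.
Qed.

Lemma nbefore_window (R : realType) (r : nat) (beta : nat -> 'rV[R]_r) (t q : nat) :
  (forall i j, (i < q)%N -> (j < q)%N -> beta (t + i) = beta (t + j) -> i = j) ->
  forall i j, (i <= q)%N -> (j < q)%N ->
  nbefore beta (t + i) (beta (t + j)) = (nbefore beta t (beta (t + j)) + (j < i))%N.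
Proof.
move=> inj i j + jq; elim: i => [|i IH] iq; first by rewrite addn0 ltn0 addn0.
rewrite addnS nbeforeS IH ?(ltnW iq) // -addnA; congr (_ + _)%N.
have -> : (beta (t + i) == beta (t + j)) = (i == j).
  by apply/eqP/eqP => [/inj->|->].
by rewrite ltnS; case: ltngtP.
Qed.

(** * The window *)

Record window_chain (R : realType) (r : nat) (D : root_system R r)
    (Psi : seq 'rV[R]_r) (beta : nat -> 'rV[R]_r) (N t q : nat) : Prop :=
  WindowChain {
  wc_rank2 : rank2_subsystem D Psi;
  wc_pos : forall i, (i < N)%N -> positive D (beta i);
  wc_wall : forall i, (i < N)%N -> exists z,
    pairing (ip D) z (beta i) = - (nbefore beta i (beta i))%:R /\
    forall d, positive D d -> d != beta i ->
      - (nbefore beta i d)%:R < pairing (ip D) z d < 1 - (nbefore beta i d)%:R;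
  wc_size : (2 <= q)%N;
  wc_bound : (t + q <= N)%N;
  wc_inj : forall i j, (i < q)%N -> (j < q)%N ->
    beta (t + i) = beta (t + j) -> i = j;
  wc_roots : forall b, b \in Psi /\ positive D b <->
    exists2 i, (i < q)%N & b = beta (t + i)
}.

Section Window.
Variables (R : realType) (r : nat) (D : root_system R r).
Local Notation V := 'rV[R]_r.
Local Notation refl := (refl (ip D)).
Local Notation pairing := (pairing (ip D)).
Local Notation pos := (positive D).
Let ipP := ip_axiom D.
Variables (Psi : seq V) (beta : nat -> V) (N t q : nat).
Hypothesis win : window_chain D Psi beta N t q.
Let PsiP := wc_rank2 win.
Let beta_pos := wc_pos win.
Let beta_wall := wc_wall win.
Let q2 := wc_size win.
Let tqN := wc_bound win.
Let window_inj := wc_inj win.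
Let windowP := wc_roots win.

Let g i := beta (t + i).

Lemma window_pos i : (i < q)%N -> pos (g i).
Proof. by move=> iq; apply: beta_pos; apply: leq_trans tqN; rewrite ltn_add2l. Qed.

Lemma window_Psi i : (i < q)%N -> g i \in Psi.
Proof. by move=> iq; have [] := (windowP (g i)).2 (ex_intro2 _ _ i iq erefl). Qed.

Lemma window_neq i j : (i < q)%N -> (j < q)%N -> i <> j -> g i <> g j.
Proof. by move=> iq jq ne /(window_inj iq jq). Qed.

Lemma nat_close (a b : nat) (x : R) :
  - a%:R < x < 1 - a%:R -> - b%:R < x < 1 - b%:R -> a = b.
Proof.
move=> /andP[h1 h2] /andP[h3 h4].
have : (a%:R : R) < b.+1%:R by rewrite -natr1; lra.
have : (b%:R : R) < a.+1%:R by rewrite -natr1; lra.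
rewrite !ltr_nat; lia.
Qed.

(** Evaluate the coroot relation at the wall points of the three positions [a], [b] and [c]. Each
    evaluation is an equation between counts, and the three together leave only the orders in which
    [c] is in the middle. *)
Lemma coroot_sum_between a b c : (a < q)%N -> (b < q)%N -> (c < q)%N ->
  (forall u, pairing u (g c) = pairing u (g a) + pairing u (g b)) ->
  a <> b -> a <> c -> b <> c ->
  nbefore beta t (g c) = (nbefore beta t (g a) + nbefore beta t (g b))%N /\
  (a < c < b \/ b < c < a)%N.
Proof.
move=> aq bq cq sum nab nac nbc.
have wall i : (i < q)%N -> exists z : V,
    pairing z (g i) = - (nbefore beta t (g i))%:R /\
    forall j, (j < q)%N -> j <> i ->
    - (nbefore beta t (g j) + (j < i))%:R < pairing z (g j) < 1 - (nbefore beta t (g j) + (j < i))%:R.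
  move=> iq; have [|z [e hz]] := beta_wall (i := t + i).
    by apply: leq_trans tqN; rewrite ltn_add2l.
  exists z; rewrite e (nbefore_window window_inj) ?ltnn ?addn0 ?(ltnW iq) //; split=> // j jq ne.
  rewrite -(nbefore_window window_inj) ?(ltnW iq) //; apply: hz; first exact: window_pos.
  by apply/eqP/window_neq.
have eqa : (nbefore beta t (g c) + (c < a) = nbefore beta t (g a) + (nbefore beta t (g b) + (b < a)))%N.
  have [z [e hz]] := wall a aq.
  apply: (@nat_close _ _ (pairing z (g c))); first by apply: hz => // /esym.
  rewrite sum e natrD; have := hz b bq (fun h => nab (esym h)); lra.
have eqb : (nbefore beta t (g c) + (c < b) = nbefore beta t (g a) + (a < b) + nbefore beta t (g b))%N.
  have [z [e hz]] := wall b bq.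
  apply: (@nat_close _ _ (pairing z (g c))); first by apply: hz => // /esym.
  rewrite sum e [(_ + nbefore _ _ (g b))%:R]natrD; have := hz a aq nab; lra.
(* On the wall of [c] the left side is an integer and the right side a sum of two numbers from open
   unit intervals, which determines it; hence the extra 1. *)
have eqc : ((nbefore beta t (g c)).+1 = nbefore beta t (g a) + (a < c) + (nbefore beta t (g b) + (b < c)))%N.
  have [z [e hz]] := wall c cq.
  have /andP[h1 h2] := hz a aq nac; have /andP[h3 h4] := hz b bq nbc.
  move: e; rewrite sum => e.
  have : ((nbefore beta t (g c))%:R : R) < (nbefore beta t (g a) + (a < c) + (nbefore beta t (g b) + (b < c)))%:R.
    rewrite [ltRHS]natrD; lra.
  have : ((nbefore beta t (g a) + (a < c) + (nbefore beta t (g b) + (b < c)))%:R : R) < (nbefore beta t (g c)).+2%:R.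
    rewrite -!natr1 [ltLHS]natrD; lra.
  rewrite !ltr_nat; lia.
move: eqa eqb eqc nab nac nbc; lia.
Qed.

Definition window_root k : V := if (k < q)%N then g k else - g (k - q).

(** Positive roots have positive height, so the rays of the plane of [Psi] that they span are
    parametrized by the ratio of a coordinate to the height. The roots of least and greatest ratio
    bound the cone. *)
Lemma extreme_pair : exists a b, [/\ (a < b)%N, (b < q)%N &
  forall x, x \in Psi -> pos x -> exists c : R * R,
    [/\ 0 <= c.1, 0 <= c.2 & x = c.1 *: g a + c.2 *: g b]].
Proof.
have q0 : (0 < q)%N := ltnW q2.
pose h (x : V) : R := \sum_p coord (simples D) p x.
have hlin (c1 c2 : R) x y : h (c1 *: x + c2 *: y) = c1 * h x + c2 * h y.
  rewrite /h !mulr_sumr -big_split /=; apply: eq_bigr => p _.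
  by rewrite linearD !linearZ.
have hpos x : pos x -> 0 < h x.
  by move=> px; apply: (height_gt0 (weyl_based D)) => //; apply: pos_root.
have ne01 : g 0 <> g 1%N by apply: window_neq.
have cmb : forall x, x \in Psi -> exists c : R * R, x = c.1 *: g 0%N + c.2 *: g 1%N.
  by apply: (comb_pair PsiP) => //; apply: window_Psi || apply: window_pos.
pose e0 := g 0%N; pose e1 := g 1%N.
pose co (x : V) : R * R := xget (0, 0) [set c : R * R | x = c.1 *: e0 + c.2 *: e1].
have coE x : x \in Psi -> x = (co x).1 *: e0 + (co x).2 *: e1.
  by move=> /cmb [c ec]; rewrite /co; case: xgetP => [c' _ //|/(_ c)/(_ ec)].
pose s x := (co x).1 / h x.
pose I0 : 'I_q := Ordinal q0.
have [ia _ amin] := @Order.TotalTheory.arg_minP _ _ _ I0 xpredT (fun i : 'I_q => s (g i)) isT.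
have [ib _ bmax] := @Order.TotalTheory.arg_maxP _ _ _ I0 xpredT (fun i : 'I_q => s (g i)) isT.
(* The determinant of [x] and [y] in the coordinates given by [co] and the height; its sign compares
   the two ratios. *)
pose om x y : R := (co x).1 * h y - (co y).1 * h x.
have hg (i : 'I_q) : 0 < h (g i) by apply/hpos/window_pos.
have omE (i j : 'I_q) : s (g i) <= s (g j) -> 0 <= om (g j) (g i).
  rewrite /s /om ler_pdivrMr ?hg // mulrAC ler_pdivlMr ?hg //.
  by rewrite subr_ge0.
pose A := g ia; pose B := g ib.
have comp x : x \in Psi -> h x = (co x).1 * h e0 + (co x).2 * h e1.
  by move=> xP; rewrite {1}(coE x xP) hlin.
have wP (i : 'I_q) : g i \in Psi by apply: window_Psi.
(* Cramer's rule in the plane of [Psi], with the determinant [om]. *)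
have key x : x \in Psi -> om B A *: x = om B x *: A + om x A *: B.
  move=> xP.
  transitivity (om B A *: ((co x).1 *: e0 + (co x).2 *: e1)); first by rewrite -coE.
  transitivity (om B x *: ((co A).1 *: e0 + (co A).2 *: e1) +
    om x A *: ((co B).1 *: e0 + (co B).2 *: e1)); last by rewrite -!coE ?wP.
  rewrite !scalerDr !scalerA addrACA -!scalerDl /om (comp x xP) (comp A (wP ia)) (comp B (wP ib)).
  by congr (_ *: _ + _ *: _); ring.
(* If the extreme ratios coincided, all ratios would. But the ratio is 0 at [e1] and nonzero at
   [e0]. *)
have om_pos : 0 < om B A.
  rewrite lt_neqAle eq_sym omE ?amin // andbT; apply/eqP => om0.
  have sAB : s B <= s A.
    rewrite /s ler_pdivrMr ?hg // mulrAC ler_pdivlMr ?hg //.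
    by rewrite -subr_le0 -/(om B A) om0.
  have alls (i : 'I_q) : s (g i) = s A.
    apply/eqP; rewrite eq_le amin // andbT.
    exact: le_trans (bmax i isT) sAB.
  pose I1 : 'I_q := Ordinal q2.
  have s0 : s e0 = s e1 by rewrite (alls I0) (alls I1).
  have c0 : (co e0).1 = 1.
    have e : e0 = 1 *: e0 + 0 *: e1 by rewrite scale1r scale0r addr0.
    have := coE e0 (window_Psi q0); rewrite {1}e => /(comb_inj (window_pos q0) (window_pos q2) ne01)[].
    by move=> <-.
  have c1 : (co e1).1 = 0.
    have e : e1 = 0 *: e0 + 1 *: e1 by rewrite scale1r scale0r add0r.
    have := coE e1 (window_Psi q2); rewrite {1}e => /(comb_inj (window_pos q0) (window_pos q2) ne01)[].
    by move=> <-.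
  move: s0; rewrite /s c0 c1 mul0r mul1r => /eqP; rewrite invr_eq0 => /eqP h0.
  by have := hpos _ (window_pos q0); rewrite h0 ltxx.
have neab : ia != ib.
  by apply: contraTneq om_pos => e; rewrite /om /A /B e subrr ltxx.
have cone x : x \in Psi -> pos x -> exists c : R * R,
    [/\ 0 <= c.1, 0 <= c.2 & x = c.1 *: A + c.2 *: B].
  move=> xP px; have [i iq ei] := (windowP x).1 (conj xP px).
  exists (om B x / om B A, om x A / om B A); split=> /=.
  - by rewrite divr_ge0 ?(ltW om_pos) // ei; apply: (omE (Ordinal iq)); apply: bmax.
  - by rewrite divr_ge0 ?(ltW om_pos) // ei; apply: (omE _ (Ordinal iq)); apply: amin.
  - apply: (scalerI (lt0r_neq0 om_pos)); rewrite key // scalerDr !scalerA.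
    by rewrite ![om B A * _]mulrC !divfK ?lt0r_neq0.
have [lt|lt|/val_inj e] := ltngtP ia ib.
- by exists ia, ib; split=> //.
- exists ib, ia; split=> // x xP px; have [[c1 c2] [h1 h2 h3]] := cone x xP px.
  by exists (c2, c1); split=> //=; rewrite addrC.
- by rewrite e eqxx in neab.
Qed.

(** The tables describe the roots in angular order, and [order_of_sums] shows that the window lists
    them in this order. Its second conclusion makes the counts linear in the coroots, so all
    hyperplanes of the window pass through one point. *)
Lemma window_structure :
  [/\ q \in [:: 2; 3; 4; 6]%N,
    forall i k, (i < q)%N -> (k < 2 * q)%N ->
      refl (g i) (window_root k) = window_root (dih_refl q i k),
    exists z, forall i, (i < q)%N ->
      pairing z (g i) = - (nbefore beta t (g i))%:R,
    based_system (ip D) Psi pos [tuple g 0%N; g q.-1] &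
    forall k, (k < q)%N -> k <> 0%N -> k <> q.-1 ->
      exists x y : R, [/\ 0 < x, 0 < y & g k = x *: g 0%N + y *: g q.-1]].
Proof.
have [a [b [ab bq cone]]] := extreme_pair.
have aq := ltn_trans ab bq.
set A := g a in cone; set B := g b in cone.
have AP : A \in Psi := window_Psi aq.
have BP : B \in Psi := window_Psi bq.
have pA : pos A := window_pos aq.
have pB : pos B := window_pos bq.
have AB : A <> B by apply: window_neq => // e; rewrite e ltnn in ab.
have [m [n [em en mnP]]] := cartan_types PsiP AP BP pA pB AB cone.
pose L := rank2_roots m n; pose C := rank2_coroots m n.
pose rv k := int_comb A B (nth (0, 0) L k).
have rvP k : (k < size L)%N -> rv k \in Psi /\ pos (rv k).
  move=> kL; split; first exact: (table_in_Psi PsiP AP BP pA pB AB em en mnP kL).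
  exact: (table_pos PsiP AP BP pA pB AB cone em en mnP kL).
have rvC x : x \in Psi -> pos x -> exists2 k, (k < size L)%N & x = rv k.
  exact: (table_complete PsiP AP BP pA pB AB cone em en mnP).
have Luniq : uniq L by have /and5P[_ _ ] := allP rank2_table_ok _ mnP.
have rv_inj i j : (i < size L)%N -> (j < size L)%N -> rv i = rv j -> i = j.
  move=> iL jL /(int_comb_inj pA pB AB)/eqP; rewrite nth_uniq //; exact: eqP.
have uw : uniq (mkseq g q).
  by rewrite map_inj_in_uniq ?iota_uniq // => i j; rewrite !mem_iota /= => iq jq; apply: window_inj.
have ul : uniq (mkseq rv (size L)).
  by rewrite map_inj_in_uniq ?iota_uniq // => i j; rewrite !mem_iota /= => iq jq; apply: rv_inj.
have sizeL : size L = q.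
  have : perm_eq (mkseq rv (size L)) (mkseq g q).
    apply: uniq_perm => // x; apply/mapP/mapP => -[i]; rewrite mem_iota /= => iq ->.
      have [h1 h2] := rvP i iq.
      by have [j jq ->] := (windowP _).1 (conj h1 h2); exists j; rewrite ?mem_iota.
    have [j jL ->] := rvC _ (window_Psi iq) (window_pos iq).
    by exists j; rewrite ?mem_iota.
  by move/perm_size; rewrite !size_mkseq.
have q0 : (0 < q)%N := ltnW q2.
have qq : (q.-1 < q)%N by rewrite prednK.
pose p k := index (rv k) (mkseq g q).
have pP k : (k < q)%N -> (p k < q)%N /\ g (p k) = rv k.
  rewrite -{1}sizeL => /rvP[h1 h2].
  have : rv k \in mkseq g q.
    by have [j jq ->] := (windowP _).1 (conj h1 h2); apply/mapP; exists j; rewrite ?mem_iota.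
  move=> h; split; first by move: h; rewrite -index_mem size_mkseq.
  have := nth_index 0 h; rewrite nth_mkseq //.
  by move: h; rewrite -index_mem size_mkseq.
have rv0 : rv 0%N = A := int_comb_first A B mnP.
have rvq : rv q.-1 = B by rewrite /rv -sizeL; apply: int_comb_last.
have p0 : p 0%N = a.
  have [h1 h2] := pP 0%N q0; apply: window_inj => //.
  by rewrite -/(g (p 0%N)) h2 rv0.
have pq : p q.-1 = b.
  have [h1 h2] := pP q.-1 qq; apply: window_inj => //.
  by rewrite -/(g (p q.-1)) h2 rvq.
have coroot i u : (i < q)%N -> pairing u (rv i) =
    (nth (0, 0) C i).1%:~R * pairing u A + (nth (0, 0) C i).2%:~R * pairing u B.
  by rewrite -{1}sizeL => iq; apply: (table_coroot pA pB AB em en mnP).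
pose nt k := nbefore beta t (g (p k)).
have p_inj i j : (i < q)%N -> (j < q)%N -> p i = p j -> i = j.
  move=> iq jq e; apply: rv_inj; rewrite ?sizeL //.
  by rewrite -(pP i iq).2 -(pP j jq).2 e.
have [pk ntk] : (forall k, (k < q)%N -> p k = k) /\
  (forall k, (k < q)%N ->
     (nt k)%:Z = (nth (0, 0) C k).1 * (nt 0%N)%:Z + (nth (0, 0) C k).2 * (nt q.-1)%:Z).
  rewrite -sizeL; apply: order_of_sums; rewrite // -/L ?sizeL.
  - by rewrite p0 pq.
  - by move=> k /pP[].
  move=> i j k iq jq kq /and3P[/eqP ij /eqP ik /eqP jk] e1 e2.
  have [i1 i2] := pP i iq; have [j1 j2] := pP j jq; have [k1 k2] := pP k kq.
  apply: coroot_sum_between => //.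
  - move=> u; rewrite i2 j2 k2 !coroot // -e1 -e2 !intrD; ring.
  - by move/(p_inj _ _ iq jq).
  - by move/(p_inj _ _ iq kq).
  - by move/(p_inj _ _ jq kq).
have gE k : (k < q)%N -> g k = rv k by move=> kq; rewrite -(pP k kq).2 pk.
have g0 : g 0%N = A by rewrite gE.
have gq : g q.-1 = B by rewrite gE.
have wr k : (k < 2 * q)%N -> window_root k = int_comb A B (signed_coord L k).
  move=> kq; rewrite /window_root; case: ltnP => h.
    by rewrite gE // signed_coord_pos // sizeL.
  rewrite (signed_coord_neg A B) sizeL // gE //.
  by rewrite ltn_subLR // addnn -mul2n.
split.
- by rewrite -sizeL; apply: table_size.
- move=> i k iq kq; rewrite !wr ?ltn_mod ?muln_gt0 // gE //.
  by rewrite /rv -[in RHS]sizeL; apply: table_refl => //; rewrite -/L sizeL.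
- have mn4 : (m * n < 4)%N.
    by move: mnP; rewrite /rank2_types !inE;
       case/or4P => [/eqP[-> ->]|/eqP[-> ->]|/eqP[-> ->]|/or3P[/eqP[-> ->]|/eqP[-> ->]|/eqP[-> ->]]].
  have d0 : (4 - m%:R * n%:R : R) != 0.
    by rewrite subr_eq0 -natrM eqr_nat gtn_eqF.
  pose dA : R := (nt 0%N)%:R; pose dB : R := (nt q.-1)%:R.
  (* The solution in the span of [A] and [B] of the two equations for the base hyperplanes;
     [4 - m * n] is the determinant of the Cartan matrix. *)
  pose z := ((- 2 * dA - m%:R * dB) / (4 - m%:R * n%:R)) *: A +
            ((- 2 * dB - n%:R * dA) / (4 - m%:R * n%:R)) *: B.
  have zA : pairing z A = - dA.
    rewrite /z (pairingD ipP) !(pairingZ ipP) em (pairing_self ipP (pos_nz pA)).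
    by field.
  have zB : pairing z B = - dB.
    rewrite /z (pairingD ipP) !(pairingZ ipP) en (pairing_self ipP (pos_nz pB)).
    by field.
  exists z => i iq; rewrite gE // coroot // zA zB -gE //.
  have e : (nt i)%:R = (nth (0, 0) C i).1%:~R * dA + (nth (0, 0) C i).2%:~R * dB :> R.
    by have := congr1 (fun k : int => k%:~R : R) (ntk i iq); rewrite /= intrD !intrM.
  by rewrite -[in nbefore _ _ _](pk i iq) -/(nt i) e !mulrN opprD.
- rewrite g0 gq; exact: (pair_based PsiP AP BP pA pB AB cone).
- move=> k kq k0 kq1; rewrite gE // g0 gq.
  have /and5P[_ _ _ _ /and5P[_ _ _ _ /allP/(_ k)]] := allP rank2_table_ok _ mnP.
  rewrite mem_iota -/L sizeL => /(_ kq) /or3P[/eqP//|/eqP//|/andP[x0 y0]].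
  by exists (nth (0, 0) L k).1%:~R, (nth (0, 0) L k).2%:~R; split=> //; rewrite (ltr_int R 0).
Qed.

End Window.

(** * Finite model of the dihedral group and its check *)

(* [rmul q d i] and [lmul q j d] compose the permutation [d] of the [2 q]
   roots with a reflection on the right and on the left. *)
Definition rmul q (d : seq nat) i : seq nat :=
  [seq nth 0%N d (dih_refl q i k) | k <- iota 0 (2 * q)].
Definition lmul q j (d : seq nat) : seq nat := [seq dih_refl q j x | x <- d].
(** Indices from [q] on stand for negative roots, so this is the inversion number, that is, the
    length in the dihedral group. *)
Definition minv q (d : seq nat) : nat := count (leq q) (take q d).

(** Each round multiplies by the two generators on the right; [q] rounds suffice because the longest
    element has length [q]. *)
Fixpoint dihedral_closure q n (ds : seq (seq nat)) : seq (seq nat) :=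
  if n is n'.+1 then
    dihedral_closure q n' (undup (ds ++ [seq rmul q d 0 | d <- ds] ++
                                  [seq rmul q d q.-1 | d <- ds]))
  else ds.
Definition dihedral q := dihedral_closure q q [:: iota 0 (2 * q)].

Fixpoint subseqs (s : seq nat) : seq (seq nat) :=
  if s is x :: s' then [seq x :: z | z <- subseqs s'] ++ subseqs s' else [:: [::]].

Lemma mem_subseqs (P : pred nat) s : [seq x <- s | P x] \in subseqs s.
Proof.
elim: s => //= x s IH; rewrite mem_cat; case: ifP => _; last by rewrite IH orbT.
by rewrite map_f.
Qed.

(* The product after [i] steps of the chain of reflections [os], folding at
   the (1-based) positions in [S]. *)
Fixpoint dwalk q (os S d : seq nat) i : seq nat :=
  if i is i'.+1 then
    let d' := dwalk q os S d i' in
    if i \in S then rmul q d' (nth 0%N os i') else d'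
  else d.

(** The trace of admissibility in the dihedral group. *)
Definition saturated q (S d : seq nat) : bool :=
  all (fun i => (i.+1 \in S) ==>
    (minv q (dwalk q (iota 0 q) S d i.+1) ==
     (minv q (dwalk q (iota 0 q) S d i)).+1)) (iota 0 q).

(** The part of I(J, p) in the window, 0-based, when [j] is the number of the simple root; reduction
    modulo [q] identifies opposite roots. *)
Definition whits q (os S d : seq nat) j : seq nat :=
  [seq i <- iota 0 q | nth 0%N (dwalk q os S d i) (nth 0%N os i) %% q == j]%N.

Definition eq_upto q (P Q : pred nat) : bool := all (fun i => P i.+1 == Q i.+1) (iota 0 q).

(** The rows [d] and [y] are the elements at the entry and the exit of the window, and [upx], [upy]
    are the signs there. If the sign goes from plus to minus, the operator deletes the earliest hit
    and the entry element is multiplied by the simple reflection. If it stays plus, the operator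
    adds the last hit and the exit element is multiplied. In both cases the list transported by
    [yb_invol] must be the one obtained from [T] and the hits of the reversed window. *)
Definition window_check q (d S : seq nat) : bool :=
  let os := iota 0 q in let ros := rev os in
  let y := dwalk q os S d q in
  let a := minv q d in let b := minv q y in
  let T := yb_invol q a b S in
  (dwalk q ros T d q == y) && all (fun j =>
    let I := whits q os S d j in let I' := whits q ros T d j in
    let upx := (index j d < q)%N in let upy := (index j y < q)%N in
    upx ==>
    [&& I != [::], I' != [::],
       ~~ upy ==>
         eq_upto q [in yb_invol q (minv q (lmul q j d)) b
                         [seq i <- iota 1 q | (i \in S) && (i != (head 0%N I).+1)]]
         [pred i | (i \in T) && (i != (head 0%N I').+1)]
     & upy ==>
         eq_upto q [in yb_invol q a (minv q (lmul q j y))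
                         [seq i <- iota 1 q | (i \in S) || (i == (last 0%N I).+1)]]
         [pred i | (i \in T) || (i == (last 0%N I').+1)]]) [:: 0; q.-1]%N.

(** The last clause: a reflection increasing the length either raises it by one or is a product of
    three length-increasing steps. It is what carries covers of [W] over to the dihedral group. *)
Definition dihedral_check q (d : seq nat) : bool :=
  let stays d i := (nth 0%N d i < q)%N in
  [&& size d == (2 * q)%N, uniq d, all (fun x => x < 2 * q)%N d,
    all (fun i => rmul q d i \in dihedral q) (iota 0 q) &
    all (fun i => stays d i ==>
      (minv q (rmul q d i) == (minv q d).+1) ||
      has (fun i1 => stays d i1 && let d1 := rmul q d i1 in
        has (fun i2 => stays d1 i2 && let d2 := rmul q d1 i2 in
          has (fun i3 => stays d2 i3 && (rmul q d2 i3 == rmul q d i))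
            (iota 0 q)) (iota 0 q)) (iota 0 q)) (iota 0 q)].

Lemma dihedral_ok : all (fun q =>
  (iota 0 (2 * q) \in dihedral q) && all (dihedral_check q) (dihedral q))
  [:: 2; 3; 4; 6]%N.
Proof. by vm_compute. Qed.

Lemma window_ok : all (fun q => all (fun d => all (fun S =>
  saturated q S d ==> window_check q d S) (subseqs (iota 1 q))) (dihedral q))
  [:: 2; 3; 4; 6]%N.
Proof. by vm_compute. Qed.

(** * Elements of the Weyl group as permutations of the window roots *)

Section WindowModel.
Variables (R : realType) (r : nat) (D : root_system R r).
Local Notation V := 'rV[R]_r.
Local Notation refl := (refl (ip D)).
Local Notation pairing := (pairing (ip D)).
Local Notation pos := (positive D).
Local Notation W := (generated (simple_refls D)).
Local Notation len := (word_length (simple_refls D)).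
Let ipP := ip_axiom D.
Variables (Psi : seq V) (beta : nat -> V) (N t q : nat).
Hypothesis win : window_chain D Psi beta N t q.
Let PsiP := wc_rank2 win.
Let beta_pos := wc_pos win.
Let q2 := wc_size win.
Let tqN := wc_bound win.
Let window_inj := wc_inj win.
Let windowP := wc_roots win.

Local Notation g i := (beta (t + i)).
Local Notation wr := (window_root beta t q).
Let PsiPhi : {subset Psi <= Defs.roots D}. Proof. by case: PsiP. Qed.
Let WS := window_structure win.

Lemma q_small : q \in [:: 2; 3; 4; 6]%N. Proof. by case: WS. Qed.
Lemma q_gt0 : (0 < q)%N. Proof. exact: ltnW q2. Qed.
Lemma q_pred : (q.-1 < q)%N. Proof. by rewrite prednK ?q_gt0. Qed.

Lemma win_pos i : (i < q)%N -> pos (g i).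
Proof. exact: (window_pos win). Qed.
Lemma win_Psi i : (i < q)%N -> g i \in Psi.
Proof. exact: (window_Psi win). Qed.
Lemma win_root i : (i < q)%N -> g i \in Defs.roots D.
Proof. by move=> /win_pos/pos_root. Qed.

Lemma win_refl i k : (i < q)%N -> (k < 2 * q)%N -> refl (g i) (wr k) = wr (dih_refl q i k).
Proof. by case: WS => _ h _ _ _; apply: h. Qed.

Definition window_base : 2.-tuple V := [tuple g 0; g q.-1].
Lemma win_based : based_system (ip D) Psi pos window_base. Proof. by case: WS. Qed.

Local Notation Wbar := (generated (base_refls (ip D) window_base)).

Lemma Wbar_refl i : (i < q)%N -> Wbar (refl (g i)).
Proof. by move=> iq; apply: (generated_refl win_based); apply: win_Psi. Qed.

Lemma Wbar_weyl x : Wbar x -> W x.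
Proof.
case=> s; elim: s x => [|f s IH] x; first by case=> _ ->; apply: generated_id.
move=> /word_consP[[p _ <-] [x' /IH h ->]]; apply: generated_comp => //.
apply/weyl_refl; case: p => -[|[|//]] ?; [exact: win_root q_gt0|exact: win_root q_pred].
Qed.

Lemma Wbar_Psi x i : Wbar x -> (i < q)%N -> x (g i) \in Psi.
Proof. by move=> /(generated_isom win_based)[_ h] iq; apply: h; apply: win_Psi. Qed.

Lemma window_root_lt k : (k < q)%N -> wr k = g k. Proof. by rewrite /window_root => ->. Qed.
Lemma window_root_add k : (k < q)%N -> wr (q + k) = - g k.
Proof. by move=> kq; rewrite /window_root ltnNge leq_addr /= addKn. Qed.

Lemma window_rootP k : (k < 2 * q)%N -> exists2 i, (i < q)%N &
  (k = i /\ wr k = g i) \/ (k = (q + i)%N /\ wr k = - g i).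
Proof.
move=> k2; have [kq|kq] := ltnP k q; first by exists k => //; left; rewrite window_root_lt.
have h : (k - q < q)%N by rewrite ltn_subLR // addnn -mul2n.
exists (k - q)%N => //; right; split; first by rewrite subnKC.
by rewrite -{1}(subnKC kq) window_root_add.
Qed.

(** The property by which a minimal length representative of a coset of [Wbar] is used: it preserves
    the sign of every root of [Psi]. *)
Definition window_positive (v : V -> V) := W v /\ forall i, (i < q)%N -> pos (v (g i)).

Lemma window_positiveN v i : window_positive v -> (i < q)%N -> ~ pos (- v (g i)).
Proof. by move=> [_ h] iq; apply/posN/h. Qed.

Lemma pos_window_root v k : window_positive v -> (k < 2 * q)%N -> pos (v (wr k)) <-> (k < q)%N.
Proof.
move=> hv /window_rootP[i iq [[-> ->]|[-> ->]]].
  by split=> // _; apply: hv.2.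
rewrite (isomN (weyl_isom hv.1)); split; first by move/(window_positiveN hv iq).
by rewrite ltnNge leq_addr.
Qed.

(* [v^-1 w] permutes the roots of [Psi], and [d] is this permutation in the
   numbering [window_root]. *)
Definition models (v w : V -> V) (d : seq nat) :=
  d \in dihedral q /\ forall k, (k < 2 * q)%N -> w (wr k) = v (wr (nth 0%N d k)).

Lemma dihedralP d : d \in dihedral q ->
  [/\ size d = (2 * q)%N, uniq d, forall k, (k < 2 * q)%N -> (nth 0%N d k < 2 * q)%N,
    forall i, (i < q)%N -> rmul q d i \in dihedral q & dihedral_check q d].
Proof.
move=> dd; have /andP[_ /allP/(_ d dd) chk] := allP dihedral_ok _ q_small.
have /and5P[/eqP sd ud /allP hd /allP hr _] := chk; split=> //.
- by move=> k k2; apply/hd/mem_nth; rewrite sd.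
- by move=> i iq; apply: hr; rewrite mem_iota.
Qed.

Lemma models_id v : models v v (iota 0 (2 * q)).
Proof.
split; first by have /andP[] := allP dihedral_ok _ q_small.
by move=> k k2; rewrite nth_iota.
Qed.

Lemma dih_refl_bound i k : (dih_refl q i k < 2 * q)%N.
Proof. by rewrite ltn_mod muln_gt0 q_gt0. Qed.

Lemma models_refl v w d i : models v w d -> (i < q)%N ->
  models v (w \o refl (g i)) (rmul q d i).
Proof.
move=> [dd h] iq; have [_ _ _ hr _] := dihedralP dd.
split; first exact: hr.
move=> k k2 /=; rewrite win_refl // h ?dih_refl_bound // (nth_map 0%N) ?size_iota //.
by rewrite nth_iota.
Qed.

Lemma models_Wbar v w d x : models v w d -> Wbar x -> exists d', models v (w \o x) d'.
Proof.
move=> + [s]; elim: s w d x => [|f s IH] w d x md; first by case=> _ ->; exists d.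
move=> /word_consP[[p _ <-] [x' Wx' ->]].
have [i iq ei] : exists2 i, (i < q)%N & window_base`_p = g i.
  case: p => -[|[|//]] ?; [by exists 0%N => //; exact: q_gt0|by exists q.-1 => //; exact: q_pred].
rewrite ei; have := IH _ _ x' (models_refl md iq) Wx'.
by [].
Qed.

Definition window_ninv (w : V -> V) := count (fun i => ~~ `[< pos (w (g i)) >]) (iota 0 q).

Lemma models_ninv v w d : window_positive v -> models v w d ->
  window_ninv w = minv q d.
Proof.
move=> hv [dd h]; have [sd _ hd _ _] := dihedralP dd.
have q2q : (q <= 2 * q)%N by rewrite leq_pmull.
have tE : take q d = [seq nth 0%N d i | i <- iota 0 q] by rewrite map_nth_iota0 // sd.
rewrite /window_ninv /minv tE count_map; apply: eq_in_count => i.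
rewrite mem_iota /= => iq; have i2 : (i < 2 * q)%N := leq_trans iq q2q.
rewrite -window_root_lt // h // leqNgt; congr (~~ _).
by apply/asboolP/idP => /(pos_window_root hv (hd i i2)).
Qed.

Lemma models_pos v w d i : window_positive v -> models v w d -> (i < q)%N ->
  pos (w (g i)) <-> (nth 0%N d i < q)%N.
Proof.
move=> hv [dd h] iq; have [sd _ hd _ _] := dihedralP dd.
have i2 : (i < 2 * q)%N by apply: leq_trans iq _; rewrite leq_pmull.
by rewrite -window_root_lt // h //; apply: pos_window_root => //; apply: hd.
Qed.

(** An element of [Wbar] is determined by its action on the roots: the quotient of [x] and [x']
    keeps all positive roots of [Psi] positive, hence is the identity. *)
Lemma models_eq v w x x' d : W w -> models v (w \o x) d -> models v (w \o x') d ->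
  Wbar x -> Wbar x' -> x = x'.
Proof.
move=> gw [_ h1] [_ h2] gx gx'.
have [y [gy e1 e2]] := generated_inv win_based gx.
have xg i : (i < q)%N -> x (g i) = x' (g i).
  move=> iq; have i2 : (i < 2 * q)%N by apply: leq_trans iq _; rewrite leq_pmull.
  by apply: (isom_inj ipP (weyl_isom gw)); have := h1 i i2; rewrite -h2 // window_root_lt.
have : y \o x' = id.
  apply: (ninv0_id win_based (bs := [seq g i | i <- iota 0 q])).
  - rewrite map_inj_in_uniq ?iota_uniq // => i j; rewrite !mem_iota /= => iq jq.
    exact: window_inj.
  - move=> b; rewrite windowP; split.
      by move=> /mapP[i]; rewrite mem_iota /= => iq ->; exists i.
    by move=> [i iq ->]; apply/mapP; exists i => //; rewrite mem_iota.
  - exact: generated_comp.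
  - move=> b /mapP[i]; rewrite mem_iota /= => iq ->.
    rewrite -xg //; have /= -> := congr1 (fun h => h (g i)) e2; exact: win_pos.
move=> e3; apply/funext => z.
have /= h3 := congr1 (fun h => h z) e3.
by have /= := congr1 (fun h => h (x' z)) e1; rewrite h3.
Qed.

(** Otherwise [dihedral_check] writes the reflection as three reflections, each increasing the
    length in [W] as well, and the length would rise by at least 3 instead of 1. *)
Lemma models_cover v w d i : window_positive v -> models v w d -> (i < q)%N ->
  W w -> len (w \o refl (g i)) = (len w).+1 ->
  minv q (rmul q d i) = (minv q d).+1.
Proof.
move=> hv md iq gw cov; have [_ _ _ _ /and5P[_ _ _ _ /allP/(_ i)]] := dihedralP md.1.
rewrite mem_iota => /(_ iq) /implyP chk.
have {chk} := chk ((models_pos hv md iq).1 (cover_pos gw (win_pos iq) cov)).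
case/orP => [/eqP//|].
case/hasP => i1; rewrite mem_iota /= => i1q /andP[s1 /hasP[i2]].
rewrite mem_iota /= => i2q /andP[s2 /hasP[i3]].
rewrite mem_iota /= => i3q /andP[s3 /eqP e].
have m1 := models_refl md i1q; have m2 := models_refl m1 i2q.
have m3 := models_refl m2 i3q; rewrite e in m3.
have gc w0 j : W w0 -> (j < q)%N -> W (w0 \o refl (g j)).
  by move=> h jq; apply: generated_comp => //; apply/weyl_refl/win_root.
have g1 := gc _ _ gw i1q; have g2 := gc _ _ g1 i2q.
have l1 := len_gt gw (win_pos i1q) ((models_pos hv md i1q).2 s1).
have l2 := len_gt g1 (win_pos i2q) ((models_pos hv m1 i2q).2 s2).
have l3 := len_gt g2 (win_pos i3q) ((models_pos hv m2 i3q).2 s3).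
have ex : refl (g i1) \o refl (g i2) \o refl (g i3) = refl (g i).
  apply: (models_eq gw m3 (models_refl md iq)); last exact: Wbar_refl.
  exact: (generated_comp (generated_comp (Wbar_refl i1q) (Wbar_refl i2q)) (Wbar_refl i3q)).
have e4 : len (((w \o refl (g i1)) \o refl (g i2)) \o refl (g i3)) = (len w).+1.
  by rewrite -cov -ex.
by move: l1 l2 l3; rewrite e4; lia.
Qed.
(** The counterpart of [models_ninv] for rows not known to belong to [dihedral q], such as those
    given by [lmul]. *)
Lemma rows_ninv v w d : window_positive v -> size d = (2 * q)%N ->
  (forall k, (k < q)%N -> (nth 0%N d k < 2 * q)%N) ->
  (forall k, (k < q)%N -> w (g k) = v (wr (nth 0%N d k))) ->
  window_ninv w = minv q d.
Proof.
move=> hv sd hd h.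
have tE : take q d = [seq nth 0%N d i | i <- iota 0 q].
  by rewrite map_nth_iota0 // sd leq_pmull.
rewrite /window_ninv /minv tE count_map; apply: eq_in_count => i.
rewrite mem_iota /= => iq; rewrite h // leqNgt; congr (~~ _).
by apply/asboolP/idP => /(pos_window_root hv (hd i iq)).
Qed.

(** An inner root of the window is a positive combination of the two ends, and [v] keeps both ends
    positive. A simple root is not such a combination of two different positive roots. *)
Lemma models_simple v w d k p : window_positive v -> models v w d -> (k < 2 * q)%N ->
  w (wr k) = simple D p \/ w (wr k) = - simple D p ->
  exists2 j, j \in [:: 0; q.-1]%N & simple D p = v (g j).
Proof.
move=> hv [dd h] k2 hk; have [sd _ hd _ _] := dihedralP dd.
have [j jq ej] : exists2 j, (j < q)%N & simple D p = v (g j).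
  have [j jq hj] := window_rootP (hd k k2); exists j => //.
  have iv := weyl_isom hv.1.
  move: hk; rewrite h //; case: hj => -[_ ->]; rewrite ?(isomN iv) => -[] //.
  - by move=> e; case: (posN (simple_pos D p)); rewrite -e; apply: hv.2.
  - by move=> e; case: (window_positiveN hv jq); rewrite e; apply: simple_pos.
  - by move/oppr_inj.
exists j => //; rewrite !inE; apply: contraT; rewrite negb_or => /andP[/eqP j0 /eqP jq1].
have [_ _ _ _ hs] := WS; have [x [y [x0 y0 e]]] := hs j jq j0 jq1.
have iv := weyl_isom hv.1.
move: ej; rewrite e (isomD iv) !(isomZ iv).
set a := v (g 0); set b := v (g q.-1) => ej.
have pa : pos a := hv.2 _ q_gt0; have pb : pos b := hv.2 _ q_pred.
have co c l : pos c -> 0 <= coord (simples D) l c.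
  by move=> pc; apply: (based_pos (weyl_based D) (pos_root pc)).1.
have cz l : l != p -> x * coord (simples D) l a + y * coord (simples D) l b = 0.
  move=> lp; have := congr1 (coord (simples D) l) ej.
  rewrite linearD !linearZ /= -simplesE (coord_base (weyl_based D)) (negbTE lp).
  by move=> <-.
have mult c : pos c -> (forall l, l != p -> coord (simples D) l c = 0) -> c = simple D p.
  move=> pc hc; apply: (pos_colinear (c := coord (simples D) p c) (simple_pos D p) pc).
  rewrite {1}(coord_span (simples_span (pos_root pc))) (bigD1 p) //= big1 ?addr0 ?simplesE //.
  by move=> l lp; rewrite hc // scale0r.
have ea : a = simple D p.
  apply: mult => // l lp; have := cz l lp; have := co a l pa; have := co b l pb.
  move=> h1 h2 /eqP; rewrite paddr_eq0 ?mulr_ge0 ?(ltW x0) ?(ltW y0) //.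
  by rewrite mulf_eq0 (gt_eqF x0) => /andP[/eqP].
have eb : b = simple D p.
  apply: mult => // l lp; have := cz l lp; have := co a l pa; have := co b l pb.
  move=> h1 h2 /eqP; rewrite paddr_eq0 ?mulr_ge0 ?(ltW x0) ?(ltW y0) //.
  by rewrite [y * _ == 0]mulf_eq0 (gt_eqF y0) => /andP[_ /eqP].
have : 0%N = q.-1.
  by apply: (window_inj q_gt0 q_pred); apply: (isom_inj ipP iv); rewrite -/a -/b ea eb.
by move: q2; case: (q) => [|[]].
Qed.

(** Since [v] sends [g j] to the simple root, the simple reflection on the left of [v] becomes the
    reflection in [g j] on its right. *)
Lemma models_lmul v w d j p : window_positive v -> models v w d -> (j < q)%N ->
  simple D p = v (g j) ->
  window_ninv (refl (simple D p) \o w) = minv q (lmul q j d).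
Proof.
move=> hv [dd h] jq e; have [sd _ hd _ _] := dihedralP dd.
have q2q k : (k < q)%N -> (k < 2 * q)%N by move=> kq; apply: leq_trans kq _; rewrite leq_pmull.
apply: (rows_ninv hv).
- by rewrite size_map.
- by move=> k kq; have k2 := q2q k kq; rewrite /lmul (nth_map 0%N) ?sd // dih_refl_bound.
- move=> k kq; have k2 := q2q k kq; rewrite /lmul (nth_map 0%N) ?sd // -win_refl //; last exact: hd.
  by rewrite (isom_refl_conj ipP (weyl_isom hv.1)) -e -h // window_root_lt.
Qed.

Lemma models_mem v w d j : models v w d -> (j < 2 * q)%N ->
  (index j d < 2 * q)%N /\ w (wr (index j d)) = v (wr j).
Proof.
move=> [dd h] j2; have [sd ud hd _ /and5P[_ _ /allP al _ _]] := dihedralP dd.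
have jd : j \in d.
  have sub : {subset d <= iota 0 (2 * q)} by move=> x /al; rewrite mem_iota.
  have [_ ->] := uniq_min_size ud sub (eq_leq (etrans (size_iota _ _) (esym sd))).
  by rewrite mem_iota.
have i2 : (index j d < 2 * q)%N by rewrite -sd index_mem.
by rewrite h // nth_index.
Qed.

Section Walk.
Variables (gam : nat -> V) (J : pred nat) (os S d : seq nat) (v : V -> V).
Hypothesis gam_pos : forall i, (i < N)%N -> pos (gam i).
Hypothesis os_lt : forall i, (i < q)%N -> (nth 0%N os i < q)%N.
Hypothesis gamE : forall i, (i < q)%N -> gam (t + i) = g (nth 0%N os i).
Hypothesis JS : forall i, (i < q)%N -> J (t + i) = (i.+1 \in S).
Hypothesis vP : window_positive v.
Hypothesis dP : models v (gprod D gam J t) d.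

(** Stated for any chain [gam] whose window runs through the roots in the order [os], so that it
    applies to the given chain and to its reversal. *)
Lemma walk_models i : (i <= q)%N -> models v (gprod D gam J (t + i)) (dwalk q os S d i).
Proof.
elim: i => [|i IH] iq; first by rewrite addn0.
rewrite addnS /= JS //; case: ifP => _; last exact/IH/ltnW.
by rewrite gamE //; apply: models_refl; [exact/IH/ltnW|exact: os_lt].
Qed.

Lemma walk_coset i : (i <= q)%N ->
  exists2 x, Wbar x & gprod D gam J (t + i) = gprod D gam J t \o x.
Proof.
elim: i => [|i IH] iq; first by exists id; [exact: generated_id|rewrite addn0].
have [x gx e] := IH (ltnW iq); rewrite addnS /=; case: ifP => _; last by exists x.
exists (x \o refl (g (nth 0%N os i))); last by rewrite e gamE.
by apply: generated_comp => //; apply/Wbar_refl/os_lt.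
Qed.

Variable p : 'I_r.
Variable j : nat.
Hypothesis jq : (j < q)%N.
Hypothesis pE : simple D p = v (g j).

Lemma walk_hits i : (i < q)%N -> hits D gam J (simple D p) (t + i) =
  (nth 0%N (dwalk q os S d i) (nth 0%N os i) %% q == j)%N.
Proof.
move=> iq; have [dd h] := walk_models (ltnW iq); have [_ _ hd _ _] := dihedralP dd.
have iv := weyl_isom vP.1; have vinj := isom_inj ipP iv.
have o2 : (nth 0%N os i < 2 * q)%N by apply: leq_trans (os_lt iq) _; rewrite leq_pmull.
rewrite /hits gamE // -window_root_lt ?os_lt // h // pE -(isomN iv) !(inj_eq vinj).
have [k kq [[-> ->]|[-> ->]]] := window_rootP (hd _ o2).
  rewrite modn_small // orbC; case: eqP => [e|_] /=.
    by have := posN (win_pos jq); rewrite -e => /(_ (win_pos kq)).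
  by apply/eqP/eqP => [/window_inj->|->].
rewrite modnDl modn_small // eqr_opp; case: eqP => [e|_] /=.
  by have := posN (win_pos kq); rewrite e => /(_ (win_pos jq)).
by apply/eqP/eqP => [/window_inj->|->].
Qed.

Lemma walk_up i : (i <= q)%N ->
  up D gam J p (t + i) = (index j (dwalk q os S d i) < q)%N /\
  absdir D gam J p (t + i) \in [seq g k | k <- iota 0 q].
Proof.
move=> iq.
have j2 : (j < 2 * q)%N by apply: leq_trans jq _; rewrite leq_pmull.
have [i2 e] := models_mem (walk_models iq) j2.
have tiN : (t + i <= N)%N by apply: leq_trans tqN; rewrite leq_add2l.
have de : dir D gam J p (t + i) = wr (index j (dwalk q os S d i)).
  by apply: (dir_uniq gam_pos tiN); rewrite e window_root_lt.
have ue : up D gam J p (t + i) = (index j (dwalk q os S d i) < q)%N.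
  rewrite /up de; have [k kq [[-> ->]|[-> ->]]] := window_rootP i2.
    by rewrite kq; apply/asboolP/win_pos.
  by rewrite ltnNge leq_addr; apply/asboolPn/posN/win_pos.
split=> //; rewrite /absdir ue de.
have [k kq [[-> ->]|[-> ->]]] := window_rootP i2; rewrite ?kq ?ltnNge ?leq_addr /= ?opprK.
  by rewrite map_f // mem_iota.
by rewrite map_f // mem_iota.
Qed.

Variable z : V.
Hypothesis zP : forall i, (i < q)%N -> pairing z (g i) = - (nbefore beta t (g i))%:R.
Hypothesis gam_before : forall i, (i < q)%N ->
  nbefore gam (t + i) (gam (t + i)) = nbefore beta t (gam (t + i)).

(** All affine reflections of the window fix [z], so inside the window the affine product is the
    linear product centred at [z]. This holds for any order of the window. *)
Lemma walk_aprod i x : (i <= q)%N -> aprod D gam J (t + i) x =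
  gprod D gam J (t + i) (x - z) + aprod D gam J t z.
Proof.
have tN : (t <= N)%N by apply: leq_trans tqN; rewrite leq_addr.
elim: i x => [|i IH] x iq.
  rewrite addn0 (aprodE _ gam_pos x tN) (aprodE _ gam_pos z tN) addrA.
  by rewrite -(isomD (weyl_isom (gprod_weyl _ gam_pos tN))) subrK.
rewrite addnS /=; case: ifP => _; last exact/IH/ltnW.
rewrite /= IH ?(ltnW iq) //; congr (gprod _ _ _ _ _ + _).
rewrite /wall_refl /arefl gam_before // gamE //.
have e : pairing z (g (nth 0%N os i)) =
    (- (nbefore beta t (g (nth 0%N os i)))%:Z)%:~R by rewrite zP ?os_lt // mulrNz.
rewrite -e /Defs.refl (pairingB ipP) addrAC.
by [].
Qed.

Lemma walk_aprod_center i : (i <= q)%N -> aprod D gam J (t + i) z = aprod D gam J t z.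
Proof.
move=> iq; rewrite walk_aprod // subrr.
have tiN : (t + i <= N)%N by apply: leq_trans tqN; rewrite leq_add2l.
by rewrite (isom0 (weyl_isom (gprod_weyl _ gam_pos tiN))) add0r.
Qed.

End Walk.

Section Unreversed.
Variables (J : pred nat) (S d : seq nat) (v : V -> V).
Hypothesis JS : forall i, (i < q)%N -> J (t + i) = (i.+1 \in S).
Hypothesis vP : window_positive v.
Hypothesis dP : models v (gprod D beta J t) d.
Hypothesis J_cover : forall i, (i < N)%N -> J i ->
  len (gprod D beta J i \o refl (beta i)) = (len (gprod D beta J i)).+1.

Let os_lt i : (i < q)%N -> (nth 0%N (iota 0 q) i < q)%N.
Proof. by move=> iq; rewrite nth_iota. Qed.
Let osE i : (i < q)%N -> beta (t + i) = g (nth 0%N (iota 0 q) i).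
Proof. by move=> iq; rewrite nth_iota. Qed.

Lemma walk_saturated : saturated q S d.
Proof.
apply/allP => i; rewrite mem_iota /= => iq; apply/implyP => iS; rewrite iS nth_iota //.
have tiN : (t + i < N)%N by apply: leq_trans tqN; rewrite ltn_add2l.
apply/eqP/(models_cover vP (walk_models os_lt osE JS dP (ltnW iq)) iq).
  exact: (gprod_weyl J beta_pos (ltnW tiN)).
by apply: J_cover => //; rewrite JS.
Qed.

Variable p : 'I_r.
Variable j : nat.
Hypothesis jq : (j < q)%N.
Hypothesis pE : simple D p = v (g j).
Variable z : V.
Hypothesis zP : forall i, (i < q)%N -> pairing z (g i) = - (nbefore beta t (g i))%:R.

(* [z] lies on all hyperplanes of the window, hence so does its image on the
   folded ones. *)
Definition window_level : R := - pairing (aprod D beta J t z) (simple D p).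

Let gb i : (i < q)%N -> nbefore beta (t + i) (beta (t + i)) = nbefore beta t (beta (t + i)).
Proof. by move=> iq; rewrite (nbefore_window window_inj) ?ltnn ?addn0 // ltnW. Qed.

Lemma window_lev i : (i < q)%N -> hits D beta J (simple D p) (t + i) ->
  lev D beta J p (t + i) = window_level.
Proof.
move=> iq h; have tiN : (t + i < N)%N by apply: leq_trans tqN; rewrite ltn_add2l.
rewrite -(lev_value (J := J) beta_pos tiN h (y := z)); last by rewrite gb // zP.
by rewrite (walk_aprod_center J beta_pos os_lt osE zP gb) // ltnW.
Qed.

(** The root [absdir] is a window root, whose count at the exit is one more than at the entry. Hence
    the hyperplane through the image of [z] bounds the current unit interval, from the side
    determined by the sign and by which end of the window is considered. *)
Lemma window_floor_at i : i = 0%N \/ i = q ->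
  floor_at D beta J p (t + i) =
  window_level - (up D beta J p (t + i) == (i == 0%N))%:R.
Proof.
move=> hi; have iq : (i <= q)%N by case: hi => ->.
have tiN : (t + i <= N)%N by apply: leq_trans tqN; rewrite leq_add2l.
have [_ /mapP[k]] := walk_up beta_pos os_lt osE JS dP jq pE iq.
rewrite mem_iota /= => kq ek.
have := pairing_aprod J beta_pos p z tiN.
rewrite (walk_aprod_center J beta_pos os_lt osE zP gb) // => e.
have := zP kq; rewrite /window_level e /floor_at ek (nbefore_window window_inj) // natrD.
have -> : ((k < i)%N%:R : R) = (i != 0%N)%:R.
  by case: hi => ->; rewrite ?ltn0 ?kq // -lt0n q_gt0.
move: ek; rewrite /absdir; case: up => ek; first rewrite ek.
  by move=> ->; case: (i == 0%N) => /=; lra.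
rewrite -[dir _ _ _ _ _]opprK ek (pairingNr ipP) => ->.
by case: (i == 0%N) => /=; lra.
Qed.

End Unreversed.

Section MinRep.
Variable G : N.-tuple V.
Hypothesis GE : forall i, beta i = G`_i.

Lemma dihedral_reflsE : dihedral_refls D G t q = base_refls (ip D) window_base.
Proof.
have lE : G`_(t + q).-1 = g q.-1 by rewrite GE; congr nth; move: q_gt0; lia.
have fE : G`_t = g 0 by rewrite GE addn0.
apply/seteqP; split=> [f|_ [[[|[|//]] i2] _ <-]].
- by case=> ->; [exists ord0|exists (lift ord0 ord0)]; rewrite //= ?fE ?lE.
- by left; rewrite fE.
- by right; rewrite lE.
Qed.

(** If a minimal length representative sent a window root to a negative root, the corresponding
    reflection would shorten it inside the coset. *)
Lemma min_rep_spec u : W u -> window_positive (min_rep D G t q u) /\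
  exists2 x, Wbar x & u = min_rep D G t q u \o x.
Proof.
move=> gu; rewrite /min_rep dihedral_reflsE; set A := [set v | _].
have [v0 Av0] : exists v, A v.
  pose P n := `[< exists2 x, Wbar x & len (u \o x) = n >].
  have exP : exists n, P n.
    by exists (len u); apply/asboolP; exists id => //; apply: generated_id.
  case: (ex_minnP exP) => n /asboolP[x gx en] mn; exists (u \o x); split; first by exists x.
  by move=> y gy; rewrite en; apply: mn; apply/asboolP; exists y.
case: xgetP => [v _ [[x gx ev] vm]|/(_ v0)//].
have gv : W v by rewrite ev; apply: generated_comp => //; apply: Wbar_weyl.
split.
  split=> // i iq; apply: contrapT => /(len_lt gv (win_pos iq)).
  apply/negP; rewrite -leqNgt {2}ev.
  by apply: (vm (x \o refl (g i))); apply: generated_comp => //; apply: Wbar_refl.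
have [y [gy e1 e2]] := generated_inv win_based gx.
exists y => //; rewrite ev; apply/funext => s /=.
by have /= -> := congr1 (fun h => h s) e1.
Qed.

(** Length in [Wbar] is an inversion number, and the representative on the left does not change
    signs on [Psi]. *)
Lemma bar_length_ninv u x : W u -> Wbar x ->
  bar_length D G t q (min_rep D G t q u) (u \o x) = window_ninv (u \o x).
Proof.
move=> gu gx; have [hv [y gy eu]] := min_rep_spec gu.
rewrite /bar_length dihedral_reflsE; set v := min_rep D G t q u in hv eu *.
have gyx : Wbar (y \o x) by apply: generated_comp.
have e : u \o x = v \o (y \o x) by rewrite eu.
case: xgetP => [s _ [gs es]|/(_ (y \o x))[]//].
rewrite es (ninv_word_length win_based (bs := [seq g i | i <- iota 0 q])) //.
- rewrite /ninv count_map; apply: eq_in_count => i; rewrite mem_iota /= => iq.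
  congr (~~ _); have sP := Wbar_Psi gs iq.
  apply/asboolP/asboolP => [ps|pv].
    by have [k kq ->] := (windowP _).1 (conj sP ps); apply: hv.2.
  apply: contrapT => /(neg_posP (PsiPhi sP)) ns.
  have sN : - s (g i) \in Psi by apply: (root_opp win_based).
  have [k kq ek] := (windowP _).1 (conj sN ns).
  by apply: (window_positiveN hv kq); rewrite -ek (isomN (weyl_isom hv.1)) opprK.
- rewrite map_inj_in_uniq ?iota_uniq // => i k; rewrite !mem_iota /= => iq kq.
  exact: window_inj.
- move=> b; rewrite windowP; split.
    by move=> /mapP[i]; rewrite mem_iota /= => iq ->; exists i.
  by move=> [i iq ->]; apply/mapP; exists i => //; rewrite mem_iota.
Qed.

End MinRep.

End WindowModel.

(** * Levels of hyperplanes *)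

Section SetTranslation.
Variable N : nat.
Implicit Types (A : {set 'I_N}).

(** Positions as natural numbers, with value false from [N] on, as the recursions on galleries
    require. *)
Definition nat_mem A : pred nat := fun i => i \in [seq val j | j <- enum A].

Lemma nat_memE A (j : 'I_N) : nat_mem A j = (j \in A).
Proof. by rewrite /nat_mem (mem_map val_inj) mem_enum. Qed.

Lemma nat_mem_lt A i : nat_mem A i -> (i < N)%N.
Proof. by rewrite /nat_mem => /mapP[j _ ->]; apply: ltn_ord. Qed.

Lemma map_val_enum A : [seq val j | j <- enum A] = [seq i <- iota 0 N | nat_mem A i].
Proof.
apply: (irr_sorted_eq ltn_trans ltnn).
- have : subseq [seq val j | j <- enum A] (iota 0 N).
    by rewrite -(val_enum_ord N) map_subseq // {1}/enum_mem -enumT filter_subseq.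
  by move/(subseq_sorted ltn_trans); apply; apply: iota_ltn_sorted.
- by apply: sorted_filter; [exact: ltn_trans|exact: iota_ltn_sorted].
- move=> i; rewrite mem_filter mem_iota /= add0n.
  by apply/idP/andP => [h|[]//]; split=> //; exact: (nat_mem_lt (A := A) h).
Qed.

Lemma nat_mem_initial A n i : nat_mem (initial A n) i = nat_mem A i && (i < n)%N.
Proof.
apply/idP/andP => [h|[h1 h2]].
  have iN := nat_mem_lt h; move: h; rewrite -[i]/(val (Ordinal iN)) !nat_memE inE.
  by case/andP.
have iN := nat_mem_lt h1; rewrite -[i]/(val (Ordinal iN)) nat_memE inE /= h2.
by move: h1; rewrite -[i]/(val (Ordinal iN)) nat_memE => ->.
Qed.

Fixpoint iter_prod (T : Type) (h : nat -> T -> T) (J : pred nat) n : T -> T :=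
  if n is n'.+1 then
    if J n' then iter_prod h J n' \o h n' else iter_prod h J n'
  else id.

Lemma foldr_iota (T : Type) (h : nat -> T -> T) (J : pred nat) n :
  foldr (fun i f => h i \o f) id [seq i <- iota 0 n | J i] = iter_prod h J n.
Proof.
have cat s phi : foldr (fun i f => h i \o f) phi s = foldr (fun i f => h i \o f) id s \o phi.
  by elim: s => //= i s ->.
elim: n => // n IH; rewrite -[X in iota 0 X]addn1 iotaD filter_cat foldr_cat cat IH add0n /=.
by case: (J n).
Qed.

Lemma foldr_initial (T : Type) (h : nat -> T -> T) A n : (n <= N)%N ->
  foldr (fun (j : 'I_N) f => h j \o f) id (enum (initial A n)) =
  iter_prod h (nat_mem A) n.
Proof.
move=> nN; rewrite -foldr_iota.
rewrite -[LHS](foldr_map (fun j : 'I_N => val j) (fun i f => h i \o f)) map_val_enum.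
have -> : iota 0 N = iota 0 n ++ iota n (N - n) by rewrite -{2}[n]add0n -iotaD subnKC.
congr foldr; rewrite filter_cat.
rewrite [X in _ ++ X](_ : _ = [::]) ?cats0.
  by apply: eq_in_filter => i; rewrite mem_iota nat_mem_initial => /= ->; rewrite andbT.
rewrite -(filter_pred0 (iota n (N - n))); apply: eq_in_filter => i.
by rewrite mem_iota nat_mem_initial => /andP[h1 _]; rewrite ltnNge h1 andbF.
Qed.

Lemma initial_full A : initial A N = A.
Proof. by apply/setP => j; rewrite inE ltn_ord andbT. Qed.

Lemma window_indices A t q : (t + q <= N)%N ->
  [seq (j - t).+1 | j : 'I_N <- enum A & (t <= j < t + q)%N] =
  [seq i <- iota 1 q | nat_mem A (t + i.-1)].
Proof.
move=> tqN.
have -> : [seq (j - t).+1 | j : 'I_N <- enum A & (t <= j < t + q)%N] =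
    [seq (i - t).+1 | i <- [seq val j | j <- enum A] & (t <= i < t + q)%N].
  by rewrite filter_map -map_comp.
rewrite map_val_enum -filter_predI.
have -> : iota 0 N = iota 0 t ++ iota t q ++ iota (t + q) (N - (t + q)).
  by rewrite -iotaD -iotaD; congr iota; lia.
rewrite !filter_cat.
rewrite [X in X ++ _](_ : _ = [::]); last first.
  rewrite -(filter_pred0 (iota 0 t)); apply: eq_in_filter => i.
  by rewrite mem_iota /=; lia.
rewrite [X in _ ++ _ ++ X](_ : _ = [::]); last first.
  rewrite -(filter_pred0 (iota (t + q) (N - (t + q)))); apply: eq_in_filter => i.
  by rewrite mem_iota /=; lia.
rewrite cat0s cats0.
have -> : iota t q = [seq (t + i.-1)%N | i <- iota 1 q].
  have -> : iota 1 q = [seq (1 + i)%N | i <- iota 0 q] by rewrite -iotaDl.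
  by rewrite -map_comp -{1}[t]addn0 iotaDl; apply: eq_map.
rewrite filter_map -map_comp -[RHS]map_id.
rewrite (eq_in_filter (a2 := fun i => nat_mem A (t + i.-1))).
  by apply/eq_in_map => i; rewrite mem_filter mem_iota /=; lia.
by move=> i; rewrite mem_iota /=; case: nat_mem; lia.
Qed.

End SetTranslation.

Section Translation.
Variables (R : realType) (r : nat) (D : root_system R r).
Local Notation V := 'rV[R]_r.
Local Notation refl := (refl (ip D)).
Local Notation pairing := (pairing (ip D)).
Local Notation pos := (positive D).
Local Notation W := (generated (simple_refls D)).
Let ipP := ip_axiom D.
Variables (N : nat) (G : N.-tuple V).
Implicit Types (J : {set 'I_N}).
Local Notation beta := (nth 0 G).

Lemma wprodE J n : (n <= N)%N ->
  wprod D G (initial J n) = gprod D beta (nat_mem J) n.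
Proof.
move=> nN; have -> : gprod D beta (nat_mem J) n =
    iter_prod (fun k => refl (beta k)) (nat_mem J) n by elim: n {nN} => //= n ->.
rewrite -foldr_initial // /wprod; elim: (enum _) => //= j s ->.
by rewrite (tnth_nth 0).
Qed.

Lemma level0E (i : 'I_N) : level0 G i = nbefore beta i (beta i).
Proof.
rewrite /level0 /nbefore cardE.
rewrite -(size_map (fun j : 'I_N => val j)).
rewrite map_val_enum size_filter.
have -> : iota 0 N = iota 0 i ++ iota i (N - i).
  by rewrite -{2}[val i]add0n -iotaD subnKC // ltnW.
rewrite count_cat.
rewrite [X in (_ + X)%N](_ : _ = 0%N).
  rewrite addn0; apply: eq_in_count => j; rewrite mem_iota /= => ji.
  have jN := ltn_trans ji (ltn_ord i).
  by rewrite -[j]/(val (Ordinal jN)) nat_memE inE /= ji !(tnth_nth 0).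
apply/eqP; rewrite -leqn0 leqNgt -has_count; apply/hasPn => j; rewrite mem_iota => /andP[ij _].
apply/negP => h; have jN := nat_mem_lt h; move: h.
by rewrite -[j]/(val (Ordinal jN)) nat_memE inE /= ltnNge ij.
Qed.

Lemma whatE J n : (n <= N)%N ->
  what D G (initial J n) = aprod D beta (nat_mem J) n.
Proof.
move=> nN; have -> : aprod D beta (nat_mem J) n =
    iter_prod (wall_refl D beta) (nat_mem J) n by elim: n {nN} => //= n ->.
rewrite -foldr_initial // /what; elim: (enum _) => //= j s ->.
by rewrite /rhat /wall_refl level0E (tnth_nth 0).
Qed.

Lemma linfE lam J p : linf D lam G J p =
  pairing (- aprod D beta (nat_mem J) N (- lam)) (simple D p).
Proof. by rewrite /linf /mu -{1}(initial_full J) whatE. Qed.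

Lemma gammaE J (i : 'I_N) : gamma D G J i = gprod D beta (nat_mem J) i (beta i).
Proof. by rewrite /gamma wprodE ?(ltnW (ltn_ord i)) // (tnth_nth 0). Qed.

Lemma IsetE J p (i : 'I_N) : (i \in Iset D G J p) = hits D beta (nat_mem J) (simple D p) i.
Proof. by rewrite inE gammaE. Qed.

Hypothesis beta_pos : forall i, (i < N)%N -> pos (beta i).

(** An affine isometry sends the wall to a hyperplane parallel to those of [a], so the image of a
    single point [y] of the wall determines the level. *)
Lemma levelE J p (i : 'I_N) y (l : int) : i \in Iset D G J p ->
  pairing y (beta i) = - (nbefore beta i (beta i))%:R ->
  - pairing (aprod D beta (nat_mem J) i y) (simple D p) = l%:~R ->
  level D G J i = l.
Proof.
move=> iI ey el; have iN := ltnW (ltn_ord i); pose P := nat_mem J.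
have gw := gprod_weyl P beta_pos iN.
have iw := weyl_isom gw.
have [w' [gw' e1 e2]] := weyl_inv gw.
have ga : absroot D (gamma D G J i) = simple D p.
  move: iI; rewrite inE /absroot => /orP[]/eqP->.
    by rewrite asboolT //; apply: simple_pos.
  by rewrite asboolF ?opprK //; apply/posN/simple_pos.
have dw u : pairing u (beta i) = 0 <-> pairing (gprod D beta P i u) (simple D p) = 0.
  rewrite -(isom_pairing ipP iw u (beta i)); move: iI; rewrite IsetE => /orP[]/eqP->//.
  rewrite (pairingNr ipP); split=> [/eqP|->]; last by rewrite oppr0.
  by rewrite oppr_eq0 => /eqP.
have key : what D G (initial J i) @`
    hyperplane (ip D) (tnth G i) (- (level0 G i)%:Z) =
    hyperplane (ip D) (- absroot D (gamma D G J i)) l.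
  rewrite whatE // level0E (tnth_nth 0) ga /hyperplane mulrNz.
  have ap u : aprod D beta P i u = gprod D beta P i u + aprod D beta P i 0.
    exact: (aprodE P beta_pos u iN).
  apply/seteqP; split=> [_ [x /= ex <-]|x /= ex].
    rewrite (pairingNr ipP) -el; congr (- _); apply/eqP.
    rewrite -subr_eq0 -(pairingB ipP) -/P (ap x) (ap y) opprD addrACA subrr addr0.
    by rewrite -(isomB iw); apply/eqP/dw; rewrite (pairingB ipP) ex ey subrr.
  exists (w' (x - aprod D beta P i 0)); last first.
    by rewrite -/P (ap (w' _)); have /= -> := congr1 (fun h => h (x - aprod D beta P i 0)) e1; rewrite subrK.
  apply/eqP; rewrite /= -ey -subr_eq0 -(pairingB ipP); apply/eqP/dw.
  rewrite (isomB iw); have /= -> := congr1 (fun h => h (x - aprod D beta P i 0)) e1.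
  rewrite -addrA -opprD [_ + gprod _ _ _ _ _]addrC -ap (pairingB ipP) /P.
  by move: ex el; rewrite (pairingNr ipP) => <- /eqP; rewrite eqr_opp => /eqP->; rewrite subrr.
(* Any other level chosen would give the same hyperplane, and evaluation at the image of [y] shows
   that the two levels agree. *)
rewrite /level; case: xgetP => [l' _ /= e|/(_ l)]; last by rewrite /= key.
have : hyperplane (ip D) (- absroot D (gamma D G J i)) l
    (aprod D beta P i y).
  by rewrite /hyperplane /= ga (pairingNr ipP).
rewrite -key e /hyperplane /= ga (pairingNr ipP) el => /eqP.
by rewrite eqr_int => /eqP ->.
Qed.

End Translation.

Lemma head_filter_iota (h : pred nat) q : let s := [seq i <- iota 0 q | h i] in
  s != [::] -> [/\ (head 0%N s < q)%N, h (head 0%N s) &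
                   forall i, (i < head 0 s)%N -> ~~ h i].
Proof.
move=> s; have : sorted ltn s by apply: sorted_filter; [exact: ltn_trans|exact: iota_ltn_sorted].
have memS i : (i \in s) = h i && (i < q)%N by rewrite mem_filter mem_iota.
case: s memS => //= x s memS pth _.
have /andP[hx xq] : h x && (x < q)%N by rewrite -memS inE eqxx.
split=> // i ix; apply/negP => hi.
have : i \in x :: s by rewrite memS hi (ltn_trans ix).
rewrite inE ltn_eqF //= => /(allP (order_path_min ltn_trans pth)) /=.
by rewrite ltnNge ltnW.
Qed.

Lemma last_filter_iota (h : pred nat) q : let s := [seq i <- iota 0 q | h i] in
  s != [::] -> [/\ (last 0%N s < q)%N, h (last 0%N s) &
                   forall i, (last 0 s < i < q)%N -> ~~ h i].
Proof.
elim: q => // q IH s; rewrite {}/s -[X in iota 0 X]addn1 iotaD filter_cat add0n /=.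
case: ifP => hq; first by rewrite last_cat /= => _; split=> // i; lia.
rewrite cats0 => /IH [h1 h2 h3]; split=> //; first exact: leq_trans h1 _.
move=> i /andP[i1]; rewrite ltnS leq_eqVlt => /orP[/eqP->|i2]; first by rewrite hq.
by apply: h3; rewrite i1.
Qed.

(** * Galleries that agree on a range of positions *)

Section ChainExtensionality.
Variables (R : realType) (r : nat) (D : root_system R r).
Local Notation V := 'rV[R]_r.
Local Notation refl := (refl (ip D)).
Local Notation pos := (positive D).
Variables (beta beta' : nat -> V) (J J' : pred nat).

Lemma nbefore_ext i (d : V) : {in gtn i, beta =1 beta'} ->
  nbefore beta i d = nbefore beta' i d.
Proof.
by move=> h; apply: eq_in_count => j; rewrite mem_iota /= => ji; rewrite h.
Qed.

Lemma gprod_ext s i : (s <= i)%N -> gprod D beta J s = gprod D beta' J' s ->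
  (forall k, (s <= k < i)%N -> beta k = beta' k /\ J k = J' k) ->
  gprod D beta J i = gprod D beta' J' i.
Proof.
move=> + e; elim: i => [|i IH]; first by rewrite leqn0 => /eqP s0 _; rewrite s0 in e.
rewrite leq_eqVlt => /orP[/eqP s0 _|]; [by rewrite s0 in e|rewrite ltnS => si h].
have [e1 e2] := h i (introT andP (conj si (ltnSn i))).
rewrite /= e1 e2 IH // => k /andP[k1 k2]; apply: h; rewrite k1 /=.
exact: leq_trans k2 (leqnSn i).
Qed.

Lemma aprod_ext s i : (s <= i)%N -> aprod D beta J s = aprod D beta' J' s ->
  (forall k, (s <= k < i)%N -> [/\ beta k = beta' k, J k = J' k &
    nbefore beta k (beta k) = nbefore beta' k (beta k)]) ->
  aprod D beta J i = aprod D beta' J' i.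
Proof.
move=> + e; elim: i => [|i IH]; first by rewrite leqn0 => /eqP s0 _; rewrite s0 in e.
rewrite leq_eqVlt => /orP[/eqP s0 _|]; [by rewrite s0 in e|rewrite ltnS => si h].
have [e1 e2 e3] := h i (introT andP (conj si (ltnSn i))).
have -> : aprod D beta J i.+1 =
  if J' i then aprod D beta J i \o wall_refl D beta' i else aprod D beta J i.
  by rewrite /= e2 /wall_refl e3 e1.
rewrite IH // => k /andP[k1 k2]; apply: h; rewrite k1 /=.
exact: leq_trans k2 (leqnSn i).
Qed.

Variables (t q : nat).
Hypothesis revE : forall i, beta' i =
  if (t <= i < t + q)%N then beta (t + (t + q).-1 - i) else beta i.

Lemma rev_window i : (i < q)%N -> beta' (t + i) = beta (t + nth 0%N (rev (iota 0 q)) i).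
Proof.
move=> iq; rewrite revE leq_addr ltn_add2l iq /=.
rewrite nth_rev size_iota // nth_iota ?subn_gt0 //; last by lia.
by congr beta; lia.
Qed.

Lemma rev_outside i : ~~ (t <= i < t + q)%N -> beta' i = beta i.
Proof. by rewrite revE => /negbTE ->. Qed.

Lemma nbefore_rev i (d : V) : (t + q <= i)%N -> nbefore beta' i d = nbefore beta i d.
Proof.
move=> tqi; rewrite -(subnKC tqi) /nbefore !iotaD !count_cat !add0n.
congr (_ + _ + _)%N.
- apply: eq_in_count => j; rewrite mem_iota /= add0n => jt.
  by rewrite rev_outside // leqNgt jt.
- have -> : iota t q = [seq (t + i)%N | i <- iota 0 q] by rewrite -iotaDl addn0.
  rewrite !count_map.
  have pm : perm_eq (iota 0 q) [seq nth 0%N (rev (iota 0 q)) j | j <- iota 0 q].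
    rewrite map_nth_iota0 ?size_rev ?size_iota // take_oversize ?size_rev ?size_iota //.
    by rewrite perm_sym perm_rev.
  rewrite [RHS](permP pm) count_map; apply: eq_in_count => j; rewrite mem_iota /= => jq.
  by rewrite rev_window.
- apply: eq_in_count => j; rewrite mem_iota => /andP[h1 _].
  by rewrite rev_outside // negb_and -leqNgt h1 orbT.
Qed.

End ChainExtensionality.

(** * Effect of the root operator on the gallery *)

Section Flip.
Variables (R : realType) (r : nat) (D : root_system R r).
Local Notation V := 'rV[R]_r.
Local Notation refl := (refl (ip D)).
Local Notation pos := (positive D).
Variables (beta : nat -> V) (N : nat) (J K : pred nat) (p : 'I_r) (k n : nat).
Local Notation a := (simple D p).
Hypothesis beta_pos : forall i, (i < N)%N -> pos (beta i).
Hypotheses (kn : (k < n)%N) (kN : (k < N)%N) (Jk : ~~ J k).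
Hypothesis KE : forall i, (i < N)%N -> K i = (J i && (i != n)) || (i == k).
Hypothesis hk : gprod D beta J k (beta k) = a.
Hypothesis hn : (n < N)%N -> J n /\ gprod D beta J n (beta n) = a.

(** The new fold at [k] inserts the simple reflection on the left, because [gprod] sends its root to
    [a]; deleting the fold at [n] removes it for the same reason. If [n = N] it is never removed. *)
Lemma gprod_flip i : (i <= N)%N -> gprod D beta K i =
  if (k < i <= n)%N then refl a \o gprod D beta J i else gprod D beta J i.
Proof.
elim: i => [|i IH] iN; first by [].
have {}IH := IH (ltnW iN).
have conj_refl : gprod D beta J i (beta i) = a ->
    gprod D beta J i \o refl (beta i) = refl a \o gprod D beta J i.
  by move=> e; rewrite (weyl_conj _ (gprod_weyl J beta_pos (ltnW iN))) e.
rewrite /= KE // IH; have [e|ne] := eqVneq i k.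
  subst i; rewrite orbT ltnn /= ltnSn kn /= (negbTE Jk).
  exact: conj_refl.
rewrite orbF; have [e|ne'] := eqVneq i n.
  subst i; have [Jn h] := hn iN.
  rewrite andbF kn leqnn /= [(n < n)%N]ltnn andbF Jn.
  by rewrite conj_refl.
have -> : (k < i.+1 <= n)%N = (k < i <= n)%N.
  by rewrite ltnS; move: ne ne' kn; lia.
by rewrite andbT; case: (k < i <= n)%N; case: (J i).
Qed.

End Flip.

(** * Characterization of M, m and k *)

Section Positions.
Variables (R : realType) (r : nat) (D : root_system R r).
Variables (lam : 'rV[R]_r) (N : nat) (G : N.-tuple 'rV[R]_r).
Variables (J : {set 'I_N}) (p : 'I_r).
Local Notation I := (Iset D G J p).
Local Notation M := (Mmax D lam G J p).
Local Notation lv i := ((level D G J i)%:~R : R).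

Lemma Mmax_linf : linf D lam G J p <= M.
Proof. exact: bigmax_ge_id. Qed.

Lemma Mmax_level i : i \in I -> lv i <= M.
Proof. by move=> iI; apply: (le_bigmax_cond _ (fun i : 'I_N => lv i)). Qed.

Lemma Mmax_le x : linf D lam G J p <= x -> (forall i, i \in I -> lv i <= x) -> M <= x.
Proof. by move=> h1 h2; apply/bigmax_leP. Qed.

Lemma mpos_some m : m \in I -> lv m = M ->
  (forall j, j \in I -> lv j = M -> (m <= j)%N) -> mpos D lam G J p = Some m.
Proof.
move=> mI mM mmin; rewrite /mpos; case: pickP => [i|/(_ m)]; last first.
  rewrite mI mM eqxx /= => /negbT/negP[]; apply/forallP.
  by move=> j; apply/implyP => jI; apply/implyP => /eqP; apply: mmin.
move=> /and3P[iI /eqP iM /forallP imin]; congr Some; apply/val_inj/eqP.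
rewrite eqn_leq mmin // andbT.
by have /implyP/(_ mI)/implyP := imin m; apply; apply/eqP.
Qed.

Lemma mpos_none : (forall j, j \in I -> lv j <> M) -> mpos D lam G J p = None.
Proof.
by move=> h; rewrite /mpos; case: pickP => // i /and3P[iI /eqP /(h i iI)].
Qed.

Lemma mpos_cases : (exists m, [/\ m \in I, lv m = M &
    forall j, j \in I -> lv j = M -> (m <= j)%N]) \/
  ((forall j, j \in I -> lv j <> M) /\ linf D lam G J p = M).
Proof.
have [[i [iI iM]]|h] := pselect (exists i, i \in I /\ lv i = M).
  left; pose P := [pred i | (i \in I) && (lv i == M)].
  have Pi : P i by rewrite /= iI iM eqxx.
  have [m /andP[mI /eqP mM] mmin] := @arg_minnP _ i P (fun i : 'I_N => val i) Pi.
  by exists m; split=> // j jI jM; apply: mmin; rewrite /= jI jM eqxx.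
right; have h' j : j \in I -> lv j <> M by move=> jI jM; apply: h; exists j.
split=> //; apply/eqP; rewrite eq_le Mmax_linf /=; apply: contraT; rewrite -ltNge => lt.
have : M < M.
  rewrite {1}/Mmax; apply/bigmax_ltP; split=> // i iI.
  by rewrite lt_neqAle Mmax_level // andbT; apply/eqP/h'.
by rewrite ltxx.
Qed.

Lemma kpos_some k : k \in I -> before k (mpos D lam G J p) ->
  (forall j, j \in I -> before j (mpos D lam G J p) -> (j <= k)%N) ->
  kpos D lam G J p = Some k.
Proof.
move=> kI kb kmax; rewrite /kpos; case: pickP => [i|/(_ k)]; last first.
  rewrite kI kb /= => /negbT/negP[]; apply/forallP.
  by move=> j; apply/implyP => jI; apply/implyP; apply: kmax.
move=> /and3P[iI ib /forallP imax]; congr Some; apply/val_inj/eqP.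
rewrite eqn_leq kmax //=.
by have /implyP/(_ kI)/implyP := imax k; apply.
Qed.

End Positions.

(** * Comparison of the galleries of J and Y J *)

Section Final.
Variables (R : realType) (r : nat) (D : root_system R r).
Local Notation V := 'rV[R]_r.
Local Notation refl := (refl (ip D)).
Local Notation pairing := (pairing (ip D)).
Local Notation pos := (positive D).
Local Notation W := (generated (simple_refls D)).
Local Notation len := (word_length (simple_refls D)).
Let ipP := ip_axiom D.
Variables (lam : V) (N : nat) (G : N.-tuple V) (t q : nat) (Psi : seq V).
Hypothesis lam_dom : dominant_weight D lam.
Hypothesis G_chain : lambda_chain D lam G.
Hypothesis q2 : (2 <= q)%N.
Hypothesis tqN : (t + q <= N)%N.
Hypothesis PsiP : rank2_subsystem D Psi.
Hypothesis seg_uniq : uniq (segment G t q).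
Hypothesis segP : forall b, b \in segment G t q <-> b \in Psi /\ pos b.
Variable p : 'I_r.
Local Notation a := (simple D p).
Local Notation beta := (nth 0 G).
Local Notation G' := (reverse_segment G t q).
Local Notation beta' := (nth 0 G').
Local Notation Y := (yang_baxter D G t q).
Local Notation g i := (beta (t + i)).
Local Notation inW i := (t <= i < t + q)%N.

Let bpos := chain_pos G_chain.
Let bwall := chain_wall G_chain.

Lemma N_gt0 : (0 < N)%N. Proof. by move: q2 tqN; lia. Qed.
Let lamc := chain_weight G_chain N_gt0 lam_dom.1.

Lemma segment_nth i : (i < q)%N -> (segment G t q)`_i = g i.
Proof. by move=> iq; rewrite /segment nth_take // nth_drop. Qed.

Lemma segment_size : size (segment G t q) = q.
Proof. by rewrite /segment size_takel // size_drop size_tuple; move: tqN; lia. Qed.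

Lemma segment_root_inj i j : (i < q)%N -> (j < q)%N -> g i = g j -> i = j.
Proof.
move=> iq jq e; apply/eqP; rewrite -(nth_uniq 0 _ _ seg_uniq) ?segment_size //.
by rewrite !segment_nth // e.
Qed.

Lemma segment_rootsP b : b \in Psi /\ pos b <-> exists2 i, (i < q)%N & b = g i.
Proof.
rewrite -segP; split=> [/(nthP 0)[i]|[i iq ->]].
  by rewrite segment_size => iq <-; exists i; rewrite ?segment_nth.
by rewrite -segment_nth // mem_nth // segment_size.
Qed.

Lemma segment_window : window_chain D Psi beta N t q.
Proof. by split=> //; [exact: segment_root_inj|exact: segment_rootsP]. Qed.

Lemma reverseE i : beta' i = if inW i then beta (t + (t + q).-1 - i) else beta i.
Proof.
have [iN|Ni] := ltnP i N.
  rewrite -[i in LHS]/(val (Ordinal iN)) -tnth_nth tnth_mktuple /=.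
  by case: ifP.
rewrite [(i < t + q)%N]ltnNge (leq_trans tqN Ni) andbF.
by rewrite !nth_default ?size_tuple.
Qed.

Lemma reverse_in_window i : (i < q)%N -> beta' (t + i) = g (nth 0%N (rev (iota 0 q)) i).
Proof. exact: rev_window reverseE i. Qed.

Lemma reverse_outside i : ~~ inW i -> beta' i = beta i.
Proof. exact: rev_outside reverseE i. Qed.

Lemma rev_index_lt i : (i < q)%N -> (nth 0%N (rev (iota 0 q)) i < q)%N.
Proof. by move=> iq; rewrite nth_rev size_iota // nth_iota; lia. Qed.

Lemma index_lt i : (i < q)%N -> (nth 0%N (iota 0 q) i < q)%N.
Proof. by move=> iq; rewrite nth_iota. Qed.

Lemma window_index i : (i < q)%N -> beta (t + i) = g (nth 0%N (iota 0 q) i).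
Proof. by move=> iq; rewrite nth_iota. Qed.

Lemma split_window i : inW i -> exists2 k, (k < q)%N & i = (t + k)%N.
Proof. by move=> /andP[h1 h2]; exists (i - t)%N; lia. Qed.

Lemma reverse_pos i : (i < N)%N -> pos (beta' i).
Proof.
move=> iN; have [/split_window[k kq ->]|h] := boolP (inW i); last first.
  by rewrite reverse_outside //; apply: bpos.
by rewrite reverse_in_window //; apply: bpos; have := rev_index_lt kq; move: tqN; lia.
Qed.

Lemma nbefore_out i (d : V) : ~~ (t < i < t + q)%N -> nbefore beta' i d = nbefore beta i d.
Proof.
move=> h; have [it|ti] := leqP i t.
  by apply: nbefore_ext => k; rewrite inE => ki; rewrite reverse_outside //; lia.
by apply: (nbefore_rev reverseE); lia.
Qed.

Lemma nbefore_wall i : (i < q)%N ->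
  nbefore beta' (t + i) (beta' (t + i)) = nbefore beta t (beta' (t + i)).
Proof.
move=> iq; rewrite -(nbefore_out (i := t)) ?ltnn //.
rewrite (nbefore_window (q := q)) ?ltnn ?addn0 ?(ltnW iq) // => j k jq kq.
rewrite !reverse_in_window // => /(segment_root_inj (rev_index_lt jq) (rev_index_lt kq)).
by rewrite !nth_rev ?size_iota // !nth_iota; lia.
Qed.

Lemma gprod_coset (P : pred nat) : exists2 x,
  generated (base_refls (ip D) (window_base beta t q)) x &
  gprod D beta P (t + q) = gprod D beta P t \o x.
Proof.
exact: (walk_coset segment_window P index_lt window_index (leqnn q)).
Qed.

Lemma window_start_le : (t <= N)%N. Proof. by apply: leq_trans tqN; rewrite leq_addr. Qed.

(** The lengths entering the Yang-Baxter table are replaced by inversion numbers of the two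
    products, which no longer mention the coset representative. *)
Lemma yang_baxterE (K : {set 'I_N}) i : (i < N)%N -> nat_mem (Y K) i =
  if inW i then (i - t).+1 \in yb_invol q
    (window_ninv D beta t q (gprod D beta (nat_mem K) t))
    (window_ninv D beta t q (gprod D beta (nat_mem K) (t + q)))
    [seq k <- iota 1 q | nat_mem K (t + k.-1)]
  else nat_mem K i.
Proof.
move=> iN; rewrite -[i in LHS]/(val (Ordinal iN)) nat_memE inE /=.
rewrite -[nat_mem K i]/(nat_mem K (val (Ordinal iN))) nat_memE.
case: ifP => // _; rewrite window_indices // !wprodE ?window_start_le //.
have gu := gprod_weyl (nat_mem K) bpos window_start_le.
have [x gx ->] := gprod_coset (nat_mem K).
have B := bar_length_ninv segment_window (G := G) (fun=> erefl) gu.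
rewrite -(B x gx) -[X in window_ninv _ _ _ _ X]/(gprod D beta (nat_mem K) t \o id).
by rewrite -(B id) //; apply: generated_id.
Qed.

Section Admissible.
Variable J : {set 'I_N}.
Hypothesis J_adm : admissible D G J.
Local Notation P := (nat_mem J).
Local Notation J' := (Y J).
Local Notation P' := (nat_mem J').
Local Notation u := (gprod D beta P t).
Local Notation v := (min_rep D G t q u).
Local Notation S := [seq i <- iota 1 q | P (t + i.-1)%N].
Local Notation Lev i := ((level D G J i)%:~R : R).
Local Notation Lev' i := ((level D G' J' i)%:~R : R).
Local Notation I := (Iset D G J p).
Local Notation I' := (Iset D G' J' p).

Lemma fold_cover i : (i < N)%N -> P i ->
  len (gprod D beta P i \o refl (beta i)) = (len (gprod D beta P i)).+1.
Proof.
move=> iN Pi; have iJ : Ordinal iN \in J by rewrite -nat_memE.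
have [_] := J_adm iJ; rewrite /= !wprodE ?(ltnW iN) // => <-.
by rewrite /= Pi.
Qed.

Lemma gprod_start_weyl : W u. Proof. exact: (gprod_weyl P bpos window_start_le). Qed.

Let mrs := min_rep_spec segment_window (G := G) (fun=> erefl) gprod_start_weyl.

Lemma min_rep_pos : window_positive D beta t q v. Proof. exact: mrs.1. Qed.

Lemma fold_in_window i : (i < q)%N -> P (t + i) = (i.+1 \in S).
Proof. by move=> iq; rewrite mem_filter mem_iota add1n !ltnS iq /= andbT. Qed.

Lemma yang_outside i : ~~ inW i -> P' i = P i.
Proof.
move=> h; have [iN|Ni] := ltnP i N; first by rewrite yang_baxterE // (negbTE h).
have out (K : {set 'I_N}) : nat_mem K i = false.
  by apply/negP => /nat_mem_lt; rewrite ltnNge Ni.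
by rewrite !out.
Qed.

Variable d : seq nat.
Hypothesis dP : models beta t q v u d.
Variable z : V.
Hypothesis zP : forall i, (i < q)%N -> pairing z (g i) = - (nbefore beta t (g i))%:R.
Local Notation y := (dwalk q (iota 0 q) S d q).
Local Notation T := (yb_invol q (minv q d) (minv q y) S).
Local Notation ros := (rev (iota 0 q)).

Let yP := walk_models segment_window index_lt window_index fold_in_window dP (leqnn q).

Lemma window_checked : window_check q d S.
Proof.
have qq := q_small segment_window.
have /allP/(_ d dP.1)/allP/(_ S (mem_subseqs _ _))/implyP := allP window_ok q qq.
have sat := walk_saturated segment_window fold_in_window min_rep_pos dP fold_cover.
exact.
Qed.

Lemma ninv_u : window_ninv D beta t q u = minv q d.
Proof. exact: (models_ninv segment_window min_rep_pos dP). Qed.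

Lemma ninv_w : window_ninv D beta t q (gprod D beta P (t + q)) = minv q y.
Proof. exact: (models_ninv segment_window min_rep_pos yP). Qed.

Lemma yang_in_window i : (i < q)%N -> P' (t + i) = (i.+1 \in T).
Proof.
move=> iq; rewrite yang_baxterE; last by move: tqN; lia.
by rewrite leq_addr ltn_add2l iq /= ninv_u ninv_w addKn.
Qed.

Lemma gprod_before i : (i <= t)%N -> gprod D beta' P' i = gprod D beta P i.
Proof.
move=> it; apply: (gprod_ext (s := 0)) => // k /= kt; have h : ~~ inW k by lia.
by rewrite reverse_outside // yang_outside.
Qed.

Lemma yang_models : models beta t q v (gprod D beta' P' t) d.
Proof. by rewrite gprod_before. Qed.

(** By the finite check both walks leave the window with the same permutation of the roots, hence
    with the same element by [models_eq]; beyond it all factors agree. *)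
Lemma gprod_after i : (t + q <= i)%N -> gprod D beta' P' i = gprod D beta P i.
Proof.
move=> h; apply: (gprod_ext h) => [|k k1]; last first.
  have h' : ~~ inW k by lia.
  by rewrite reverse_outside // yang_outside.
have [x gx ex] := walk_coset segment_window P index_lt window_index (leqnn q).
have [x' gx' ex'] := walk_coset segment_window P' rev_index_lt reverse_in_window (leqnn q).
have m := walk_models segment_window rev_index_lt reverse_in_window yang_in_window yang_models (leqnn q).
have /andP[/eqP ey _] := window_checked; rewrite ey ex' (gprod_before (leqnn t)) in m.
have m0 := yP; rewrite ex in m0.
rewrite ex' ex (gprod_before (leqnn t)); congr (_ \o _).
exact: (models_eq segment_window gprod_start_weyl m m0 gx' gx).
Qed.

Let gb i : (i < q)%N -> nbefore beta (t + i) (beta (t + i)) = nbefore beta t (beta (t + i)).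
Proof. by move=> iq; rewrite (nbefore_window segment_root_inj) ?ltnn ?addn0 // ltnW. Qed.

Lemma aprod_before i : (i <= t)%N -> aprod D beta' P' i = aprod D beta P i.
Proof.
move=> it; apply: (aprod_ext (s := 0)) => // k /= kt; have h : ~~ inW k by lia.
by rewrite reverse_outside // yang_outside //; split=> //; apply: nbefore_out; lia.
Qed.

(** In both orders the affine product across the window is the linear one centred at [z], and the
    linear products agree. *)
Lemma aprod_after i : (t + q <= i)%N -> aprod D beta' P' i = aprod D beta P i.
Proof.
move=> h; apply: (aprod_ext h) => [|k k1]; last first.
  have h' : ~~ inW k by lia.
  by rewrite reverse_outside // yang_outside //; split=> //; apply: nbefore_out; lia.
apply/funext => x.
rewrite (walk_aprod segment_window P' reverse_pos rev_index_lt reverse_in_window zP nbefore_wall x (leqnn q)).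
rewrite (walk_aprod segment_window P bpos index_lt window_index zP gb x (leqnn q)).
by rewrite gprod_after // aprod_before.
Qed.

Lemma gprod_out i : ~~ (t < i < t + q)%N -> gprod D beta' P' i = gprod D beta P i.
Proof. by move=> h; have [it|ti] := leqP i t; [exact: gprod_before|apply: gprod_after; lia]. Qed.

Lemma aprod_out i : ~~ (t < i < t + q)%N -> aprod D beta' P' i = aprod D beta P i.
Proof. by move=> h; have [it|ti] := leqP i t; [exact: aprod_before|apply: aprod_after; lia]. Qed.

Lemma hits_out i : ~~ inW i -> hits D beta' P' a i = hits D beta P a i.
Proof. by move=> h; rewrite /hits gprod_out ?reverse_outside //; lia. Qed.

Lemma Iset_out (i : 'I_N) : ~~ inW i -> (i \in I') = (i \in I).
Proof. by move=> h; rewrite !IsetE hits_out. Qed.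

Lemma level_out (i : 'I_N) : ~~ inW i -> level D G' J' i = level D G J i.
Proof.
move=> h; have h' : ~~ (t < i < t + q)%N by lia.
have tG : tnth G' i = tnth G i by rewrite !(tnth_nth 0) reverse_outside.
have gG : gamma D G' J' i = gamma D G J i by rewrite !gammaE gprod_out // reverse_outside.
have lG : level0 G' i = level0 G i by rewrite !level0E reverse_outside // nbefore_out.
have iN := ltnW (ltn_ord i).
by rewrite /level tG gG lG !whatE // aprod_out.
Qed.

Lemma linf_eq : linf D lam G' J' p = linf D lam G J p.
Proof. by rewrite !linfE aprod_out //; move: tqN; lia. Qed.

Lemma level_lev (i : 'I_N) : i \in I -> Lev i = lev D beta P p i.
Proof.
move=> iI; have iN := ltn_ord i; have [w [ew _]] := bwall iN.
have /intrP[l el] := lev_int P bpos p iN.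
have h : hits D beta P a i by rewrite -IsetE.
rewrite el (levelE bpos iI ew (l := l)) //.
by rewrite -el; exact: (lev_value bpos iN h ew).
Qed.

Local Notation Lw := (window_level D beta t P p z).

Lemma window_Lev (i : 'I_N) : inW i -> i \in I -> Lev i = Lw.
Proof.
move=> /split_window[k kq ik] iI; have h : hits D beta P a (t + k) by rewrite -ik -IsetE.
by rewrite level_lev // ik; exact: (window_lev segment_window zP kq h).
Qed.

Section Direction.
Variable j : nat.
Hypothesis jP : j \in [:: 0; q.-1]%N.
Hypothesis pE : a = v (g j).

Lemma direction_lt : (j < q)%N.
Proof. by move: jP; rewrite !inE => /orP[]/eqP->; move: q2; lia. Qed.

Lemma up_start : up D beta P p t = (index j d < q)%N.
Proof.
have := walk_up segment_window bpos index_lt window_index fold_in_window dP direction_lt pE (leq0n q).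
by rewrite addn0 => -[e _]; rewrite e.
Qed.

Lemma up_end : up D beta P p (t + q) = (index j y < q)%N.
Proof.
by have [] := walk_up segment_window bpos index_lt window_index fold_in_window dP direction_lt pE (leqnn q).
Qed.

Lemma floor_start : floor_at D beta P p t = Lw - (up D beta P p t)%:R.
Proof.
have := window_floor_at segment_window fold_in_window dP direction_lt pE zP (or_introl erefl).
by rewrite addn0 => e; rewrite e; case: up.
Qed.

Lemma floor_end : floor_at D beta P p (t + q) = Lw - (~~ up D beta P p (t + q))%:R.
Proof.
have := window_floor_at segment_window fold_in_window dP direction_lt pE zP (or_intror erefl).
by rewrite (gtn_eqF (ltnW q2)) eqbF_neg => e; rewrite e.
Qed.

Lemma window_level_int : Lw \is a Num.int.
Proof.
have -> : Lw = floor_at D beta P p t + (up D beta P p t)%:R by rewrite floor_start subrK.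
by rewrite rpredD ?rpred_nat //; apply: (floor_int P bpos p window_start_le).
Qed.

Lemma whitsE : whits q (iota 0 q) S d j = [seq i <- iota 0 q | hits D beta P a (t + i)].
Proof.
apply: eq_in_filter => i; rewrite mem_iota /= => iq.
by rewrite (walk_hits segment_window index_lt window_index fold_in_window min_rep_pos dP direction_lt pE iq).
Qed.

Lemma whits_reverse : whits q ros T d j = [seq i <- iota 0 q | hits D beta' P' a (t + i)].
Proof.
apply: eq_in_filter => i; rewrite mem_iota /= => iq.
by rewrite (walk_hits segment_window rev_index_lt reverse_in_window yang_in_window min_rep_pos yang_models direction_lt pE iq).
Qed.

Lemma direction_check : (index j d < q)%N ->
  let H := whits q (iota 0 q) S d j in let H' := whits q ros T d j in
  [/\ H != [::], H' != [::],
    ~~ (index j y < q)%N -> eq_upto q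
      [in yb_invol q (minv q (lmul q j d)) (minv q y)
         [seq i <- iota 1 q | (i \in S) && (i != (head 0%N H).+1)]]
      [pred i | (i \in T) && (i != (head 0%N H').+1)] &
    (index j y < q)%N -> eq_upto q
      [in yb_invol q (minv q d) (minv q (lmul q j y))
         [seq i <- iota 1 q | (i \in S) || (i == (last 0%N H).+1)]]
      [pred i | (i \in T) || (i == (last 0%N H').+1)]].
Proof.
move=> h; have /andP[_ /allP/(_ j jP)] := window_checked.
by move=> /implyP/(_ h)/and4P[h1 h2 /implyP h3 /implyP h4]; split.
Qed.

Lemma window_Lev' (i : 'I_N) : inW i -> i \in I' -> Lev' i = Lw.
Proof.
move=> /split_window[k kq ik] iI; have /intrP[l el] := window_level_int.
have kw : pairing z (beta' i) = - (nbefore beta' i (beta' i))%:R.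
  by rewrite ik nbefore_wall // reverse_in_window // zP // rev_index_lt.
rewrite el (levelE reverse_pos iI kw (l := l)) //.
rewrite ik (walk_aprod_center segment_window P' reverse_pos rev_index_lt reverse_in_window zP nbefore_wall (ltnW kq)).
by rewrite aprod_before // -el.
Qed.

End Direction.

Lemma hit_direction i : (i < q)%N ->
  hits D beta P a (t + i) \/ hits D beta' P' a (t + i) ->
  exists2 j, j \in [:: 0; q.-1]%N & a = v (g j).
Proof.
have q2q k : (k < q)%N -> (k < 2 * q)%N by move=> kq; apply: leq_trans kq _; rewrite leq_pmull.
move=> iq [].
- have md := walk_models segment_window index_lt window_index fold_in_window dP (ltnW iq).
  rewrite /hits window_index // => h.
  apply: (models_simple segment_window min_rep_pos md (q2q _ (index_lt iq))).
  by rewrite /window_root index_lt //; case/orP: h => /eqP ->; [left|right].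
- have md := walk_models segment_window rev_index_lt reverse_in_window yang_in_window yang_models (ltnW iq).
  rewrite /hits reverse_in_window // => h.
  apply: (models_simple segment_window min_rep_pos md (q2q _ (rev_index_lt iq))).
  by rewrite /window_root rev_index_lt //; case/orP: h => /eqP ->; [left|right].
Qed.

Lemma ordinal_of i : (i < N)%N -> exists s : 'I_N, val s = i.
Proof. by move=> iN; exists (Ordinal iN). Qed.

Lemma window_lt i : (i < q)%N -> (t + i < N)%N. Proof. by move: tqN; lia. Qed.

Lemma inW_add i : (i < q)%N -> inW (t + i).
Proof. by move=> iq; rewrite leq_addr ltn_add2l. Qed.

Lemma window_hit j : j \in [:: 0; q.-1]%N -> a = v (g j) -> up D beta P p t ->
  (exists2 i : 'I_N, inW i & i \in I) /\ (exists2 i : 'I_N, inW i & i \in I').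
Proof.
move=> jP pE ut; rewrite (up_start jP pE) in ut.
have [h1 h2 _ _] := direction_check jP ut.
rewrite (whitsE jP pE) in h1; rewrite (whits_reverse jP pE) in h2.
split.
  have [kq hk _] := head_filter_iota h1.
  by exists (Ordinal (window_lt kq)); rewrite ?IsetE //= inW_add.
have [kq hk _] := head_filter_iota h2.
by exists (Ordinal (window_lt kq)); rewrite ?IsetE //= inW_add.
Qed.

(** With sign minus at the entry, an earlier level exceeds that of the window, so the hits in the
    window do not matter for the maximum. *)
Lemma down_level j : j \in [:: 0; q.-1]%N -> a = v (g j) -> ~~ up D beta P p t ->
  exists i : 'I_N, [/\ (i < t)%N, i \in I & Lw + 1 <= Lev i].
Proof.
move=> jP pE nu.
have [k [kt hk lek]] := down_above bpos bwall fold_cover window_start_le nu.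
have [s es] := ordinal_of (leq_trans kt window_start_le); exists s.
have sI : s \in I by rewrite IsetE es.
rewrite es; split=> //; rewrite level_lev // es; apply: le_trans lek.
by rewrite (floor_start jP pE) (negbTE nu) subr0.
Qed.

Local Notation M := (Mmax D lam G J p).

(** Only levels in the window need comparison. With sign plus at the entry both windows contain
    hits, all of level [Lw]; with sign minus these hits are dominated by a level before the window,
    common to both. *)
Lemma Mmax_same : Mmax D lam G' J' p = M.
Proof.
apply/eqP; rewrite eq_le; apply/andP; split; apply: Mmax_le.
- by rewrite linf_eq; apply: Mmax_linf.
- move=> i iI'; have [iW|iW] := boolP (inW i); last first.
    by rewrite level_out //; apply: Mmax_level; rewrite -Iset_out.
  have [k kq ik] := split_window iW.
  have [|j jP pE] := hit_direction kq; first by right; rewrite -ik -IsetE.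
  rewrite (window_Lev' jP pE iW iI').
  have [ut|nu] := boolP (up D beta P p t).
    have [[s sW sI] _] := window_hit jP pE ut.
    by rewrite -(window_Lev sW sI); apply: Mmax_level.
  have [s [_ sI le]] := down_level jP pE nu.
  by apply: le_trans (Mmax_level lam sI); apply: le_trans le; rewrite lerDl.
- by rewrite -linf_eq; apply: Mmax_linf.
- move=> i iI; have [iW|iW] := boolP (inW i); last first.
    by rewrite -level_out //; apply: Mmax_level; rewrite Iset_out.
  have [k kq ik] := split_window iW.
  have [|j jP pE] := hit_direction kq; first by left; rewrite -ik -IsetE.
  rewrite (window_Lev iW iI).
  have [ut|nu] := boolP (up D beta P p t).
    have [_ [s sW sI]] := window_hit jP pE ut.
    by rewrite -(window_Lev' jP pE sW sI); apply: Mmax_level.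
  have [s [st sI le]] := down_level jP pE nu.
  have sW : ~~ inW s by rewrite leqNgt st.
  apply: le_trans (_ : Lev' s <= _); last by apply: Mmax_level; rewrite Iset_out.
  by rewrite level_out //; apply: le_trans le; rewrite lerDl.
Qed.

Lemma before_insub (n : nat) (i : 'I_N) : (n <= N)%N ->
  before i (insub n) = (i < n)%N.
Proof.
rewrite leq_eqVlt => /orP[/eqP->|nN].
  by rewrite insubF ?ltnn //= ltn_ord.
by rewrite (insubT (fun k => k < N)%N nN).
Qed.

Lemma M_last : floor_at D beta P p N + (up D beta P p N)%:R <= M.
Proof.
by rewrite -(floor_last P bpos p lamc) -linfE; apply: Mmax_linf.
Qed.

Lemma M_lev i : (i < N)%N -> hits D beta P a i -> lev D beta P p i <= M.
Proof.
move=> iN h; have [s es] := ordinal_of iN.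
have sI : s \in I by rewrite IsetE es.
by rewrite -es -level_lev //; apply: Mmax_level.
Qed.

(* [n] is the position [m] of the maximum, or [N] when it is infinite. *)
Record extremal (n : nat) (k : 'I_N) : Prop := Extremal {
  ext_lt : (k < n)%N;
  ext_le : (n <= N)%N;
  ext_mpos : mpos D lam G J p = insub n;
  ext_kpos : kpos D lam G J p = Some k;
  ext_max : (n < N)%N -> [/\ P n, hits D beta P a n & lev D beta P p n = M];
  ext_first : forall i, (i < n)%N -> hits D beta P a i -> lev D beta P p i != M;
  ext_mem : k \in I;
  ext_unfolded : ~~ P k;
  ext_gap : forall i, (k < i < n)%N -> ~~ hits D beta P a i;
  ext_up : forall i, (k <= i <= n)%N -> up D beta P p i;
  ext_floor : floor_at D beta P p n + 1 = M
}.

(** If no hit attains [M], the final weight does. The floor at the end is below [M], so the sign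
    there is plus and [n = N] takes the role of [m]. *)
Lemma extremal_positions : 0 < M -> exists n k, extremal n k.
Proof.
move=> M0; have ML := M_last; have MV := M_lev.
have finish n : (n <= N)%N -> mpos D lam G J p = insub n ->
    ((n < N)%N -> [/\ P n, hits D beta P a n & lev D beta P p n = M]) ->
    (forall i, (i < n)%N -> hits D beta P a i -> lev D beta P p i != M) ->
    up D beta P p n -> floor_at D beta P p n + 1 = M -> exists k, extremal n k.
  move=> nN mE hm nolev un fn.
  have [k [kn hk gap nPk upk]] := pred_max bpos bwall fold_cover ML MV M0 nN un fn nolev.
  have [s es] := ordinal_of (leq_trans kn nN); subst k; exists s.
  have sI : s \in I by rewrite IsetE.
  split=> //; apply: kpos_some => //; first by rewrite mE before_insub.
  move=> i iI; rewrite mE before_insub // => i_n; rewrite leqNgt; apply/negP => ki.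
  by have := gap i; rewrite ki i_n -IsetE iI => /(_ isT).
have [[m [mI mM mmin]]|[nolev lM]] := mpos_cases D lam G J p.
  have mN := ltn_ord m.
  have hm : hits D beta P a m by rewrite -IsetE.
  have lm : lev D beta P p m = M by rewrite -level_lev.
  have nolev i : (i < m)%N -> hits D beta P a i -> lev D beta P p i != M.
    move=> im hi; have [s es] := ordinal_of (ltn_trans im mN).
    have sI : s \in I by rewrite IsetE es.
    apply/eqP; rewrite -es -level_lev // => /(mmin _ sI).
    by rewrite es leqNgt im.
  have [um Pm fm] := first_max bpos bwall fold_cover ML MV M0 mN hm lm nolev.
  exists m; apply: finish => //; first exact: ltnW.
  by rewrite valK; apply: mpos_some.
have nolev' i : (i < N)%N -> hits D beta P a i -> lev D beta P p i != M.
  move=> iN hi; have [s es] := ordinal_of iN.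
  have sI : s \in I by rewrite IsetE es.
  by rewrite -es -level_lev //; apply/eqP/nolev.
have lt := below_before bpos bwall fold_cover MV M0 (leqnn N) nolev'.
have lE : floor_at D beta P p N + (up D beta P p N)%:R = M.
  by rewrite -(floor_last P bpos p lamc) -linfE.
have uN : up D beta P p N.
  by apply: contraLR lt => nu; rewrite -lE (negbTE nu) addr0 ltxx.
exists N; apply: finish => //.
- by rewrite insubF ?ltnn //; apply: mpos_none.
- by rewrite ltnn.
- by rewrite -lE uN.
Qed.

Lemma root_opE (H : N.-tuple V) (A : {set 'I_N}) n (k : 'I_N) i :
  (n <= N)%N -> mpos D lam H A p = insub n -> kpos D lam H A p = Some k -> (i < N)%N ->
  nat_mem (root_op D lam H p A) i = (nat_mem A i && (i != n)) || (i == k).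
Proof.
move=> nN mE kE iN; have [s <-] := ordinal_of iN.
have eqS (x w : 'I_N) : (Some x == Some w) = (val w == val x).
  by apply/eqP/eqP => [[->]|/val_inj->].
rewrite !nat_memE !inE mE kE eqS; congr (_ || _); rewrite andbC; congr (_ && ~~ _).
move: nN; rewrite leq_eqVlt => /orP[/eqP->|nN].
  by rewrite insubF ?ltnn //= ltn_eqF.
by rewrite (insubT (fun k => k < N)%N nN) eqS.
Qed.

(** A simple reflection changes the sign of no root other than [a] and [- a]. *)
Lemma ninv_flip f : W f -> (forall i, (i < q)%N -> f (g i) <> a /\ f (g i) <> - a) ->
  window_ninv D beta t q (refl a \o f) = window_ninv D beta t q f.
Proof.
move=> gf ne; apply: eq_in_count => i; rewrite mem_iota /= => iq; congr (~~ _).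
have [n1 n2] := ne i iq.
have gP : f (g i) \in Defs.roots D by apply: weyl_root => //; apply/pos_root/bpos/window_lt.
have rP : refl a (f (g i)) \in Defs.roots D.
  by apply: weyl_root => //; apply/weyl_refl/simple_root.
apply/asboolP/asboolP => [h|h]; last exact: simple_permutes.
apply: contrapT => /(neg_posP gP) nf; apply: (posN h).
by rewrite -(reflNx ipP); apply: simple_permutes => // e; apply: n2; rewrite -e opprK.
Qed.

(** * Commutation, by the place of m and k relative to the window *)

Section Commutation.
Variables (n : nat) (k : 'I_N).
Hypothesis ext : extremal n k.
Let kn := ext_lt ext.
Let nN := ext_le ext.
Let n_max := ext_max ext.
Let nolev := ext_first ext.
Let kI := ext_mem ext.
Let gap := ext_gap ext.
Let upk := ext_up ext.
Local Notation K := (root_op D lam G p J).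

Let KE i : (i < N)%N -> nat_mem K i = (P i && (i != n)) || (i == k).
Proof. exact: (root_opE nN (ext_mpos ext) (ext_kpos ext)). Qed.

Lemma gprod_root_op i : (i <= N)%N -> gprod D beta (nat_mem K) i =
  if (k < i <= n)%N then refl a \o gprod D beta P i else gprod D beta P i.
Proof.
apply: (gprod_flip bpos kn (ltn_ord k) (ext_unfolded ext) KE).
  have h : hits D beta P a k by rewrite -IsetE.
  by apply/eqP; rewrite -(hit_up bpos (ltn_ord k) h) upk // leqnn ltnW.
move=> nN'; have [Pn hn _] := n_max nN'; split=> //.
exact: (fold_dir bpos fold_cover nN' hn Pn).
Qed.

Lemma no_early_level (i : 'I_N) : (i < n)%N -> i \in I -> Lev i <> M.
Proof.
move=> i_n iI; rewrite level_lev //; apply/eqP; apply: nolev => //.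
by rewrite -IsetE.
Qed.

Lemma no_gap_index (i : 'I_N) : (k < i < n)%N -> i \notin I.
Proof. by move=> h; rewrite IsetE; apply: gap. Qed.

(** Reduces the claim to the window: outside it suffices that the changed positions coincide, inside
    an identity between lists in the Yang-Baxter table remains. *)
Lemma commute_at n' (k' : 'I_N) : (n' <= N)%N ->
  mpos D lam G' J' p = insub n' -> kpos D lam G' J' p = Some k' ->
  (forall i, ~~ inW i -> (i == n') = (i == n) /\ (i == k') = (i == k)) ->
  (forall i, (i < q)%N ->
    (i.+1 \in yb_invol q (window_ninv D beta t q (gprod D beta (nat_mem K) t))
       (window_ninv D beta t q (gprod D beta (nat_mem K) (t + q)))
       [seq x <- iota 1 q | nat_mem K (t + x.-1)]) =
    ((i.+1 \in T) && (t + i != n')%N) || (t + i == k')%N) ->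
  Y K = root_op D lam G' p J'.
Proof.
move=> n'N mE' kE' out segment_window; apply/setP => s; have sN := ltn_ord s.
have e1 := yang_baxterE K sN; have e2 := root_opE n'N mE' kE' sN.
rewrite nat_memE in e1; rewrite nat_memE in e2; rewrite e1 e2 {e1 e2}.
case: ifP => sW.
  have [i iq es] := split_window sW.
  by rewrite es addKn segment_window // yang_in_window.
have [-> ->] := out s (negbT sW).
by rewrite KE // yang_outside // sW.
Qed.

Lemma no_early_level' (i : 'I_N) : ~~ inW n -> (i < n)%N -> i \in I' -> Lev' i <> M.
Proof.
move=> nW i_n iI' eM; have [iW|iW] := boolP (inW i); last first.
  by apply: (no_early_level i_n); rewrite -?level_out // -Iset_out.
have [x xq ix] := split_window iW.
have [|j jP pE] := hit_direction xq; first by right; rewrite -ix -IsetE.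
rewrite (window_Lev' jP pE iW iI') in eM.
have [ut|nu] := boolP (up D beta P p t).
  have [[s sW sI] _] := window_hit jP pE ut.
  apply: (@no_early_level s _ sI); last by rewrite (window_Lev sW sI).
  by clear -sW iW nW i_n; lia.
have [s [_ sI le]] := down_level jP pE nu.
by have := Mmax_level lam sI; rewrite leNgt (lt_le_trans _ le) // eM ltrDl.
Qed.

Lemma mpos_out : ~~ inW n -> mpos D lam G' J' p = insub n.
Proof.
move=> nW; have [nN'|Nn] := ltnP n N; last first.
  have eN : n = N by apply/eqP; rewrite eqn_leq nN.
  rewrite insubF ?eN ?ltnn //; apply: mpos_none => i iI'; rewrite Mmax_same.
  by apply: no_early_level' => //; rewrite eN ltn_ord.
have [_ hn ln] := n_max nN'.
rewrite (insubT (fun k => k < N)%N nN').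
set s := Sub _ _; have es : val s = n by [].
have sI : s \in I by rewrite IsetE es.
apply: mpos_some.
- by rewrite Iset_out ?es.
- by rewrite level_out ?es // Mmax_same level_lev.
- move=> i iI'; rewrite Mmax_same es leqNgt => e; apply/negP => i_n.
  exact: (no_early_level' nW i_n iI' e).
Qed.

Lemma commute_window_max : inW n -> Y K = root_op D lam G' p J'.
Proof.
move=> nW; have [m0 m0q en] := split_window nW.
have nN' : (n < N)%N by rewrite en window_lt.
have [Pn hn ln] := n_max nN'.
have [|j jP pE] := hit_direction m0q; first by left; rewrite -en.
have lw i : (i < q)%N -> hits D beta P a (t + i) -> lev D beta P p (t + i) = Lw.
  by move=> iq h; apply: (window_lev segment_window zP iq h).
have eLw : Lw = M by rewrite -ln en lw // -en.
(* All hits in the window share the level [M], so a predecessor inside it would attain the maximum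
   before [m]. *)
have kt : (k < t)%N.
  rewrite ltnNge; apply/negP => tk; apply: (no_early_level kn kI).
  by rewrite window_Lev // tk; clear -kn nW; lia.
have ut : up D beta P p t by apply: upk; clear -kt nW; lia.
(* With sign plus at the exit the floor there would be [M], and [up_below] would give a level above
   the maximum. *)
have nutq : ~~ up D beta P p (t + q).
  apply/negP => u'; have := up_below bpos bwall fold_cover M_last M_lev tqN u'.
  by rewrite (floor_end jP pE) u' subr0 eLw gerDl ler10.
have ut' := ut; rewrite (up_start jP pE) in ut'.
have nutq' := nutq; rewrite (up_end jP pE) in nutq'.
have [h1 h2 /(_ nutq') h3 _] := direction_check jP ut'.
(* The fold [m] is the earliest hit of the window, because an earlier one would also have level
   [M]. *)
have e0 : head 0%N (whits q (iota 0 q) S d j) = m0.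
  rewrite (whitsE jP pE) in h1 *; have [hq hh hmin] := head_filter_iota h1.
  have [lt|lt|//] := ltngtP (head 0%N [seq i <- iota 0 q | hits D beta P a (t + i)]) m0.
    have := nolev (i := t + head 0%N [seq i <- iota 0 q | hits D beta P a (t + i)]).
    by rewrite lw // eLw eqxx en ltn_add2l => /(_ lt hh).
  by have := hmin _ lt; rewrite -en hn.
rewrite e0 (whits_reverse jP pE) in h3; rewrite (whits_reverse jP pE) in h2.
have [m'q hm' m'min] := head_filter_iota h2.
move: (head 0%N _) m'q hm' m'min h3 => m' m'q hm' m'min h3.
have n'N := window_lt m'q.
pose s := Ordinal n'N.
have sI : s \in I' by rewrite IsetE.
have sW : inW s := inW_add m'q.
have early i : i \in I' -> (i < s)%N -> (i < t)%N /\ i \in I.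
  move=> iI' lt; have it : (i < t)%N.
    rewrite ltnNge; apply/negP => ti.
    have [x xq ix] : exists2 x, (x < q)%N & val i = (t + x)%N.
      by apply: split_window; rewrite ti (ltn_trans lt) //; case/andP: sW.
    have := m'min x; rewrite -(ltn_add2l t) -ix lt => /(_ isT).
    by rewrite -IsetE iI'.
  by split=> //; rewrite -Iset_out // negb_and -ltnNge it.
have mE' : mpos D lam G' J' p = insub (t + m')%N.
  rewrite -[(t + m')%N]/(val s) valK; apply: mpos_some => //.
    by rewrite (window_Lev' jP pE sW sI) Mmax_same.
  move=> i iI' ei; rewrite leqNgt; apply/negP => lt.
  have [it iI] := early i iI' lt.
  apply: (@no_early_level i _ iI); first by clear -it nW; lia.
  by rewrite -level_out ?ei ?Mmax_same // negb_and -ltnNge it.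
have kE' : kpos D lam G' J' p = Some k.
  apply: kpos_some.
  - by rewrite Iset_out // negb_and -ltnNge kt.
  - by rewrite mE' before_insub ?(ltnW n'N) // ltn_addr.
  - move=> i iI'; rewrite mE' before_insub ?(ltnW n'N) // => lt.
    have [it iI] := early i iI' lt; rewrite leqNgt; apply/negP => ki.
    have := no_gap_index (i := i); rewrite iI ki /=.
    by move/(_ (leq_trans it (proj1 (andP nW)))).
apply: (commute_at (ltnW n'N) mE' kE').
- move=> i iW; split=> //; apply/eqP/eqP => e; move: iW; rewrite e ?nW //.
  by rewrite inW_add.
- move=> i iq; rewrite (gprod_root_op window_start_le) (gprod_root_op tqN).
  have -> : (k < t <= n)%N by rewrite kt; case/andP: nW.
  have -> : (k < t + q <= n)%N = false by clear -nW; lia.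
  rewrite (models_lmul segment_window min_rep_pos dP (direction_lt jP) pE) ninv_w.
  have -> : [seq x <- iota 1 q | nat_mem K (t + x.-1)] =
      [seq x <- iota 1 q | (x \in S) && (x != m0.+1)].
    apply: eq_in_filter => x; rewrite mem_iota => /andP[x0 xq].
    have xq' : (x.-1 < q)%N by clear -x0 xq; lia.
    rewrite (KE (window_lt xq')) (fold_in_window xq') (prednK x0).
    have -> : (t + x.-1 == k)%N = false by clear -kt; lia.
    by rewrite orbF en eqn_add2l -(prednK x0) eqSS.
  have /allP/(_ i) := h3; rewrite mem_iota => /(_ iq)/eqP /= ->.
  have -> : (t + i == k)%N = false by clear -kt; lia.
  by rewrite eqn_add2l eqSS orbF.
Qed.

Lemma outside_pred (i : 'I_N) : ~~ inW n -> (i < n)%N -> ~~ inW i ->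
  i \in I' -> (i <= k)%N.
Proof.
move=> nW i_n iW iI'; rewrite leqNgt; apply/negP => ki.
by have := no_gap_index (i := i); rewrite ki i_n -Iset_out // iI' => /(_ isT).
Qed.

Lemma floor_before i : (k < i <= n)%N -> floor_at D beta P p i + 1 = M.
Proof.
move=> /andP[ki i_n]; rewrite -(ext_floor ext); congr (_ + 1).
suff step x : (i + x <= n)%N -> floor_at D beta P p (i + x) = floor_at D beta P p i.
  by rewrite -(step (n - i)%N) subnKC.
elim: x => [|x IH]; first by rewrite addn0.
rewrite addnS => xn; rewrite -IH ?(ltnW xn) //.
have xN : (i + x < N)%N := leq_trans xn nN.
rewrite (floor_nohit bpos bwall xN) //.
by apply: gap; rewrite xn andbT (leq_trans ki) // leq_addr.
Qed.

Lemma commute_window_pred : ~~ inW n -> inW k -> Y K = root_op D lam G' p J'.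
Proof.
move=> nW kW; have [k0 k0q ek] := split_window kW.
have tqn : (t + q <= n)%N by clear -nW kW kn; lia.
have tk : (t <= k < t + q)%N := kW.
have hk : hits D beta P a (t + k0) by rewrite -ek -IsetE.
have [|j jP pE] := hit_direction k0q; first by left.
have utq : up D beta P p (t + q) by apply: upk; clear -tk tqn; lia.
(* No hit occurs between [k] and [n], so the floor at the exit is already [M - 1], which is the
   level of the window when the sign is plus. *)
have eLw : Lw + 1 = M.
  by rewrite -(floor_before (i := t + q)) ?(floor_end jP pE) ?utq ?subr0 //; clear -tk tqn; lia.
(* Sign minus would give a hit before the window of level at least [Lw + 1 = M], hence earlier than
   [n]. *)
have ut : up D beta P p t.
  apply: contraT => nu; have [s [st sI]] := down_level jP pE nu.
  rewrite eLw => le; case: (@no_early_level s _ sI); first by clear -st tqn; lia.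
  by apply/eqP; rewrite eq_le le Mmax_level.
have ut' := ut; rewrite (up_start jP pE) in ut'.
have utq' := utq; rewrite (up_end jP pE) in utq'.
have [h1 h2 _ /(_ utq') h4] := direction_check jP ut'.
have e0 : last 0%N (whits q (iota 0 q) S d j) = k0.
  rewrite (whitsE jP pE) in h1 *; have [lq hl lmax] := last_filter_iota h1.
  move: (last 0%N _) lq hl lmax => l lq hl lmax.
  have [lt|lt|//] := ltngtP l k0.
    by have := lmax k0; rewrite lt k0q hk => /(_ isT).
  have := gap (i := t + l); rewrite ek ltn_add2l lt hl.
  have -> : (t + l < n)%N by clear -lq tqn; lia.
  by move/(_ isT).
rewrite e0 (whits_reverse jP pE) in h4; rewrite (whits_reverse jP pE) in h2.
have [k'q hk' k'max] := last_filter_iota h2.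
move: (last 0%N _) k'q hk' k'max h4 => k' k'q hk' k'max h4.
pose s := Ordinal (window_lt k'q).
have sI : s \in I' by rewrite IsetE.
have mE' := mpos_out nW.
have kE' : kpos D lam G' J' p = Some s.
  apply: kpos_some => //.
    by rewrite mE' before_insub //=; clear -k'q tqn; lia.
  move=> i iI'; rewrite mE' before_insub // => i_n.
  have [iW|iW] := boolP (inW i); last first.
    by have := outside_pred nW i_n iW iI'; clear -iW tk; rewrite /=; lia.
  have [x xq ix] := split_window iW.
  rewrite /= ix leq_add2l leqNgt; apply/negP => lt.
  by have := k'max x; rewrite lt xq -ix -IsetE iI' => /(_ isT).
apply: (commute_at nN mE' kE').
- move=> i iW; split=> //; apply/eqP/eqP => e; move: iW; rewrite e ?kW //.
  by rewrite inW_add.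
- move=> i iq; rewrite (gprod_root_op window_start_le) (gprod_root_op tqN).
  have -> : (k < t <= n)%N = false by clear -tk; lia.
  have -> : (k < t + q <= n)%N by clear -tk tqn; lia.
  rewrite ninv_u (models_lmul segment_window min_rep_pos yP (direction_lt jP) pE).
  have -> : [seq x <- iota 1 q | nat_mem K (t + x.-1)] =
      [seq x <- iota 1 q | (x \in S) || (x == k0.+1)].
    apply: eq_in_filter => x; rewrite mem_iota => /andP[x0 xq].
    have xq' : (x.-1 < q)%N by clear -x0 xq; lia.
    rewrite (KE (window_lt xq')) (fold_in_window xq') (prednK x0).
    have -> : (t + x.-1 != n)%N by clear -xq' tqn; lia.
    by rewrite andbT ek eqn_add2l -(prednK x0) eqSS.
  have /allP/(_ i) := h4; rewrite mem_iota => /(_ iq)/eqP /= ->.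
  have -> : (t + i != n)%N by clear -iq tqn; lia.
  by rewrite andbT eqn_add2l eqSS.
Qed.

(** The operator leaves the folds in the window alone. If the window lies between [k] and [n], both
    of its end products acquire the simple reflection on the left, but neither sends a window root
    to [a] or [- a], so the inversion numbers persist. Otherwise the products are unchanged. *)
Lemma commute_outside : ~~ inW n -> ~~ inW k -> Y K = root_op D lam G' p J'.
Proof.
move=> nW kW; have mE' := mpos_out nW.
have no_window i : (k < t)%N -> (t + q <= n)%N -> inW i -> ~~ hits D beta P a i.
  by move=> kt tqn iW; apply: gap; clear -kt tqn iW; lia.
(* The sign is plus all the way from [k] to [n], so an extreme root in the direction of [a] would
   produce a hit in the gap. *)
have no_dir j : (k < t)%N -> (t + q <= n)%N -> j \in [:: 0; q.-1]%N -> a <> v (g j).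
  move=> kt tqn jP pE.
  have ut : up D beta P p t by apply: upk; clear -kt tqn; lia.
  have [[s sW sI] _] := window_hit jP pE ut.
  by have := no_window s kt tqn sW; rewrite -IsetE sI.
have kE' : kpos D lam G' J' p = Some k.
  apply: kpos_some.
  - by rewrite Iset_out.
  - by rewrite mE' before_insub.
  - move=> i iI'; rewrite mE' before_insub // => i_n.
    have [iW|iW] := boolP (inW i); last exact: outside_pred.
    rewrite leqNgt; apply/negP => ki.
    have kt : (k < t)%N by clear -ki iW kW; lia.
    have tqn : (t + q <= n)%N by clear -i_n iW nW; lia.
    have [x xq ix] := split_window iW.
    have [|j jP pE] := hit_direction xq; first by right; rewrite -ix -IsetE.
    exact: no_dir kt tqn jP pE.
apply: (commute_at nN mE' kE') => // i iq.
have -> : (t + i != n)%N by apply: contraNneq nW => <-; apply: inW_add.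
have -> : (t + i == k)%N = false.
  by apply/negbTE; apply: contraNneq kW => <-; apply: inW_add.
rewrite orbF andbT.
have -> : [seq x <- iota 1 q | nat_mem K (t + x.-1)] = S.
  apply: eq_in_filter => x; rewrite mem_iota => /andP[x0 xq].
  have xq' : (x.-1 < q)%N by clear -x0 xq; lia.
  rewrite (KE (window_lt xq')).
  have -> : (t + x.-1 != n)%N by apply: contraNneq nW => <-; apply: inW_add.
  have -> : (t + x.-1 == k)%N = false.
    by apply/negbTE; apply: contraNneq kW => <-; apply: inW_add.
  by rewrite andbT orbF.
rewrite (gprod_root_op window_start_le) (gprod_root_op tqN).
have [/andP[kt tqn]|out] := boolP ((k < t) && (t + q <= n))%N; last first.
  have -> : (k < t <= n)%N = false by clear -out nW q2; lia.
  have -> : (k < t + q <= n)%N = false by clear -out kW q2; lia.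
  by rewrite ninv_u ninv_w.
have -> : (k < t <= n)%N by clear -kt tqn; lia.
have -> : (k < t + q <= n)%N by clear -kt tqn; lia.
have q2q x : (x < q)%N -> (x < 2 * q)%N by move=> xq; apply: leq_trans xq _; rewrite leq_pmull.
have noroot f e : models beta t q v f e ->
    forall x, (x < q)%N -> f (g x) <> a /\ f (g x) <> - a.
  move=> md x xq; apply/not_orP => h.
  have [|j jP pE] := models_simple segment_window (p := p) min_rep_pos md (q2q _ xq).
    by rewrite /window_root xq.
  exact: no_dir kt tqn jP pE.
rewrite (ninv_flip gprod_start_weyl (noroot _ _ dP)) ninv_u.
by rewrite (ninv_flip (gprod_weyl P bpos tqN) (noroot _ _ yP)) ninv_w.
Qed.

End Commutation.

Lemma root_op_commutes : 0 < M -> Y (root_op D lam G p J) = root_op D lam G' p J'.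
Proof.
move=> /extremal_positions[n [k ext]].
have [nW|nW] := boolP (inW n); first exact: (commute_window_max ext nW).
have [kW|kW] := boolP (inW k); first exact: (commute_window_pred ext nW kW).
exact: (commute_outside ext nW kW).
Qed.

End Admissible.

End Final.

Theorem theorem4p7 (R : realType) (r : nat) (D : root_system R r)
    (lam : 'rV[R]_r) (N : nat) (G : N.-tuple 'rV[R]_r)
    (t q : nat) (Psi : seq 'rV[R]_r) :
  dominant_weight D lam ->
  lambda_chain D lam G ->
  (2 <= q)%N -> (t + q <= N)%N ->
  rank2_subsystem D Psi ->
  uniq (segment G t q) ->
  (forall b, b \in segment G t q <-> b \in Psi /\ positive D b) ->
  forall (p : 'I_r) (J : {set 'I_N}), admissible D G J ->
    let G' := reverse_segment G t q in
    let Y := yang_baxter D G t q in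
    (root_op_defined D lam G p J <-> root_op_defined D lam G' p (Y J)) /\
    (root_op_defined D lam G p J -> Y (root_op D lam G p J) = root_op D lam G' p (Y J)).
Proof.
move=> dom chain q2 tqN PsiP su sP p J adm G' Y.
have w := segment_window chain q2 tqN PsiP su sP.
have gu := gprod_weyl (nat_mem J) (chain_pos chain) (window_start_le tqN).
have [_ [x gx ex]] := min_rep_spec w (G := G) (fun=> erefl) gu.
(* The identity row models the coset representative; multiplying by the element [x] of [Wbar] gives
   a row [d] for the product at the entry of the window. *)
have mid := models_id w (min_rep D G t q (gprod D (nth 0 G) (nat_mem J) t)).
have [d dP] := models_Wbar w mid gx.
rewrite -ex in dP.
have [_ _ [z zP] _ _] := window_structure w.
have MM := Mmax_same chain q2 tqN PsiP su sP p adm dP zP.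
split; first by rewrite /root_op_defined MM.
exact: (root_op_commutes dom chain q2 tqN PsiP su sP adm dP zP).
Qed.
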